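(* Let $n\ge 1$ and let $\mathcal{N}=(M_1,\ldots,M_n)$ be a necklace of order $n$. Then there exists a completely generic (monic, degree $n$, complex) polynomial $f$ such that $\mathcal{N}=\mathcal{N}(f)$.
   Context: **Matchings.** A matching on a set of size $2n$ is a partition of it into $n$ subsets of size $2$ (pairs). For integers $a,b$, $\langle a,b\rangle$ is the set of integers in $[a,b]$. Two blocks of a partition of a subset of $\mathbb{R}$ cross if there are elements $i<j<k<\ell$ with $i,k$ in one block and $j,\ell$ in the other; a partition is noncrossing if no two blocks cross. Noncrossing matchings of order $n$ are taken on $\langle 0,2n-1\rangle$. $M'$ is a flip of $M$ if $M'$ is obtained from $M$ by replacing two pairs $\{i,j\},\{k,\ell\}$ of $M$ by $\{i,\ell\},\{j,k\}$. For an integer $e$, $M(e)$ denotes the matching in which $i+e,j+e$ are matched if and only if $i,j$ are matched in $M$ (addition modulo $2n$). A necklace of order $n$ is an $n$-tuple $(M_1,\ldots,M_n)$ of noncrossing matchings on $\langle 0,2n-1\rangle$ such that $M_{s+1}$ is a flip of $M_s$ for $1\le s<n$ and $M_n=M_1(-1)$. **Curves.** Let $f$ be a monic complex polynomial of degree $n$ with no double roots. For $\theta\in\mathbb{R}/\pi\mathbb{Z}$ (with representatives $\theta\in[0,\pi)$) let $C_\theta(f)=\{z\in\mathbb{C}:\operatorname{Im}(e^{-i\theta}f(z))=0\}$. It is singular if and only if it contains a root of $f'$; this occurs for at most $n-1$ values of $\theta$ modulo $\pi$. The curve $C_\theta(f)$ has $2n$ asymptotes, at angles $\frac{\pi k+\theta}{n}$,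 $0\le k\le 2n-1$; a connected component contains the asymptote at angle $\varphi$ if it contains points $z$ with $|z|\to\infty$ and $\arg z\to\varphi$. If $C_\theta(f)$ is nonsingular, it has $n$ connected components, each homeomorphic to $\mathbb{R}$ and containing two of the asymptotes, and $M_\theta(f)$ is the (noncrossing) matching on $\langle 0,2n-1\rangle$ in which $k,k'$ are matched if and only if the asymptotes at angles $\frac{\pi k+\theta}{n}$ and $\frac{\pi k'+\theta}{n}$ lie on the same component. **Completely generic polynomials.** A monic polynomial $f$ of degree $n$ is completely generic if it has no double roots, $C_\theta(f)$ is singular for exactly $n-1$ values of $\theta\in\mathbb{R}/\pi\mathbb{Z}$, and $C_0(f)$ is nonsingular. For such $f$, let $0<\theta_1<\cdots<\theta_{n-1}<\pi$ be the values for which $C_\theta(f)$ is singular, and put $\theta_0=0$, $\theta_n=\pi$. The matching $M_\theta(f)$ is constant on $(\theta_{s-1},\theta_s)$; call it $M(f)_s$. Then $\mathcal{N}(f)=(M(f)_1,\ldots,M(f)_n)$. *)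

(* Defs.v *)
From HB Require Import structures.
From mathcomp Require Import all_boot all_order all_algebra.
From mathcomp Require Import finmap.
From mathcomp Require Import all_classical all_reals all_analysis.
From mathcomp Require Import complex.

Set Implicit Arguments.
Unset Strict Implicit.
Unset Printing Implicit Defensive.

Import Order.TTheory GRing.Theory Num.Theory.
Import numFieldNormedType.Exports.

Local Open Scope complex_scope.
Local Open Scope ring_scope.

(* A matching on <0, N-1> is given by its set of blocks. *)
Definition is_matching (N : nat) (M : {set {set 'I_N}}) : Prop :=
  finset.partition M [set: 'I_N]%SET /\ (forall B, B \in M -> #|B| = 2%N).

Definition crossing (N : nat) (A B : {set 'I_N}) : Prop :=
  exists i j k l : 'I_N,
    [/\ (i < j)%N, (j < k)%N & (k < l)%N] /\
    [/\ i \in A, k \in A, j \in B & l \in B].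

Definition noncrossing (N : nat) (M : {set {set 'I_N}}) : Prop :=
  forall A B, A \in M -> B \in M -> A <> B -> ~ crossing A B.

Definition is_flip (N : nat) (M M' : {set {set 'I_N}}) : Prop :=
  exists i j k l : 'I_N,
    [/\ [set i; j]%SET \in M, [set k; l]%SET \in M,
        [set i; j]%SET <> [set k; l]%SET
      & M' = (M :\: [set [set i; j]; [set k; l]]
                :|: [set [set i; l]; [set j; k]])%SET].

Lemma add_mod_subproof (N : nat) (i : 'I_N) (e : int) :
  (`|((i%:Z + e) %% N%:Z)%Z| < N)%N.
Proof.
have N0 : (0 < N)%N by apply: leq_ltn_trans (ltn_ord i).
rewrite -ltz_nat gez0_abs; first exact: ltz_pmod.
by apply: modz_ge0; rewrite eqz_nat -lt0n.
Qed.

Definition add_mod (N : nat) (e : int) (i : 'I_N) : 'I_N :=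
  Ordinal (add_mod_subproof i e).

(* M(e) *)
Definition rotate (N : nat) (M : {set {set 'I_N}}) (e : int) :
  {set {set 'I_N}} := [set add_mod e @: B | B : {set 'I_N} in M]%SET.

(* The tuple is indexed from 0, so M_s is entry s - 1. *)
Definition necklace (n : nat) (M : n.-tuple {set {set 'I_(2 * n)}}) : Prop :=
  [/\ forall s, (s < n)%N ->
        is_matching (nth finset.set0 M s) /\ noncrossing (nth finset.set0 M s),
      forall s, (s.+1 < n)%N ->
        is_flip (nth finset.set0 M s) (nth finset.set0 M s.+1)
    & nth finset.set0 M n.-1 = rotate (nth finset.set0 M 0) (-1)].

(* e^(i t) *)
Definition cexp (R : realType) (t : R) : R[i] := cos t +i* sin t.

Local Open Scope classical_set_scope.
Local Open Scope card_scope.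

(* The regular algebra R[i]^o carries the topology of the complex norm. *)
Definition curve (R : realType) (f : {poly R[i]}) (theta : R) : set R[i]^o :=
  [set z : R[i] | complex.Im (cexp (- theta) * f.[z]) = 0].

(* By the Cauchy-Riemann equations, Im(e^(-i theta) f) has vanishing
   differential exactly at the roots of f'. *)
Definition singular_curve (R : realType) (f : {poly R[i]}) (theta : R) : Prop :=
  exists2 z : R[i], curve f theta z & root f^`() z.

Definition is_component (T : topologicalType) (A K : set T) : Prop :=
  exists2 z, A z & K = connected_component A z.

(* The points r m * e^(i t m) have modulus r m and argument t m (mod 2 pi). *)
Definition has_asymptote (R : realType) (K : set R[i]^o) (phi : R) : Prop :=
  exists r t : nat -> R,
    [/\ forall m, 0 < r m /\ K ((r m)%:C * cexp (t m)),
        r @ \oo --> +oo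
      & t @ \oo --> phi].

Definition asymptote_angle (R : realType) (n : nat) (theta : R) (k : nat) : R :=
  (pi * k%:R + theta) / n%:R.

(* M_theta(f) *)
Definition curve_matching (R : realType) (n : nat) (f : {poly R[i]}) (theta : R)
    : {set {set 'I_(2 * n)}} :=
  finset (fun B : {set 'I_(2 * n)} =>
    `[< exists k k' : 'I_(2 * n),
          [/\ k <> k', B = [set k; k']%SET
            & exists K, [/\ is_component (curve f theta) K,
                            has_asymptote K (asymptote_angle n theta k)
                          & has_asymptote K (asymptote_angle n theta k')]] >]).

(* R / pi Z is represented by [0, pi). *)
Definition singular_angles (R : realType) (f : {poly R[i]}) : set R :=
  [set theta | 0 <= theta < pi /\ singular_curve f theta].

Definition completely_generic (R : realType) (n : nat) (f : {poly R[i]}) : Prop :=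
  [/\ f \is monic, size f = n.+1,
      forall z, (mup z f <= 1)%N,
      singular_angles f #= `I_n.-1
    & ~ singular_curve f 0].

(* theta_0 = 0, theta_1 < ... < theta_(n-1) the singular angles in increasing
   order, and theta_n = pi (as the default value of nth). *)
Definition angle_seq (R : realType) (f : {poly R[i]}) (s : nat) : R :=
  nth pi (0 :: sort <=%R (fset_set (singular_angles f))) s.

(* M(f)_(s+1): the constant value of M_theta(f) for
   theta_s < theta < theta_(s+1); the empty set is returned if M_theta(f) is
   not constant there, which is not a matching for n >= 1. *)
Definition matching_at (R : realType) (n : nat) (f : {poly R[i]}) (s : nat)
    : {set {set 'I_(2 * n)}} :=
  xget finset.set0
    [set M | forall theta, angle_seq f s < theta < angle_seq f s.+1 ->
               curve_matching n f theta = M].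

(* N(f) *)
Definition necklace_of (R : realType) (n : nat) (f : {poly R[i]})
    : n.-tuple {set {set 'I_(2 * n)}} :=
  [tuple matching_at n f s | s < n].

(* Main.v *)
Require Import Defs.
From mathcomp Require Import all_boot all_order all_algebra.
From mathcomp Require Import finmap.
From mathcomp Require Import all_classical all_reals all_analysis.
From mathcomp Require Import complex.
From mathcomp Require Import zify ring lra.

Set Implicit Arguments.
Unset Strict Implicit.
Unset Printing Implicit Defensive.

(** At a nonsingular angle th the component of the curve through a root z of f
    is the union of two lifts of rays, on which f takes the values t e^(i th)
    and - t e^(i th), so the pairs of the matching correspond to the roots.

    In a necklace of order n >= 2 some label j is matched with j + 1 up to some
    time and with j - 1 afterwards: each flip alters two of the n pairs, there
    are only n - 1 flips, so some pair is altered at most once, and planarity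
    together with M_n = M_1(-1) forces it to be such a leaf.  Removing the leaf
    yields a necklace of order n - 1, realized by some g by induction.  After
    rotating the leaf to j = 0 and its flip to the angle 0, the polynomial
    g (X - w) with w -> +oo realizes the original necklace at sample angles:
    near the roots of g its curve follows that of g, and further out its ends
    are located by following the argument of z^(n-1) (w - z) in each half plane.

    Finally, consecutive sampled matchings differ, so each of the n - 1 gaps
    between samples contains a singular angle; as f' has n - 1 roots there are
    no others, and the matchings are constant in between. *)

(** * Pairings and necklaces as partner functions *)

Section Combinatorics.

(** The obstacle is uniformity: the estimates for g (X - w) degenerate as the sine of the angle
    tends to 0. This is why only finitely many sample angles are followed, so that one large w
    serves them all, and why the singular angles are counted afterwards and never located. The flip
    is turned to the angle 0 because w lies on the real axis: the critical point created by w is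
    near w N / (N + 1), where N is the degree of g, and its critical value is nearly real, so at an
    angle with nonzero sine the new curve is nonsingular for large w. Preimages come from factoring
    f - c into linear factors, their local uniqueness from a Taylor estimate away from the critical
    points, and continuation from intermediate value arguments with a barrier. The sheet through w
    is not followed: it gets the two labels that the roots of g leave over, since distinct roots
    have distinct ends. *)

Definition pairing (N : nat) (p : nat -> nat) : Prop :=
  forall i, i < N -> [/\ p i < N, p i <> i & p (p i) = i].

Definition planar (N : nat) (p : nat -> nat) : Prop :=
  forall i j, i < N -> j < N -> i < j -> j < p i -> i < p j /\ p j < p i.

(** Strict cyclic order i, a, b on the circle of labels. Planarity and flips are invariant under
    rotation, which the order [<] does not show, so both are handled through this relation. *)
Definition cyc (i a b : nat) : bool :=
  [|| (i < a) && (a < b), (a < b) && (b < i) | (b < i) && (i < a)].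

(* Old pairs {w, x}, {y, z}, new pairs {w, z}, {y, x}: the cyclic order is
   w, x, y, z, so the partners of w and y move forward. *)
Definition flipped (N : nat) (p q : nat -> nat) : Prop :=
  exists w x y z,
    [/\ [/\ w < N, x < N, y < N & z < N],
        [/\ p w = x, p y = z, q w = z & q y = x],
        cyc w x z, cyc y z x
      & forall i, i < N -> i <> w -> i <> x -> i <> y -> i <> z -> q i = p i].

Definition up (N i : nat) : nat := if i.+1 == N then 0 else i.+1.
Definition dn (N i : nat) : nat := if i == 0 then N.-1 else i.-1.

Definition pnecklace (n : nat) (p : nat -> nat -> nat) : Prop :=
  [/\ forall s, s < n -> pairing (2 * n) (p s) /\ planar (2 * n) (p s),
      forall s, s.+1 < n -> flipped (2 * n) (p s) (p s.+1)
    & forall i, i < 2 * n -> p n.-1 i = dn (2 * n) (p 0 (up (2 * n) i))].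

(** If i < p i, this is [planar] at i. If p i < i, the contrapositive of [planar] at p i, applied to
    p j, keeps p j off the interval from p i to i. *)
Lemma planar_cyc N p i j : pairing N p -> planar N p -> i < N -> j < N ->
  cyc i j (p i) -> cyc i (p j) (p i).
Proof.
move=> pp pl iN jN; have [piN pi ppi] := pp _ iN; have [pjN pj ppj] := pp _ jN.
have e1 : p j = i -> j = p i by move=> h; rewrite -ppj h.
have e2 : p j = p i -> j = i by move=> h; rewrite -ppj h ppi.
case/or3P => /andP[h1 h2]; rewrite /cyc.
- by have := pl _ _ iN jN h1 h2; lia.
- by have := pl _ _ piN pjN; rewrite ppi ppj; lia.
- by have := pl _ _ piN pjN; rewrite ppi ppj; lia.
Qed.

(** A flip of sets of pairs carries no orientation. Planarity of the old and the new matching leaves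
    only the cyclic order i, j, k, l or its reverse; in the second case the names are exchanged
    within both old pairs. *)
Lemma flipped_intro N p q i j k l :
  pairing N p -> planar N p -> pairing N q -> planar N q ->
  i < N -> k < N -> p i = j -> p k = l -> q i = l -> q j = k ->
  i <> k -> i <> l ->
  (forall x, x < N -> x <> i -> x <> j -> x <> k -> x <> l -> q x = p x) ->
  flipped N p q.
Proof.
move=> pp plp pq plq iN kN pij pkl qil qjk ik il rest.
have [jN ji pj] := pp _ iN; rewrite pij in jN ji pj.
have [lN lk pl] := pp _ kN; rewrite pkl in lN lk pl.
have [_ _ ql] := pq _ iN; rewrite qil in ql.
have [_ _ qk] := pq _ jN; rewrite qjk in qk.
have jk : j <> k by move=> jk; rewrite jk pkl in pj; lia.
have jl : j <> l by move=> jl; rewrite jl pl in pj; lia.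
have [n1 n2] := (planar_cyc pp plp iN kN, planar_cyc pp plp iN lN).
have [n3 n4] := (planar_cyc pq plq iN jN, planar_cyc pq plq iN kN).
rewrite ?pij ?pkl ?pl in n1 n2; rewrite ?qil ?qjk ?qk in n3 n4.
have [cy|cy] : (cyc i j l && cyc k l j) \/ (cyc j i k && cyc l k i).
  have [h|h] := boolP (cyc i j l); [left|right].
    have h' : ~~ cyc i k j by apply: contraTN h => {}/n1; rewrite /cyc; lia.
    have := n3 h; clear -h h' ik il jk jl lk ji; move: h h'; rewrite /cyc; lia.
  have h1 : cyc i l j by move: h; rewrite /cyc; lia.
  have := n2 h1 => h2.
  have h3 : ~~ cyc i k l by apply: contra h.
  by clear -h h1 h2 h3 ik il jk jl lk ji; move: h h1 h2 h3; rewrite /cyc; lia.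
- by case/andP: cy => o1 o2; exists i, j, k, l; split.
- by case/andP: cy => o1 o2; exists j, i, l, k; split=> // x xN *; apply: rest.
Qed.

Lemma flipped_values N p q : pairing N p -> pairing N q ->
  forall w x y z, w < N -> y < N -> p w = x -> p y = z -> q w = z -> q y = x ->
  [/\ p x = w, p z = y, q z = w & q x = y].
Proof.
move=> pp pq w x y z wN yN pw py qw qy.
split; [rewrite -pw|rewrite -py|rewrite -qw|rewrite -qy].
- by case: (pp _ wN).
- by case: (pp _ yN).
- by case: (pq _ wN).
- by case: (pq _ yN).
Qed.

Lemma sum_pull (P : pred nat) N (F : nat -> nat) a : a < N -> P a ->
  \sum_(x <- iota 0 N | P x) F x =
    F a + \sum_(x <- iota 0 N | (x != a) && P x) F x.
Proof.
move=> aN Pa; rewrite -big_filter (bigD1_seq a) ?filter_uniq ?iota_uniq //=.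
  by rewrite big_filter_cond; congr (_ + _); apply: eq_bigl => x; rewrite andbC.
by rewrite mem_filter Pa mem_iota.
Qed.

Lemma sum_split4 N (F : nat -> nat) a b c d : uniq [:: a; b; c; d] ->
  a < N -> b < N -> c < N -> d < N ->
  \sum_(x <- iota 0 N) F x = F a + F b + F c + F d +
    \sum_(x <- iota 0 N | [&& x != d, x != c, x != b, x != a & true]) F x.
Proof.
rewrite /= !inE !negb_or !andbT => /and3P[/and3P[ab ac ad] /andP[bc bd] cd].
move=> aN bN cN dN.
rewrite (@sum_pull xpredT _ _ a) // (@sum_pull _ _ _ b) ?(eq_sym b) ?ab //.
rewrite (@sum_pull _ _ _ c) ?(eq_sym c) ?ac ?bc //.
by rewrite (@sum_pull _ _ _ d) ?(eq_sym d) ?ad ?bd ?cd // !addnA.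
Qed.

(** The bound 4 s counts four labels per flip. In the last clause i is the label that the only flip
    of the pair has kept, so its partner moves forward once and rests before and after. *)
Definition weighted (N : nat) (p : nat -> nat -> nat) (s : nat)
    (D : nat -> nat) : Prop :=
  [/\ forall x, x < N -> D (p s x) = D x,
      \sum_(x <- iota 0 N) D x <= 4 * s,
      forall x, x < N -> D x = 0 -> forall r, r <= s -> p r x = p s x
    & forall x, x < N -> D x = 1 -> exists i m,
        [/\ i = x \/ i = p s x, m < s, cyc i (p m i) (p s i),
            forall r, r <= m -> p r i = p m i
          & forall r, m < r -> r <= s -> p r i = p s i]].

(* D counts how often the pair of a label has changed, where in a flip each
   old pair survives in the new pair that keeps the label w or y. *)
Lemma weight_exists n p s : pnecklace n p -> s < n ->
  exists D, weighted (2 * n) p s D.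
Proof.
move=> [pn fl _]; elim: s => [|s IH] sn.
  exists (fun _ => 0); split=> //; first by rewrite big1.
  by move=> x _ _ r; rewrite leqn0 => /eqP ->.
have [D [Dp Ds D0 D1]] := IH (ltnW sn).
have [pp plp] := pn _ (ltnW sn); have [pq plq] := pn _ sn.
have [w [x [y [z [[wN xN yN zN] [pw py qw qy] c1 c2 rest]]]]] := fl _ sn.
have [px pz qz qx] := flipped_values pp pq wN yN pw py qw qy.
have [_ wx _] := pp _ wN; have [_ yz _] := pp _ yN.
have [_ wz _] := pq _ wN; have [_ yx _] := pq _ yN.
rewrite pw in wx; rewrite py in yz; rewrite qw in wz; rewrite qy in yx.
have xz : x <> z by move=> e; move: c1; rewrite e /cyc; lia.
have wy : w <> y by move=> e; move: pw; rewrite e py; lia.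
pose D' u := if (u == w) || (u == z) then (D w).+1
  else if (u == x) || (u == y) then (D y).+1 else D u.
have D'w : D' w = (D w).+1 by rewrite /D' eqxx.
have D'z : D' z = (D w).+1 by rewrite /D' eqxx orbT.
have D'x : D' x = (D y).+1.
  by rewrite /D' eqxx !ifF //; apply/negP; lia.
have D'y : D' y = (D y).+1.
  by rewrite /D' eqxx orbT !ifF //; apply/negP; lia.
have D'o u : u <> w -> u <> x -> u <> y -> u <> z -> D' u = D u.
  by move=> *; rewrite /D' !ifF //; apply/negP; lia.
have Dxw : D x = D w by rewrite -pw Dp.
have Dzy : D z = D y by rewrite -py Dp.
have cases u : u = w \/ u = x \/ u = y \/ u = z \/
    u <> w /\ u <> x /\ u <> y /\ u <> z by lia.
have old i k m : i < 2 * n -> p s i = k -> D i = 0 -> forall r, r <= s -> p r i = k.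
  by move=> iN <- Di0; apply: D0.
exists D'; split.
- move=> u uN; have [->|[->|[->|[->|[uw [ux [uy uz]]]]]]] := cases u.
  + by rewrite qw D'z D'w.
  + by rewrite qx D'x D'y.
  + by rewrite qy D'x D'y.
  + by rewrite qz D'z D'w.
  + rewrite rest // !D'o ?Dp // => e; have [_ _ pu] := pp _ uN;
      rewrite e in pu; lia.
- have uq : uniq [:: w; x; y; z] by rewrite /= !inE; lia.
  rewrite (sum_split4 _ uq) // D'w D'x D'y D'z.
  rewrite (eq_bigr D); last first.
    by move=> u /and5P[/eqP uz /eqP uy /eqP ux /eqP uw _]; apply: D'o.
  by move: Ds; rewrite (sum_split4 _ uq) // Dxw Dzy; lia.
- move=> u uN; have [->|[->|[->|[->|[uw [ux [uy uz]]]]]]] := cases u;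
    rewrite ?D'w ?D'x ?D'y ?D'z // D'o // rest // => Du r.
  rewrite leq_eqVlt => /predU1P[->|rs]; first by rewrite rest.
  by rewrite (D0 _ uN Du).
- have flip i a b : i < 2 * n -> p s i = a -> p s.+1 i = b -> cyc i a b ->
      D i = 0 -> exists m, [/\ m < s.+1, cyc i (p m i) (p s.+1 i),
      forall r, r <= m -> p r i = p m i
      & forall r, m < r -> r <= s.+1 -> p r i = p s.+1 i].
    move=> iN pi qi c Di; exists s; split=> //; first by rewrite pi qi.
    + by move=> r rs; rewrite (D0 _ iN Di).
    + by move=> r r1 r2; have -> : r = s.+1 by lia.
  move=> u uN; have [->|[->|[->|[->|[uw [ux [uy uz]]]]]]] := cases u;
    rewrite ?D'w ?D'x ?D'y ?D'z.
  + move=> [Du0]; have [m [h1 h2 h3 h4]] := flip _ _ _ wN pw qw c1 Du0.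
    by exists w, m; split=> //; left.
  + move=> [Du0]; have [m [h1 h2 h3 h4]] := flip _ _ _ yN py qy c2 Du0.
    by exists y, m; split=> //; right.
  + move=> [Du0]; have [m [h1 h2 h3 h4]] := flip _ _ _ yN py qy c2 Du0.
    by exists y, m; split=> //; left.
  + move=> [Du0]; have [m [h1 h2 h3 h4]] := flip _ _ _ wN pw qw c1 Du0.
    by exists w, m; split=> //; right.
  + rewrite D'o // => Du; have [i [m [iu ms c h1 h2]]] := D1 _ uN Du.
    have [puN pu ppu] := pp _ uN.
    have iN : i < 2 * n by case: iu => ->.
    have ri : p s.+1 i = p s i.
      by apply: rest => // e; move: iu; rewrite e => -[] e'; rewrite -?e' in ppu; lia.
    exists i, m; split=> //.
    * by case: iu => ->; [left|right; rewrite rest].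
    * exact: leqW.
    * by rewrite ri.
    * move=> r mr; rewrite leq_eqVlt => /predU1P[->//|rs]; rewrite ri.
      exact: h2.
Qed.

Lemma upK N i : i < N -> dn N (up N i) = i.
Proof. by rewrite /dn /up; case: (i.+1 =P N) => //= <-. Qed.

Lemma dnK N i : i < N -> up N (dn N i) = i.
Proof. by rewrite /dn /up; case: i => [|i] /= iN; case: eqP; lia. Qed.

Lemma up_lt N i : i < N -> up N i < N.
Proof. by rewrite /up; case: eqP; lia. Qed.

Lemma dn_lt N i : i < N -> dn N i < N.
Proof. by rewrite /dn; case: eqP; lia. Qed.

Lemma leaf_exists n p : 1 < n -> pnecklace n p -> exists j m,
  [/\ j < 2 * n, m.+1 < n, forall s, s <= m -> p s j = up (2 * n) j
    & forall s, m < s -> s < n -> p s j = dn (2 * n) j].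
Proof.
move=> n1 pn; have n0 : n.-1 < n by lia.
have [D [Dp Ds D0 D1]] := weight_exists pn n0.
(* The weights of the 2 n labels add up to at most 4 (n - 1), so their mean is below 2. *)
have [x xN Dx] : exists2 x, x < 2 * n & D x <= 1.
  apply: contrapT => H.
  have : \sum_(x <- iota 0 (2 * n)) 2 <= \sum_(x <- iota 0 (2 * n)) D x.
    rewrite big_seq [leqRHS]big_seq; apply: leq_sum => x.
    rewrite mem_iota => xN; rewrite leqNgt; apply/negP => Dx.
    by apply: H; exists x => //; lia.
  by rewrite big_const_seq count_predT size_iota iter_addn; lia.
have [pns _ pl] := pn; have [pp0 pl0] := pns 0 (ltnW n1).
have [ppn _] := pns _ n0.
pose N := 2 * n; have uN i : i < N -> up N i < N by exact: up_lt.
have last i : i < N -> p 0 (up N i) = up N (p n.-1 i).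
  by move=> iN; rewrite pl // dnK //; case: (pp0 _ (uN _ iN)).
(* With b = p n.-1 i the rotation gives p 0 (i + 1) = b + 1. Were a different from i + 1, planarity
   would put b + 1, hence b, strictly between i and a, against a = b or the order i, a, b. So a = i
   + 1, and then b + 1 = p 0 a = i. *)
have sep i a b : i < N -> p 0 i = a -> p n.-1 i = b -> a = b \/ cyc i a b ->
    a = up N i /\ b = dn N i.
  move=> iN pi qi ab; have := last _ iN; rewrite qi => pui.
  have [aN ai pa] := pp0 _ iN; rewrite pi in aN ai pa.
  have [bN bi qb] := ppn _ iN; rewrite qi in bN bi qb.
  have := planar_cyc pp0 pl0 iN (uN _ iN); rewrite pi pui.
  have [_ u2 u3] := pp0 _ (uN _ iN); rewrite pui in u2 u3.
  have e1 : up N i = a -> up N b = i by move=> e; rewrite -pui e pa.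
  have e2 : up N b = i -> a = up N i by move=> e; rewrite -pi -{1}e u3.
  move: e1 e2 u2 ab aN ai bN bi iN; clear; rewrite /up /dn /cyc -/N.
  case: (i.+1 =P N); case: (b.+1 =P N); case: (i =P 0); lia.
(* Weight 0 is impossible: an unaltered pair would give x + 1 = x - 1 among at least four labels. *)
case: (posnP (D x)) => [Dx0|Dx1].
  have [e1 e2] : p 0 x = up N x /\ p n.-1 x = dn N x.
    by apply: sep => //; left; apply: D0.
  by have := D0 _ xN Dx0 0 (leq0n _); rewrite e1 e2 /up /dn /N; case: eqP; case: eqP; lia.
have [i [m [ix mn c h1 h2]]] := D1 _ xN (anti_leq (introT andP (conj Dx Dx1))).
have iN : i < N by case: ix => -> //; case: (ppn _ xN).
have [e1 e2] : p 0 i = up N i /\ p n.-1 i = dn N i.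
  by apply: sep => //; right; rewrite h1.
exists i, m; split=> //; first by lia.
- by move=> s sm; rewrite h1 // -(h1 0) // e1.
- by move=> s ms sn; rewrite h2 ?e2 //; lia.
Qed.

End Combinatorics.

(** * Rotating a necklace and removing a leaf from it *)

Section Reduction.

Definition rotdown (N : nat) (p : nat -> nat) (i : nat) : nat :=
  dn N (p (up N i)).

Lemma cyc_dn N i a b : i < N -> a < N -> b < N -> cyc i a b ->
  cyc (dn N i) (dn N a) (dn N b).
Proof. by rewrite /cyc /dn; case: (i =P 0); case: (a =P 0); case: (b =P 0); lia. Qed.

Lemma pairing_rotdown N p : pairing N p -> pairing N (rotdown N p).
Proof.
move=> pp i iN; have uN := up_lt iN; have [h1 h2 h3] := pp _ uN.
rewrite /rotdown; split; first exact: dn_lt.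
- by move=> e; apply: h2; rewrite -{2}e dnK.
- by rewrite dnK // h3 upK.
Qed.

Lemma cyc_planar N p : pairing N p ->
  (forall i j, i < N -> j < N -> cyc i j (p i) -> cyc i (p j) (p i)) ->
  planar N p.
Proof.
move=> pp H i j iN jN ij ji; have := H _ _ iN jN; rewrite /cyc; lia.
Qed.

Lemma planar_rotdown N p : pairing N p -> planar N p -> planar N (rotdown N p).
Proof.
move=> pp pl; apply: cyc_planar (pairing_rotdown pp) _ => i j iN jN c.
have [uiN ujN] := (up_lt iN, up_lt jN).
have [[pi _ _] [pj _ _]] := (pp _ uiN, pp _ ujN).
rewrite /rotdown -{1}(upK iN); apply: cyc_dn => //; apply: (@planar_cyc N) => //.
have [di _ _] := pairing_rotdown pp iN.
move: c; rewrite /rotdown; move: (p (up N i)) pi => q qN; rewrite /cyc /up /dn.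
by case: (i.+1 =P N); case: (j.+1 =P N); case: (q =P 0); lia.
Qed.

Lemma flipped_rotdown N p q : flipped N p q -> flipped N (rotdown N p) (rotdown N q).
Proof.
move=> [w [x [y [z [[wN xN yN zN] [pw py qw qy] c1 c2 rest]]]]].
exists (dn N w), (dn N x), (dn N y), (dn N z); rewrite /rotdown.
split; [split; exact: dn_lt | | exact: cyc_dn | exact: cyc_dn |].
  by rewrite !dnK // pw py qw qy.
by move=> i iN iw ix iy iz; rewrite rest ?up_lt // => e;
  [apply: iw|apply: ix|apply: iy|apply: iz]; rewrite -e upK.
Qed.

Lemma pnecklace_rotdown n p : 0 < n -> pnecklace n p ->
  pnecklace n (fun s => rotdown (2 * n) (p s)).
Proof.
move=> n0 [pn fl pl]; split.
- move=> s sn; have [pp pls] := pn _ sn.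
  by split; [exact: pairing_rotdown|exact: planar_rotdown].
- by move=> s sn; apply: flipped_rotdown; apply: fl.
- by move=> i iN; rewrite /rotdown pl // up_lt.
Qed.

Definition leafed (n : nat) (p : nat -> nat -> nat) (m j : nat) : Prop :=
  (forall s, s <= m -> p s j = up (2 * n) j) /\
  (forall s, m < s -> s < n -> p s j = dn (2 * n) j).

Lemma leafed_rotdown n p m j : 0 < n -> j < 2 * n -> leafed n p m j ->
  leafed n (fun s => rotdown (2 * n) (p s)) m (dn (2 * n) j).
Proof.
move=> n0 jN [h1 h2]; have dN := dn_lt jN; split=> s.
- by move=> sm; rewrite /rotdown dnK // h1 // upK // dnK.
- by move=> ms sn; rewrite /rotdown dnK // h2.
Qed.

(* With the leaf at label 0, its partner is 1 up to time m and -1 = 2 n - 1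
   afterwards; the remaining labels keep their cyclic order. *)
Definition emb (n : nat) (l : bool) (k : nat) : nat :=
  if (k == 0) && l then (2 * n).-1 else k.+1.
Definition ret (n : nat) (l : bool) (x : nat) : nat :=
  if (x == (2 * n).-1) && l then 0 else x.-1.
Definition reduce1 (n : nat) (l : bool) (p : nat -> nat) (k : nat) : nat :=
  ret n l (p (emb n l k)).
(** The matching of time m + 1 is the one dropped: without the leaf it equals that of time m, by
    [reduce_leaf_flip]. *)
Definition reduce (n m : nat) (p : nat -> nat -> nat) (s : nat) : nat -> nat :=
  if s <= m then reduce1 n true (p s) else reduce1 n false (p s.+1).

Definition kept (n : nat) (l : bool) (x : nat) : Prop :=
  x < 2 * n /\ (if l then 1 < x else (0 < x) && (x < (2 * n).-1)).

Lemma embP n l k : 1 < n -> k < 2 * n.-1 ->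
  kept n l (emb n l k) /\ ret n l (emb n l k) = k.
Proof.
by rewrite /kept /emb /ret => n1 kN; case: l; rewrite ?andbT ?andbF;
  case: (k =P 0) => /=; try (case: eqP => //=); lia.
Qed.

Lemma retP n l x : 1 < n -> kept n l x ->
  ret n l x < 2 * n.-1 /\ emb n l (ret n l x) = x.
Proof.
by rewrite /kept /emb /ret => n1; case: l; rewrite ?andbT ?andbF /=;
  case: (x =P (2 * n).-1) => //=; try (case: eqP => //=); lia.
Qed.

Lemma cyc_ret n l i a b : 1 < n -> kept n l i -> kept n l a -> kept n l b ->
  cyc (ret n l i) (ret n l a) (ret n l b) = cyc i a b.
Proof.
rewrite /kept /ret /cyc => n1; case: l; rewrite ?andbT ?andbF /=.
  by case: (i =P (2 * n).-1); case: (a =P (2 * n).-1); case: (b =P (2 * n).-1);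
    lia.
lia.
Qed.

Definition leaf1 (n : nat) (l : bool) (p : nat -> nat) : Prop :=
  p 0 = if l then 1 else (2 * n).-1.

Lemma kept_partner n l p x : 1 < n -> pairing (2 * n) p -> leaf1 n l p ->
  kept n l x -> kept n l (p x).
Proof.
move=> n1 pp lf [xN kx]; have [pxN _ ppx] := pp _ xN; split=> //.
have [p0N _ pp0] := pp 0 (leq_ltn_trans (leq0n _) xN).
move: lf kx p0N pp0; rewrite /leaf1; case: l => lf kx p0N; rewrite lf => pp0.
- by case: (p x) ppx => [|[|y]] // e; lia.
- have h1 : p x <> (2 * n).-1 by move=> e; rewrite e in ppx; lia.
  by have h2 : p x <> 0 by [move=> e; rewrite e in ppx; lia]; lia.
Qed.

Section Reduce1.
Variables (n : nat) (l : bool).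
Hypothesis n1 : 1 < n.

Lemma pairing_reduce1 p : pairing (2 * n) p -> leaf1 n l p ->
  pairing (2 * n.-1) (reduce1 n l p).
Proof.
move=> pp lf k kN; rewrite /reduce1; have [ke re] := embP l n1 kN.
have kp := kept_partner n1 pp lf ke; have [rN er] := retP n1 kp.
have [_ h2 h3] := pp _ (proj1 ke); split=> //.
- by move=> e; apply: h2; rewrite -er e.
- by rewrite er h3.
Qed.

Lemma planar_reduce1 p : pairing (2 * n) p -> planar (2 * n) p -> leaf1 n l p ->
  planar (2 * n.-1) (reduce1 n l p).
Proof.
move=> pp pl lf; apply: cyc_planar (pairing_reduce1 pp lf) _ => i j iN jN.
have [[ki ri] [kj rj]] := (embP l n1 iN, embP l n1 jN).
have [kpi kpj] := (kept_partner n1 pp lf ki, kept_partner n1 pp lf kj).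
rewrite /reduce1 -{1 3}ri -{1}rj !cyc_ret //.
by apply: (planar_cyc pp pl (proj1 ki) (proj1 kj)).
Qed.

Lemma flipped_reduce1 p q : pairing (2 * n) p -> pairing (2 * n) q ->
  leaf1 n l p -> leaf1 n l q -> flipped (2 * n) p q ->
  flipped (2 * n.-1) (reduce1 n l p) (reduce1 n l q).
Proof.
move=> pp pq lp lq [w [x [y [z [[wN xN yN zN] [pw py qw qy] c1 c2 rest]]]]].
have [px pz qz qx] := flipped_values pp pq wN yN pw py qw qy.
have K i : i < 2 * n -> p i <> q i -> kept n l i.
  move=> iN pqi; have i0 : i <> 0 by move=> e; rewrite e lp lq in pqi.
  have n0 : 0 < 2 * n by lia.
  have [[_ _ p0] [_ _ q0]] := (pp _ n0, pq _ n0).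
  have : i <> p 0 by move=> e; rewrite e p0 lp -lq q0 in pqi.
  by rewrite /kept lp; case: (l) => //; lia.
have wy : x <> z by move: c1; rewrite /cyc; lia.
have xw : w <> y by move=> e; apply: wy; rewrite -pw -py e.
have [kw kx ky kz] : [/\ kept n l w, kept n l x, kept n l y & kept n l z].
  by split; apply: K => //; rewrite ?pw ?qw ?px ?qx ?py ?qy ?pz ?qz //;
    apply/nesym.
have [[rw ew] [rx ex] [ry ey] [rz ez]] :=
  And4 (retP n1 kw) (retP n1 kx) (retP n1 ky) (retP n1 kz).
exists (ret n l w), (ret n l x), (ret n l y), (ret n l z).
split=> //; rewrite ?cyc_ret // /reduce1.
  by rewrite ew ey pw py qw qy.
move=> i iN iw ix iy iz; have [ki ri] := embP l n1 iN.
by rewrite rest ?(proj1 ki) // => e;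
  [apply: iw|apply: ix|apply: iy|apply: iz]; rewrite -e ri.
Qed.

End Reduce1.

(** The flip turns the pairs {0, 1}, {-1, t} into {0, -1}, {1, t}. Without the leaf, t is matched
    with -1 before and with 1 after, and these are the labels where [emb n true] and [emb n false]
    place the reduced label 0. *)
Lemma reduce_leaf_flip n p q : 1 < n -> pairing (2 * n) p -> pairing (2 * n) q ->
  leaf1 n true p -> leaf1 n false q -> flipped (2 * n) p q ->
  forall k, k < 2 * n.-1 -> reduce1 n true p k = reduce1 n false q k.
Proof.
move=> n1 pp pq lp lq [w [x [y [z [[wN xN yN zN] [pw py qw qy] c1 c2 rest]]]]].
have [px pz qz qx] := flipped_values pp pq wN yN pw py qw qy.
have n0 : 0 < 2 * n by lia.
have [_ _ p0] := pp _ n0; have [_ _ q0] := pq _ n0.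
rewrite /leaf1 in lp lq; rewrite lp in p0; rewrite lq in q0.
pose t := p (2 * n).-1.
have [q1 E] : q 1 = t /\ forall i, i < 2 * n -> i <> 0 -> i <> 1 ->
    i <> (2 * n).-1 -> i <> t -> q i = p i.
  (* The label 0 changes its partner, so it is one of the four labels of the flip; each of the four
     roles leads to the same new pair {1, t}. *)
  have : w = 0 \/ x = 0 \/ y = 0 \/ z = 0.
    case: (w =P 0); case: (x =P 0); case: (y =P 0); case: (z =P 0); try tauto.
    move=> h1 h2 h3 h4.
    by have := rest _ n0 (nesym h4) (nesym h3) (nesym h2) (nesym h1); lia.
  case=> [e|[e|[e|e]]].
  - have ex : x = 1 by rewrite -pw e.
    have ez : z = (2 * n).-1 by rewrite -qw e.
    have ey : y = t by rewrite /t -ez.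
    by split=> [|i *]; [rewrite -ex qx|apply: rest; rewrite ?e ?ex ?ey ?ez].
  - have ew : w = 1 by rewrite -px e.
    have ey : y = (2 * n).-1 by rewrite -qx e.
    have ez : z = t by rewrite /t -ey.
    by split=> [|i *]; [rewrite -ew qw|apply: rest; rewrite ?e ?ew ?ey ?ez].
  - have ez : z = 1 by rewrite -py e.
    have ex : x = (2 * n).-1 by rewrite -qy e.
    have ew : w = t by rewrite /t -ex.
    by split=> [|i *]; [rewrite -ez qz|apply: rest; rewrite ?e ?ex ?ew ?ez].
  - have ey : y = 1 by rewrite -pz e.
    have ew : w = (2 * n).-1 by rewrite -qz e.
    have ex : x = t by rewrite /t -ew.
    by split=> [|i *]; [rewrite -ey qy|apply: rest; rewrite ?e ?ex ?ew ?ey].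
have n2 : (2 * n).-1 < 2 * n by lia.
have [tN tL ptL] := pp _ n2; rewrite -/t in tN tL ptL.
have n3 : 1 < 2 * n by lia.
have [_ t1 qt] := pq _ n3; rewrite q1 in qt t1.
move=> k kN; rewrite /reduce1 /emb andbF andbT; case: (k =P 0) => [->|k0].
  by rewrite -/t q1 /ret andbF andbT ifF //; apply/eqP.
case: (k.+1 =P t) => [->|kt].
  by rewrite ptL qt /ret eqxx andbF.
rewrite E //; try lia; rewrite /ret andbF andbT ifF //.
have [_ _ pk] := pp k.+1 ltac:(lia).
by apply/eqP => e; apply: kt; rewrite -pk e.
Qed.

Lemma pnecklace_reduce n m p : 1 < n -> m.+1 < n -> pnecklace n p ->
  leafed n p m 0 -> pnecklace n.-1 (reduce n m p).
Proof.
move=> n1 mn [pn fl pl] [l1 l2].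
have lt s : s <= m -> leaf1 n true (p s).
  by move=> sm; rewrite /leaf1 l1 // /up ifF //; apply/eqP; lia.
have lf s : m < s -> s < n -> leaf1 n false (p s).
  by move=> ms sn; rewrite /leaf1 l2.
(* The reduced matching of time m may be computed on either side of the leaf flip, which bridges the
   seam between m and m + 1. *)
have em : forall k, k < 2 * n.-1 -> reduce n m p m k = reduce1 n false (p m.+1) k.
  move=> k kN; rewrite /reduce leqnn.
  have [[pm _] [pm1 _]] := (pn m (ltnW mn), pn _ mn).
  by apply: reduce_leaf_flip => //; [apply: lt|apply: lf|apply: fl].
split.
- move=> s sn; rewrite /reduce; case: leqP => sm.
    have [pp plp] := pn s ltac:(lia).
    by split; [apply: pairing_reduce1|apply: planar_reduce1] => //; apply: lt.
  have [pp plp] := pn s.+1 ltac:(lia).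
  by split; [apply: pairing_reduce1|apply: planar_reduce1] => //; apply: lf; lia.
- move=> s sn.
  have [sm|ms] := ltnP s m.
    have [[p1 _] [p2 _]] := (pn s ltac:(lia), pn s.+1 ltac:(lia)).
    rewrite /reduce sm (ltnW sm); apply: flipped_reduce1 => //.
    + exact/lt/ltnW.
    + exact: lt.
    + by apply: fl; lia.
  have [[p1 _] [p2 _]] := (pn s.+1 ltac:(lia), pn s.+2 ltac:(lia)).
  have F : flipped (2 * n.-1) (reduce1 n false (p s.+1)) (reduce n m p s.+1).
    rewrite /reduce leqNgt ltnS ms /=; apply: flipped_reduce1 => //;
      by [apply: lf; lia|apply: fl; lia].
  move: ms; rewrite leq_eqVlt => /predU1P[e|ms]; last first.
    by rewrite {1}/reduce leqNgt ms.
  case: F => [w [x [y [z [[wN xN yN zN] [pw py qw qy] c1 c2 rest]]]]].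
  by exists w, x, y, z; subst s; split; rewrite ?em // => i *; rewrite em // rest.
(* The pair {0, -1} removed from the last matching is the pair {0, 1} removed from the first one,
   rotated by -1, so the rotation condition passes to the rest. *)
- move=> i iN; have i1 : i.+1 < 2 * n by lia.
  have -> : reduce n m p n.-2 i = reduce1 n false (p n.-1) i.
    rewrite /reduce; case: (leqP n.-2 m) => h.
      have -> : n.-2 = m by lia.
      by rewrite -[in RHS](_ : m.+1 = n.-1) -?em // ?/reduce ?leqnn //; lia.
    by congr (reduce1 _ _ (p _)); lia.
  have [pp0 _] := pn 0 (ltnW n1).
  have i2 : i.+2 < 2 * n by lia.
  rewrite /reduce leq0n /reduce1 /emb andbF pl // /up.
  have -> : (i.+2 == 2 * n) = false by apply/eqP; lia.
  have k2 : kept n true i.+2 by [].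
  have [xN kx] := kept_partner n1 pp0 (lt 0 (leq0n _)) k2.
  have -> : p 0 (if ((if i.+1 == 2 * n.-1 then 0 else i.+1) == 0) && true
      then (2 * n).-1 else (if i.+1 == 2 * n.-1 then 0 else i.+1).+1) = p 0 i.+2.
    congr (p 0 _); case: (i.+1 =P 2 * n.-1) => /=; lia.
  move: (p 0 i.+2) xN kx => x xN kx; rewrite /ret /dn andbF andbT.
  case: (x =P 0) => [|_]; first by lia.
  by case: (x =P (2 * n).-1) => /=; [lia|case: (x.-1 =P 0); lia].
Qed.

End Reduction.

(** * Complex numbers and polynomial bounds *)

Section ComplexBasics.
Import Order.TTheory GRing.Theory Num.Theory.
Local Open Scope ring_scope.
Local Open Scope complex_scope.
Context {R : realType}.
Implicit Types (z w : R[i]) (f p q : {poly R[i]}).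

(** The modulus as an element of [R], so that estimates live in an ordered field; the norm on [R[i]]
    has its values in [R[i]]. *)
Definition nrm z : R := Normc.normc z.
Arguments nrm : simpl never.

Lemma nrmE z : nrm z = Num.sqrt (complex.Re z ^+ 2 + complex.Im z ^+ 2).
Proof. by case: z. Qed.
Lemma nrm_sqr z : nrm z ^+ 2 = complex.Re z ^+ 2 + complex.Im z ^+ 2.
Proof. by rewrite nrmE sqr_sqrtr // addr_ge0 ?sqr_ge0. Qed.
Lemma nrm_ge0 z : 0 <= nrm z.
Proof. by rewrite nrmE sqrtr_ge0. Qed.
Lemma nrm0 : nrm 0 = 0.
Proof. exact: Normc.normc0. Qed.
Lemma nrm1 : nrm 1 = 1.
Proof. exact: Normc.normc1. Qed.
Lemma nrmD z w : nrm (z + w) <= nrm z + nrm w.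
Proof. exact: le_normcD. Qed.
Lemma nrmM z w : nrm (z * w) = nrm z * nrm w.
Proof. exact: Normc.normcM. Qed.
Lemma nrmN z : nrm (- z) = nrm z.
Proof. exact: normcN. Qed.
Lemma nrmV z : nrm z^-1 = (nrm z)^-1.
Proof. exact: Normc.normcV. Qed.
Lemma nrm_eq0 z : (nrm z == 0) = (z == 0).
Proof. by apply/eqP/eqP => [/Normc.eq0_normc//|->]; exact: nrm0. Qed.
Lemma nrm_gt0 z : (0 < nrm z) = (z != 0).
Proof. by rewrite lt_neqAle nrm_ge0 andbT eq_sym nrm_eq0. Qed.
Lemma nrmX z n : nrm (z ^+ n) = nrm z ^+ n.
Proof. by elim: n => [|n IH]; rewrite ?expr0 ?nrm1 // !exprS nrmM IH. Qed.
Lemma nrm_real (x : R) : nrm x%:C = `|x|.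
Proof. by rewrite nrmE /= expr0n addr0 sqrtr_sqr. Qed.
Lemma nrmB z w : nrm (z - w) = nrm (w - z).
Proof. by rewrite -nrmN opprB. Qed.
Lemma nrm_tri z w u : nrm (z - u) <= nrm (z - w) + nrm (w - u).
Proof. by apply: le_trans (nrmD _ _); rewrite addrA subrK. Qed.
Lemma nrm_subr z w : nrm z - nrm w <= nrm (z - w).
Proof. by rewrite lerBlDr; apply: le_trans (nrmD _ _); rewrite subrK. Qed.
Lemma nrm_dist z w : `|nrm z - nrm w| <= nrm (z - w).
Proof. by rewrite ler_norml lerNl opprB (nrmB z) nrm_subr nrmB nrm_subr. Qed.
Lemma nrm_Re z : `|complex.Re z| <= nrm z.
Proof. by rewrite nrmE -sqrtr_sqr ler_wsqrtr // lerDl sqr_ge0. Qed.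
Lemma nrm_Im z : `|complex.Im z| <= nrm z.
Proof. by rewrite nrmE -sqrtr_sqr ler_wsqrtr // lerDr sqr_ge0. Qed.
Lemma nrm_le_ReIm z : nrm z <= `|complex.Re z| + `|complex.Im z|.
Proof.
have h := normr_ge0; rewrite nrmE -[leRHS]ger0_norm ?addr_ge0 // -sqrtr_sqr.
by rewrite ler_wsqrtr // sqrrD !real_normK ?num_real // addrAC lerDl mulrn_wge0 ?mulr_ge0.
Qed.
Lemma ReB z w : complex.Re (z - w) = complex.Re z - complex.Re w.
Proof. by case: z w => [? ?] []. Qed.
Lemma ImB z w : complex.Im (z - w) = complex.Im z - complex.Im w.
Proof. by case: z w => [? ?] []. Qed.
Lemma ReM z w : complex.Re (z * w) = complex.Re z * complex.Re w - complex.Im z * complex.Im w.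
Proof. by case: z w => [? ?] []. Qed.
Lemma ImM z w : complex.Im (z * w) = complex.Re z * complex.Im w + complex.Im z * complex.Re w.
Proof. by case: z w => [? ?] []. Qed.
Lemma ReZ (x : R) z : complex.Re (x%:C * z) = x * complex.Re z.
Proof. by rewrite ReM /= mul0r subr0. Qed.
Lemma ImZ (x : R) z : complex.Im (x%:C * z) = x * complex.Im z.
Proof. by rewrite ImM /= mul0r addr0. Qed.
Lemma complex_ext z w : complex.Re z = complex.Re w -> complex.Im z = complex.Im w -> z = w.
Proof. by case: z w => [? ?] [? ?] /= -> ->. Qed.
Lemma nrm_conj z : nrm (z^*)%C = nrm z.
Proof. by rewrite !nrmE; case: z => a b /=; rewrite sqrrN. Qed.

Local Notation cexp := (@cexp R).

Lemma cexpD s t : cexp (s + t) = cexp s * cexp t.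
Proof.
by apply: complex_ext; rewrite ?ReM ?ImM /= ?cosD ?sinD // addrC mulrC [X in _ + X]mulrC.
Qed.
Lemma cexp0 : cexp 0 = 1.
Proof. by rewrite /Defs.cexp cos0 sin0. Qed.
Lemma nrm_cexp t : nrm (cexp t) = 1.
Proof. by rewrite nrmE /= cos2Dsin2 sqrtr1. Qed.
Lemma cexpNM t : cexp (- t) * cexp t = 1.
Proof. by rewrite -cexpD addNr cexp0. Qed.
Lemma cexpMN t : cexp t * cexp (- t) = 1.
Proof. by rewrite mulrC cexpNM. Qed.
Lemma cexp_neq0 t : cexp t != 0.
Proof. by rewrite -nrm_gt0 nrm_cexp. Qed.
Lemma cexpX t n : cexp t ^+ n = cexp (t * n%:R).
Proof.
elim: n => [|n IH]; first by rewrite mulr0 cexp0.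
by rewrite exprS IH -cexpD -[n.+1%:R]natr1 mulrDr mulr1 addrC.
Qed.
Lemma cexp_pi : cexp pi = -1.
Proof. by apply: complex_ext => /=; rewrite ?cospi ?sinpi ?oppr0. Qed.
Lemma cexpDpi t : cexp (t + pi) = - cexp t.
Proof. by rewrite cexpD cexp_pi mulrN1. Qed.
Lemma cexpBpi t : cexp (t - pi) = - cexp t.
Proof. by rewrite -[in RHS](subrK pi t) cexpDpi opprK. Qed.
Lemma cexpD2pi t : cexp (t + 2 * pi) = cexp t.
Proof. by rewrite mulrDl mul1r addrA !cexpDpi opprK. Qed.
Lemma cexpD2pin t (n : nat) : cexp (t + 2 * pi * n%:R) = cexp t.
Proof.
elim: n => [|n IH]; first by rewrite mulr0 addr0.
by rewrite -[n.+1%:R]natr1 mulrDr mulr1 addrA cexpD2pi.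
Qed.
Lemma cexp_inv t : (cexp t)^-1 = cexp (- t).
Proof. by apply: (mulfI (cexp_neq0 t)); rewrite cexpMN divff // cexp_neq0. Qed.

Lemma cexp_cont (t e : R) : 0 < e -> exists2 d, 0 < d & forall s, `|s - t| < d ->
  nrm (cexp s - cexp t) < e.
Proof.
move=> e0; have e2 : 0 < e / 2 by rewrite divr_gt0.
have /cvgrPdist_lt/(_ _ e2)/nbhs_ballP[d1 /= d10 h1] := @continuous_cos R t.
have /cvgrPdist_lt/(_ _ e2)/nbhs_ballP[d2 /= d20 h2] := @continuous_sin R t.
exists (Num.min d1 d2); first by rewrite lt_min d10 d20.
move=> s; rewrite lt_min distrC => /andP[s1 s2].
apply: le_lt_trans (nrm_le_ReIm _) _; rewrite ReB ImB /=.
by rewrite [e]splitr; apply: ltrD; rewrite distrC; [exact: h1|exact: h2].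
Qed.

Lemma cexp_eq1 (x : R) : 0 <= x < 2 * pi -> cexp x = 1 -> x = 0.
Proof.
move=> /andP[x0 x2] [cx _]; have : cos (x / 2 + x / 2) = 1 by rewrite -splitr.
rewrite cosD -!expr2 cos2sin2; move: (sin_gt0_pi (x := x / 2)).
move: (sin (x / 2)) (pi_gt0 R) x2; move: pi => c y c0 x2 H h.
have y0 : y = 0 by apply/eqP; rewrite -sqrf_eq0; apply/eqP; lra.
apply/eqP; apply: contraTT isT => xn; have : 0 < y.
  by apply: H; move: xn; rewrite neq_lt; lra.
by rewrite y0 ltxx.
Qed.

Lemma cexp_primitive n : (0 < n)%N -> n.-primitive_root (cexp (2 * pi / n%:R)).
Proof.
move=> n0; have n0R : 0 < n%:R :> R by rewrite ltr0n.
have zn : cexp (2 * pi / n%:R) ^+ n = 1.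
  by rewrite cexpX divfK ?gt_eqF // -[2 * pi]add0r cexpD2pi cexp0.
have [m pm mn] := prim_order_exists n0 zn.
have m0 := prim_order_gt0 pm.
suff e : n = m by rewrite {1}e.
apply/eqP; rewrite eqn_leq [X in _ && X]dvdn_leq // andbT leqNgt; apply/negP => mn'.
have := prim_expr_order pm; rewrite cexpX => /cexp_eq1 h.
have : 2 * pi / n%:R * m%:R = 0 :> R.
  apply: h; rewrite mulrAC ler_pdivlMr // mul0r ltr_pdivrMr // ltr_pM2l ?ltr_nat ?mn'.
    by rewrite mulr_ge0 ?mulr_ge0 ?pi_ge0.
  by rewrite mulr_gt0 ?pi_gt0.
move/eqP; rewrite !mulf_eq0 invr_eq0 !pnatr_eq0 (gt_eqF (pi_gt0 R)) /=; lia.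
Qed.

Lemma nrm_Xn_sub1 n z : (0 < n)%N ->
  nrm (z ^+ n - 1) = \prod_(0 <= l < n) nrm (z - cexp (2 * pi * l%:R / n%:R)).
Proof.
move=> n0; have := factor_Xn_sub_1 (cexp_primitive n0).
move/(congr1 (fun p => nrm p.[z])); rewrite !hornerE => <-.
rewrite horner_prod (big_morph nrm nrmM nrm1); apply: eq_bigr => l _.
by rewrite !hornerE cexpX; congr (nrm (_ - cexp _)); ring.
Qed.

End ComplexBasics.
Arguments nrm : simpl never.

(** * Quantitative bounds for polynomials *)

Section PolynomialBounds.
Import Order.TTheory GRing.Theory Num.Theory.
Local Open Scope ring_scope.
Local Open Scope complex_scope.
Context {R : realType}.
Implicit Types (z w : R[i]) (f p q : {poly R[i]}).

Lemma prod_near (rs : seq R[i]) z (d : R) : 0 < d ->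
  nrm (\prod_(r <- rs) (z - r)) < d ^+ size rs ->
  exists2 r, r \in rs & nrm (z - r) < d.
Proof.
move=> d0; elim: rs => [|r rs IH]; first by rewrite big_nil nrm1 ltxx.
rewrite big_cons nrmM exprS => h; have [zr|zr] := ltP (nrm (z - r)) d.
  by exists r; rewrite ?mem_head.
have [|r' rr' zr'] := IH; last by exists r'; rewrite ?inE ?rr' ?orbT.
rewrite -(ltr_pM2l d0); apply: le_lt_trans h.
by rewrite ler_wpM2r ?nrm_ge0.
Qed.

Lemma poly_near p (d : R) z : 0 < d -> p != 0 ->
  nrm p.[z] < nrm (lead_coef p) * d ^+ (size p).-1 ->
  exists2 r, root p r & nrm (z - r) < d.
Proof.
move=> d0 p0; have [rs pE] := closed_field_poly_normal p.
have lp : lead_coef p != 0 by rewrite lead_coef_eq0.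
have sp : (size p).-1 = size rs.
  by rewrite pE size_scale // size_prod_XsubC.
rewrite sp {1}pE hornerZ horner_prod nrmM ltr_pM2l ?nrm_gt0 //.
under eq_bigr do rewrite hornerXsubC.
move=> /(prod_near d0)[r rrs zr]; exists r => //.
by rewrite pE rootZ // root_prod_XsubC.
Qed.

(** The source of all lifts. The value of f - c at z is a product of n + 1 factors z - r, so one of
    them is smaller than d as soon as the product is smaller than [d ^+ n.+1]. *)
Lemma root_near f (n : nat) (d : R) z c : f \is monic -> size f = n.+2 -> 0 < d ->
  nrm (f.[z] - c) < d ^+ n.+1 -> exists2 r, f.[r] = c & nrm (z - r) < d.
Proof.
move=> fm sf d0 h; have sc : (size (- c%:P) < size f)%N.
  by rewrite sf size_polyN size_polyC; case: (c != 0).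
have [||r rr zr] := @poly_near (f - c%:P) d z d0.
- by rewrite -size_poly_gt0 size_polyDl // sf.
- rewrite lead_coefDl // size_polyDl // (monicP fm) nrm1 mul1r sf /=.
  by rewrite hornerD hornerN hornerC.
- by exists r => //; move: rr; rewrite rootE hornerD hornerN hornerC subr_eq0 => /eqP.
Qed.

Lemma deriv_neq0 f n : size f = n.+2 -> f^`() != 0.
Proof.
move=> sf; rewrite -size_poly_gt0 lt0n; apply/negP => /eqP s0.
have : (f^`())`_n = 0 by rewrite nth_default // s0.
rewrite coef_deriv => /eqP; rewrite mulrn_eq0 /=.
have -> : f`_n.+1 = lead_coef f by rewrite lead_coefE sf.
by rewrite lead_coef_eq0 -size_poly_eq0 sf.
Qed.

(** To be read backwards: at distance at least d from all critical points, the derivative is bounded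
    below. *)
Lemma deriv_root_near f n (d : R) : size f = n.+2 -> 0 < d ->
  exists2 e, 0 < e & forall z, nrm (f^`()).[z] < e ->
    exists2 c, root f^`() c & nrm (z - c) < d.
Proof.
move=> sf d0; have f0 := deriv_neq0 sf.
exists (nrm (lead_coef f^`()) * d ^+ (size f^`()).-1).
  by rewrite mulr_gt0 ?exprn_gt0 // nrm_gt0 lead_coef_eq0.
by move=> z; apply: poly_near.
Qed.

Lemma poly_bounded p (B : R) : exists2 M, 0 < M & forall z, nrm z <= B -> nrm p.[z] <= M.
Proof.
elim/poly_ind: p => [|p c [M M0 IH]].
  by exists 1 => // z _; rewrite horner0 nrm0.
exists (M * `|B| + nrm c + 1).
  have := nrm_ge0 c; have := normr_ge0 B => ? ?.
  by rewrite ltr_pwDr // addr_ge0 // mulr_ge0 // ltW.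
move=> z zB; rewrite hornerMXaddC; apply: le_trans (nrmD _ _) _.
rewrite -[leLHS]addr0 lerD // lerD2r nrmM ler_pM ?nrm_ge0 ?IH //.
exact: le_trans (ler_norm _).
Qed.

Lemma poly_lipschitz p (B : R) : exists2 L, 0 < L & forall z w,
  nrm z <= B -> nrm w <= B -> nrm (p.[z] - p.[w]) <= L * nrm (z - w).
Proof.
elim/poly_ind: p => [|p c [L L0 IH]].
  by exists 1 => // z w _ _; rewrite !horner0 subrr nrm0 mul1r nrm_ge0.
have [M M0 hM] := poly_bounded p B.
exists (L * `|B| + M).
  by rewrite ltr_wpDl // mulr_ge0 // ltW.
move=> z w zB wB; rewrite !hornerMXaddC.
have -> : p.[z] * z + c - (p.[w] * w + c) = (p.[z] - p.[w]) * z + p.[w] * (z - w) by ring.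
apply: le_trans (nrmD _ _) _; rewrite !nrmM mulrDl lerD //.
  rewrite mulrAC ler_pM ?nrm_ge0 ?IH // ?mulr_ge0 ?nrm_ge0 //.
  exact: le_trans (ler_norm _).
by rewrite ler_wpM2r ?nrm_ge0 ?hM.
Qed.

Lemma poly_taylor p (B : R) : exists2 M, 0 < M & forall z w,
  nrm z <= B -> nrm w <= B ->
  nrm (p.[w] - p.[z] - (p^`()).[z] * (w - z)) <= M * nrm (w - z) ^+ 2.
Proof.
elim/poly_ind: p => [|p c [M M0 IH]].
  exists 1 => // z w _ _; rewrite deriv0 !horner0 subrr mul0r subr0 nrm0 mul1r.
  by rewrite exprn_ge0 ?nrm_ge0.
have [L L0 hL] := poly_lipschitz p B.
exists (M * `|B| + L).
  by rewrite ltr_wpDl // mulr_ge0 // ltW.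
move=> z w zB wB; rewrite derivMXaddC !hornerMXaddC hornerD hornerMX.
have -> : p.[w] * w + c - (p.[z] * z + c) - (p.[z] + p^`().[z] * z) * (w - z) =
   (p.[w] - p.[z] - p^`().[z] * (w - z)) * z + (p.[w] - p.[z]) * (w - z) by ring.
apply: le_trans (nrmD _ _) _; rewrite !nrmM mulrDl lerD //.
  rewrite mulrAC ler_pM ?nrm_ge0 ?IH // ?mulr_ge0 ?nrm_ge0 //.
  exact: le_trans (ler_norm _).
by rewrite expr2 mulrA ler_wpM2r ?nrm_ge0 ?hL.
Qed.

Lemma poly_growth_le p n : (size p <= n.+1)%N -> exists2 K, 0 < K &
  forall z m, 1 <= m -> nrm z <= m -> nrm p.[z] <= K * m ^+ n.
Proof.
elim: n p => [|n IH] p.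
  move=> /size1_polyC ->; exists (nrm p`_0 + 1).
    by rewrite ltr_wpDl ?nrm_ge0.
  by move=> z m _ _; rewrite hornerC expr0 mulr1 lerDl.
move=> sp; rewrite -(poly_take_drop 1 p) expr1.
have [|K K0 hK] := IH (drop_poly 1 p).
  by rewrite size_drop_poly; lia.
have -> : take_poly 1 p = (p`_0)%:P.
  by apply/polyP => i; rewrite coef_take_poly coefC; case: i.
exists (K + nrm p`_0); first by rewrite ltr_wpDr ?nrm_ge0.
move=> z m m1 zm; rewrite hornerD hornerC hornerMX; apply: le_trans (nrmD _ _) _.
rewrite addrC mulrDl lerD //.
  by rewrite nrmM exprSr mulrA ler_pM ?nrm_ge0 ?hK.
by rewrite ler_peMr ?nrm_ge0 // exprn_ege1.
Qed.

Lemma monic_growth f n (e : R) : f \is monic -> size f = n.+1 -> 0 < e ->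
  exists2 rho, 1 <= rho & forall z, rho <= nrm z ->
    nrm (f.[z] - z ^+ n) <= e * nrm z ^+ n.
Proof.
move=> fm sf e0; case: n sf => [|n] sf.
  exists 1 => // z _; have := monicP fm; rewrite lead_coefE sf /= => f0.
  rewrite (size1_polyC (p := f)) ?sf // f0 hornerC expr0 subrr nrm0 mulr1.
  exact: ltW.
have [|K K0 hK] := @poly_growth_le (f - 'X^(n.+1)) n.
  apply/leq_sizeP => j; rewrite leq_eqVlt => /predU1P[<-|nj].
    rewrite coefB coefXn eqxx; have := monicP fm.
    by rewrite lead_coefE sf /= => ->; rewrite subrr.
  by rewrite coefB coefXn nth_default ?sf // gtn_eqF // subr0.
exists (1 + K / e); first by rewrite lerDl divr_ge0 // ltW.
move=> z zr; have z1 : 1 <= nrm z.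
  by apply: le_trans zr; rewrite lerDl divr_ge0 // ltW.
have := hK z _ z1 (lexx _); rewrite hornerD hornerN hornerXn => h; apply: le_trans h _.
rewrite exprS mulrA ler_wpM2r ?exprn_ge0 ?nrm_ge0 // -ler_pdivrMl // mulrC.
by apply: le_trans zr; rewrite lerDr.
Qed.

Lemma poly_large f n (T : R) : f \is monic -> size f = n.+2 ->
  exists2 rho, 0 < rho & forall z, rho <= nrm z -> T <= nrm f.[z].
Proof.
move=> fm sf; have h2 : 0 < 2^-1 :> R by rewrite invr_gt0.
have [rho r1 h] := monic_growth fm sf h2.
have r0 : 0 < rho by apply: lt_le_trans r1.
exists (rho + 2 * `|T|) => [|z zr]; first by rewrite ltr_pwDl // mulr_ge0.
have zr' : rho <= nrm z by apply: le_trans zr; rewrite lerDl mulr_ge0.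
have := h z zr'; rewrite nrmB => h3.
have := nrm_subr (z ^+ n.+1) f.[z]; rewrite nrmX => h4.
have z1 : 1 <= nrm z by apply: le_trans zr'.
have zn : nrm z <= nrm z ^+ n.+1 by rewrite exprS ler_peMr ?nrm_ge0 // exprn_ege1.
have : `|T| <= nrm z / 2 by lra.
have := ler_norm T; lra.
Qed.

End PolynomialBounds.

(** * Lifting rays through f *)

Section Rays.
Import Order.TTheory GRing.Theory Num.Theory.
Import numFieldNormedType.Exports.
Local Open Scope ring_scope.
Local Open Scope complex_scope.
Context {R : realType}.
Implicit Types (z w : R[i]) (f p q : {poly R[i]}) (g h : R -> R[i]).

(** Continuity in terms of [nrm], so that lifts are handled by plain estimates; [contp_continuous]
    relates it to the topology of [R[i]^o]. *)
Definition contp g : Prop := forall t e : R, 0 < e ->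
  exists2 d, 0 < d & forall s, `|s - t| < d -> nrm (g s - g t) < e.
Definition contR (x : R -> R) : Prop := forall t e : R, 0 < e ->
  exists2 d, 0 < d & forall s, `|s - t| < d -> `|x s - x t| < e.

Lemma contR_continuous x : contR x -> continuous x.
Proof.
move=> cx t; apply/cvgrPdist_lt => e e0; have [d d0 h] := cx t e e0.
apply/nbhs_ballP; exists d => // s /=; rewrite /ball /= => st.
by rewrite distrC h // distrC.
Qed.

(** The barrier argument behind the continuations below: to keep a continuous quantity below c, only
    the equality with c has to be excluded. *)
Lemma avoid_lt x (a b c : R) : contR x -> a <= b ->
  (forall t, a <= t <= b -> x t <> c) -> x a < c -> x b < c.
Proof.
move=> cx ab xc xa; rewrite ltNge; apply/negP => xb.
have [||t] := @IVT R x a b c ab.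
- exact/continuous_subspaceT/contR_continuous.
- by rewrite ge_min le_max (ltW xa) xb orbT.
- by rewrite in_itv /= => /xc.
Qed.

Lemma contR_lip1 (x : R -> R) : (forall s t, `|x s - x t| <= `|s - t|) -> contR x.
Proof. by move=> hx t e e0; exists e => // s; apply: le_lt_trans. Qed.

Lemma lip1_max (c : R) s t : `|Num.max s c - Num.max t c| <= `|s - t|.
Proof.
have h1 := ler_norm (s - t); have h2 := ler_norm (t - s); rewrite distrC in h2.
have h3 := normr_ge0 (s - t); rewrite ler_norml /Num.max.
by case: (ltP s c); case: (ltP t c) => *; apply/andP; split; lra.
Qed.

Lemma lip1_min (c : R) s t : `|Num.min s c - Num.min t c| <= `|s - t|.
Proof.
have h1 := ler_norm (s - t); have h2 := ler_norm (t - s); rewrite distrC in h2.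
have h3 := normr_ge0 (s - t); rewrite ler_norml /Num.min.
by case: (ltP s c); case: (ltP t c) => *; apply/andP; split; lra.
Qed.

Lemma contp_cst z : contp (fun=> z).
Proof. by move=> t e e0; exists 1 => // s _; rewrite subrr nrm0. Qed.

Lemma contp_comp g x : contp g -> contR x -> contp (g \o x).
Proof.
move=> cg cx t e e0; have [d d0 h] := cg (x t) e e0.
by have [d' d'0 h'] := cx t d d0; exists d' => // s /h'/h.
Qed.

Lemma contpD g h : contp g -> contp h -> contp (fun t => g t + h t).
Proof.
move=> cg ch t e e0; have e2 : 0 < e / 2 by rewrite divr_gt0.
have [d1 d10 h1] := cg t _ e2; have [d2 d20 h2] := ch t _ e2.
exists (Num.min d1 d2); first by rewrite lt_min d10.
move=> s; rewrite lt_min => /andP[s1 s2].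
have -> : g s + h s - (g t + h t) = (g s - g t) + (h s - h t) by ring.
by apply: le_lt_trans (nrmD _ _) _; rewrite [e]splitr ltrD ?h1 ?h2.
Qed.

Lemma contpZ z g : contp g -> contp (fun t => z * g t).
Proof.
move=> cg t e e0; have z0 := nrm_ge0 z.
have e2 : 0 < e / (nrm z + 1) by rewrite divr_gt0 // ltr_wpDl.
have [d d0 h] := cg t _ e2; exists d => // s /h.
rewrite -mulrBr nrmM ltr_pdivlMr ?ltr_wpDl // => hh.
by apply: le_lt_trans hh; rewrite mulrC ler_wpM2l ?nrm_ge0 // lerDl.
Qed.

Lemma contpN g : contp g -> contp (fun t => - g t).
Proof.
by move=> cg; have := contpZ (-1) cg => h t e /(h t)[d d0 hd]; exists d => // s /hd; rewrite !mulN1r.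
Qed.

Lemma contpB g h : contp g -> contp h -> contp (fun t => g t - h t).
Proof. by move=> cg /contpN ch; exact: contpD. Qed.

Lemma contR_lipC (x : R[i] -> R) g : (forall z w, `|x z - x w| <= nrm (z - w)) ->
  contp g -> contR (x \o g).
Proof.
move=> hx cg t e e0; have [d d0 h] := cg t e e0.
by exists d => // s /h; exact: (le_lt_trans (hx _ _)).
Qed.

Lemma contR_nrm g : contp g -> contR (fun t => nrm (g t)).
Proof. by move=> cg; apply: (contR_lipC _ cg); exact: nrm_dist. Qed.

Lemma contR_Im g : contp g -> contR (fun t => complex.Im (g t)).
Proof. by move=> cg; apply: (contR_lipC _ cg) => z w; rewrite -ImB nrm_Im. Qed.

Lemma contp_ext g h : g =1 h -> contp g -> contp h.
Proof. by move=> gh cg t e /(cg t)[d d0 hd]; exists d => // s; rewrite -!gh; apply: hd. Qed.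

Definition nonsing f (psi : R) : Prop :=
  forall c, root f^`() c -> complex.Im (cexp (- psi) * f.[c]) <> 0.

Lemma seq_gap (rs : seq R[i]) (x : R[i] -> R) :
  (forall r, r \in rs -> x r <> 0) ->
  exists2 mu, 0 < mu & forall r, r \in rs -> mu <= `|x r|.
Proof.
elim: rs => [_|r rs IH H]; first by exists 1.
have [|mu mu0 h] := IH; first by move=> r' r'rs; apply: H; rewrite inE r'rs orbT.
exists (Num.min mu `|x r|).
  by rewrite lt_min mu0 normr_gt0; apply/eqP/H; rewrite mem_head.
move=> r'; rewrite inE => /predU1P[->|/h]; first by rewrite ge_min lexx orbT.
by rewrite ge_min => ->.
Qed.

Lemma root_seq p : p != 0 -> exists rs : seq R[i], forall r, root p r = (r \in rs).
Proof.
move=> p0; have [rs pE] := closed_field_poly_normal p; exists rs => r.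
by rewrite pE rootZ ?root_prod_XsubC // lead_coef_eq0.
Qed.

Lemma crit_gap f n psi : size f = n.+2 -> nonsing f psi ->
  exists2 mu, 0 < mu & forall c, root f^`() c ->
    mu <= `|complex.Im (cexp (- psi) * f.[c])|.
Proof.
move=> sf ns; have [rs rsP] := root_seq (deriv_neq0 sf).
have [|mu mu0 h] := @seq_gap rs (fun c => complex.Im (cexp (- psi) * f.[c])).
  by move=> r; rewrite -rsP => /ns.
by exists mu => // c; rewrite rsP => /h.
Qed.

Lemma on_curve f psi (t : R) z : f.[z] = t%:C * cexp psi ->
  complex.Im (cexp (- psi) * f.[z]) = 0.
Proof. by move=> ->; rewrite mulrCA cexpNM mulr1. Qed.

(** The imaginary part of e^(- i psi) f is 0 at z and at least mu in modulus at critical points, so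
    z keeps a distance d from them and |f'(z)| >= e. As f w = f z, the Taylor bound gives e |w - z|
    <= M |w - z|^2. *)
Lemma sep f n psi (B : R) : size f = n.+2 -> nonsing f psi ->
  exists2 r, 0 < r & forall z w t, nrm z <= B -> nrm w <= B ->
    f.[z] = t%:C * cexp psi -> f.[w] = t%:C * cexp psi -> nrm (z - w) < r -> z = w.
Proof.
move=> sf ns; have [mu mu0 hmu] := crit_gap sf ns.
have [L L0 hL] := poly_lipschitz f (B + 1).
(* Over this distance the value changes by at most mu / 2, by the Lipschitz bound; the 1 keeps the
   critical point in the ball of radius B + 1. *)
pose d := Num.min 1 (mu / (2 * L)).
have d0 : 0 < d by rewrite lt_min ltr01 divr_gt0 // mulr_gt0.
have [e e0 he] := deriv_root_near sf d0.
have [M M0 hM] := poly_taylor f B.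
exists (e / M); first by rewrite divr_gt0.
move=> z w t zB wB fz fw; rewrite ltr_pdivlMr // => zw.
apply/eqP; apply: contraTT isT => zw0.
have fe : e <= nrm (f^`()).[z].
  rewrite leNgt; apply/negP => /he[c rc zc].
  have zc1 : nrm (z - c) < 1 by move: zc; rewrite lt_min => /andP[].
  have cB : nrm c <= B + 1.
    by have := nrm_subr c z; rewrite nrmB; lra.
  have zB1 : nrm z <= B + 1 by lra.
  have := hL _ _ zB1 cB; have := hmu c rc.
  have := nrm_Im (cexp (- psi) * (f.[z] - f.[c])).
  rewrite mulrBr ImB (on_curve fz) sub0r normrN -mulrBr nrmM nrm_cexp mul1r.
  have : L * nrm (z - c) <= L * (mu / (2 * L)).
    rewrite ler_pM2l // ltW //; by move: zc; rewrite lt_min => /andP[].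
  have -> : L * (mu / (2 * L)) = mu / 2 by field; rewrite gt_eqF.
  lra.
have := hM z w zB wB; rewrite fw -fz subrr sub0r nrmN nrmM => h.
have wz0 : 0 < nrm (w - z) by rewrite nrm_gt0 subr_eq0 eq_sym.
have : e * nrm (w - z) <= M * nrm (w - z) ^+ 2.
  by apply: le_trans h; rewrite ler_wpM2r ?nrm_ge0.
by rewrite expr2 mulrA ler_pM2r // mulrC nrmB; lra.
Qed.

Lemma value_bound f n (T : R) : f \is monic -> size f = n.+2 ->
  exists B : R, forall z, nrm f.[z] <= T -> nrm z <= B.
Proof.
move=> fm sf; have [rho _ h] := poly_large (T + 1) fm sf.
exists rho => z fz; rewrite leNgt; apply/negP => /ltW/h; lra.
Qed.

Lemma nrm_target (t psi : R) : nrm (t%:C * cexp psi) = `|t|.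
Proof. by rewrite nrmM nrm_real nrm_cexp mulr1. Qed.

Lemma target_dist (s t psi : R) : nrm (s%:C * cexp psi - t%:C * cexp psi) = `|s - t|.
Proof. by rewrite -mulrBl -rmorphB nrm_target. Qed.

Definition ray_on f psi (T : R) g : Prop :=
  contp g /\ forall t, 0 <= t <= T -> f.[g t] = t%:C * cexp psi.

(** At a time when h has distance exactly d from the lift g, [root_near] finds a preimage of the
    target strictly within d of h, and [sep] identifies it with g, a contradiction. The error is
    controlled only where |h t| <= B, since h is not known to be bounded beforehand. Uniqueness of
    lifts, stability in the angle and the comparison of G with G (X - w) all come from here. *)
Lemma tube f n psi (T : R) : f \is monic -> size f = n.+2 -> nonsing f psi ->
  exists B r0 : R, 0 < r0 /\ forall d, 0 < d -> d <= r0 ->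
    exists2 eta, 0 < eta & forall g h, ray_on f psi T g -> contp h ->
      (forall t, 0 <= t <= T -> nrm (h t) <= B ->
         nrm (f.[h t] - t%:C * cexp psi) < eta) ->
      nrm (h 0 - g 0) < d -> forall t, 0 <= t <= T -> nrm (h t - g t) < d.
Proof.
move=> fm sf ns; have [B hB] := value_bound T fm sf.
have [r r0 hr] := sep B sf ns.
(* The preimage is within d of h and h within d of g, so 2 d <= r is wanted; d <= 1 keeps h in the
   ball of radius B + 1. *)
exists (B + 1), (Num.min 1 (r / 2)); split; first by rewrite lt_min ltr01 divr_gt0.
move=> d d0; rewrite le_min => /andP[d1 dr].
exists (d ^+ n.+1); first by rewrite exprn_gt0.
move=> g h [cg fg] ch fh h0 t /andP[t0 tT].
have cx : contR (fun t => nrm (h t - g t)) by apply: contR_nrm; apply: contpB.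
apply: (avoid_lt cx t0) h0 => s /andP[s0 st] /= hs.
have sT : 0 <= s <= T by rewrite s0 (le_trans st).
have gB z : f.[z] = s%:C * cexp psi -> nrm z <= B.
  move=> fz; apply: hB; rewrite fz nrm_target ger0_norm //; by case/andP: sT.
have hsB : nrm (h s) <= B + 1.
  by have := gB _ (fg _ sT); have := nrm_subr (h s) (g s); lra.
have [v fv hv] := root_near fm sf d0 (fh _ sT hsB).
have vg : v = g s.
  apply: (hr _ _ s); rewrite ?gB ?fg //.
  by have := nrm_tri v (h s) (g s); rewrite hs (nrmB v (h s)); lra.
by move: hv; rewrite vg hs ltxx.
Qed.

Lemma ray_on_uniq f n psi (T : R) g h : f \is monic -> size f = n.+2 ->
  nonsing f psi -> ray_on f psi T g -> ray_on f psi T h -> g 0 = h 0 ->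
  forall t, 0 <= t <= T -> g t = h t.
Proof.
move=> fm sf ns rg [ch fh] gh t tT.
have [B [r0 [r00 H]]] := tube T fm sf ns.
apply/eqP; rewrite -subr_eq0 -nrm_eq0 eq_le nrm_ge0 andbT leNgt; apply/negP => d0.
(* The tube radius is the supposed distance at t itself, cut off at r0. *)
have [||eta eta0 /(_ g h rg ch)] := H (Num.min r0 (nrm (g t - h t))).
- by rewrite lt_min r00 d0.
- by rewrite ge_min lexx.
move=> A; suff : nrm (h t - g t) < Num.min r0 (nrm (g t - h t)).
  by rewrite lt_min (nrmB (h t)) ltxx andbF.
apply: A tT; last by rewrite gh subrr nrm0 lt_min r00.
by move=> s sT _; rewrite fh // subrr nrm0.
Qed.

(** Preimages close to z0 are picked by choice; separation makes the pick unique, hence continuous.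
    The step eps depends on T but not on the starting point, which allows it to be repeated. *)
Lemma ray_local f n psi (T : R) : f \is monic -> size f = n.+2 -> nonsing f psi ->
  exists2 eps, 0 < eps & forall (t0 : R) z0, 0 <= t0 <= T -> f.[z0] = t0%:C * cexp psi ->
    exists g, [/\ contp g, g t0 = z0 &
      forall t, t0 <= t <= t0 + eps -> f.[g t] = t%:C * cexp psi].
Proof.
move=> fm sf ns; have [B hB] := value_bound (T + 1) fm sf.
have [r r0 hr] := sep B sf ns.
(* Two picks are each within r / 3 of z0, and a competing preimage within r / 3 of a pick, so all
   distances that occur stay below r. *)
have r3 : 0 < r / 3 by rewrite divr_gt0.
pose eps := Num.min 1 ((r / 3) ^+ n.+1 / 2).
have eps0 : 0 < eps by rewrite lt_min ltr01 divr_gt0 // exprn_gt0.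
have eps1 : eps <= 1 by rewrite ge_min lexx.
have epsr : eps < (r / 3) ^+ n.+1.
  have : 0 < (r / 3) ^+ n.+1 by rewrite exprn_gt0.
  have : eps <= (r / 3) ^+ n.+1 / 2 by rewrite ge_min lexx orbT.
  lra.
clearbody eps; exists eps => // t0 z0 /andP[t00 t0T] fz0.
pose cl t := Num.min (Num.max t t0) (t0 + eps).
have clE t : t0 <= t <= t0 + eps -> cl t = t.
  by move=> /andP[h1 h2]; rewrite /cl (elimT max_idPl) // (elimT min_idPl).
have clP t : t0 <= cl t <= t0 + eps.
  by rewrite /cl le_min ge_min le_max lexx !orbT lexx orbT andbT lerDl ltW.
have ccl s t : `|cl s - cl t| <= `|s - t|.
  by apply: le_trans (lip1_min _ _ _) (lip1_max _ _ _).
clearbody cl.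
have [g0 Hg] : {g0 : R -> R[i] & forall t, f.[g0 t] = (cl t)%:C * cexp psi /\
    nrm (z0 - g0 t) < r / 3}.
  apply: (@boolp.choice _ _ (fun t v => f.[v] = (cl t)%:C * cexp psi /\
    nrm (z0 - v) < r / 3)) => t.
  have [|v fv zv] := @root_near _ f n (r / 3) z0 ((cl t)%:C * cexp psi) fm sf r3.
    rewrite fz0 target_dist distrC; apply: le_lt_trans epsr.
    by have /andP[h1 h2] := clP t; rewrite ger0_norm; lra.
  by exists v.
have gB t z : f.[z] = (cl t)%:C * cexp psi -> nrm z <= B.
  move=> fz; apply: hB; rewrite fz nrm_target.
  by have /andP[h1 h2] := clP t; rewrite ger0_norm; lra.
exists g0; split.
- move=> t e e0; have e'0 : 0 < Num.min e (r / 3) by rewrite lt_min e0.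
  exists (Num.min e (r / 3) ^+ n.+1); first by rewrite exprn_gt0.
  move=> s st; have [fs zs] := Hg s; have [ft zt] := Hg t.
  have [|v fv] := @root_near _ f n _ (g0 t) ((cl s)%:C * cexp psi) fm sf e'0.
    by rewrite ft target_dist distrC; apply: le_lt_trans (ccl _ _) st.
  rewrite lt_min => /andP[v1 v2].
  suff <- : v = g0 s by rewrite nrmB.
  apply: (hr _ _ (cl s)) => //; [exact: gB fv|exact: gB fs|].
  have := nrm_tri v (g0 t) (g0 s); have := nrm_tri (g0 t) z0 (g0 s).
  by rewrite (nrmB v (g0 t)) (nrmB (g0 t) z0); lra.
- have [ft zt] := Hg t0; have c0 : cl t0 = t0 by apply: clE; rewrite lexx lerDl ltW.
  rewrite c0 in ft; apply: (hr _ _ t0) => //.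
  + by apply: (gB t0); rewrite c0.
  + by apply: (gB t0); rewrite c0.
  + by rewrite nrmB; lra.
- by move=> t /clE e; have [-> _] := Hg t; rewrite e.
Qed.

End Rays.

Section GlobalRays.
Import Order.TTheory GRing.Theory Num.Theory.
Local Open Scope ring_scope.
Local Open Scope complex_scope.
Context {R : realType}.
Implicit Types (z w : R[i]) (f p q : {poly R[i]}) (g h : R -> R[i]).

Lemma ray_on_exists f n psi (T : R) z0 : f \is monic -> size f = n.+2 ->
  nonsing f psi -> f.[z0] = 0 -> exists g, ray_on f psi T g /\ g 0 = z0.
Proof.
move=> fm sf ns fz0; have [eps eps0 loc] := ray_local (`|T|) fm sf ns.
have step k : k%:R * eps <= `|T| + eps ->
    exists g, ray_on f psi (k%:R * eps) g /\ g 0 = z0.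
  elim: k => [_|k IH kT].
    exists (fun=> z0); split=> //; split; first exact: contp_cst.
    by move=> t; rewrite mul0r => t0; rewrite fz0 -(le_anti t0) mul0r.
  rewrite -natr1 mulrDl mul1r in kT *; have kT' : k%:R * eps <= `|T| by lra.
  have [|g [[cg fg] g0]] := IH; first by lra.
  have k0 : 0 <= k%:R * eps by rewrite mulr_ge0 // ltW.
  set s := k%:R * eps in kT kT' fg k0 *.
  have [||h [ch hs fh]] := loc s (g s); first by rewrite k0.
    by apply: fg; rewrite k0 lexx.
  have cmin : contR (fun t => Num.min t s) by apply: contR_lip1 => *; exact: lip1_min.
  have cmax : contR (fun t => Num.max t s) by apply: contR_lip1 => *; exact: lip1_max.
  (* For t <= s the bracket vanishes because h s = g s; for t >= s the first term is frozen at g s.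
     The glued path is thus a sum of continuous paths. *)
  exists (fun t => g (Num.min t s) + (h (Num.max t s) - g s)); split; first split.
  - apply: contpD; first exact: (contp_comp cg cmin).
    by apply: contpD; [exact: (contp_comp ch cmax)|exact: contp_cst].
  - move=> t /andP[t0 t1]; have [ts|st] := leP t s.
      by rewrite hs subrr addr0 fg // t0.
    by rewrite addrC subrK fh // ltW.
  - by rewrite (elimT min_idPl) // (elimT max_idPr) // hs subrr addr0.
have x0 : 0 <= `|T| / eps by rewrite divr_ge0 // ltW.
have /andP[k1 k2] := truncn_itv x0; set k := Num.truncn _ in k1 k2.
have [|g [[cg fg] g0]] := step k.+1.
  by rewrite -natr1 mulrDl mul1r lerD2r -ler_pdivlMr.
exists g; split=> //; split=> // t /andP[t0 tT]; apply: fg; rewrite t0.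
apply: le_trans tT _; apply: le_trans (ler_norm _) _.
by rewrite -ler_pdivrMr // ltW.
Qed.

Definition is_ray f psi g : Prop :=
  contp g /\ forall t, 0 <= t -> f.[g t] = t%:C * cexp psi.

Lemma is_ray_on f psi g T : is_ray f psi g -> ray_on f psi T g.
Proof. by move=> [cg fg]; split=> // t /andP[t0 _]; apply: fg. Qed.

Lemma ray_uniq f n psi g h : f \is monic -> size f = n.+2 ->
  nonsing f psi -> is_ray f psi g -> is_ray f psi h -> g 0 = h 0 ->
  forall t, 0 <= t -> g t = h t.
Proof.
move=> fm sf ns /is_ray_on rg /is_ray_on rh gh t t0.
by apply: (ray_on_uniq fm sf ns (rg t) (rh t) gh); rewrite t0 lexx.
Qed.

Lemma ray_exists f n psi z0 : f \is monic -> size f = n.+2 ->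
  nonsing f psi -> f.[z0] = 0 -> exists g, is_ray f psi g /\ g 0 = z0.
Proof.
move=> fm sf ns fz0.
have [G HG] : {G : nat -> R -> R[i] & forall m, ray_on f psi m%:R (G m) /\ G m 0 = z0}.
  apply: (@boolp.choice _ _ (fun m g => ray_on f psi m%:R g /\ g 0 = z0)) => m.
  exact: (ray_on_exists m%:R fm sf ns fz0).
have GE m k t : 0 <= t -> t <= m%:R -> t <= k%:R -> G m t = G k t.
  wlog mk : m k / (m <= k)%N.
    move=> W t0 tm tk; have [/W->//|/ltnW/W W'] := leqP m k.
    by rewrite (W' t0 tk tm).
  move=> t0 tm _; have [[cm fm'] m0] := HG m; have [[ck fk] k0] := HG k.
  have rk : ray_on f psi m%:R (G k).
    split=> // s /andP[s0 sm]; apply: fk; rewrite s0 (le_trans sm) // ler_nat //.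
  by apply: (ray_on_uniq fm sf ns (proj1 (HG m)) rk); rewrite ?m0 ?k0 ?t0.
pose c (t : R) := Num.max t 0.
have c0 t : 0 <= c t by rewrite /c le_max lexx orbT.
have cc s t : `|c s - c t| <= `|s - t| by exact: lip1_max.
have tr t : c t <= (Num.truncn (c t)).+1%:R.
  by have /andP[_ /ltW] := truncn_itv (c0 t).
exists (fun t => G (Num.truncn (c t)).+1 (c t)); split; first split.
- move=> t e e0; pose m := (Num.truncn (c t)).+2.
  have tm : c t + 1 <= m%:R by rewrite /m -natr1 lerD2r.
  have cm : contp (G m \o c).
    by apply: contp_comp; [case: (HG m) => -[]|exact: contR_lip1].
  have [d d0 hd] := cm t e e0; exists (Num.min d 1); first by rewrite lt_min d0 ltr01.
  move=> s; rewrite lt_min => /andP[sd s1].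
  have cs : c s <= m%:R.
    by have := cc s t; have := ler_norm (c s - c t); lra.
  by rewrite (GE _ m) // (GE (Num.truncn (c t)).+1 m) ?hd //; lra.
- move=> t t0; have ct : c t = t by rewrite /c (elimT max_idPl).
  have := tr t; rewrite ct => tt; have [[_ h] _] := HG (Num.truncn t).+1.
  by rewrite h // t0.
- have -> : c 0 = 0 by rewrite /c maxxx.
  by case: (HG (Num.truncn (0 : R)).+1).
Qed.

End GlobalRays.

(** * Asymptotic directions *)

Section Directions.
Import Order.TTheory GRing.Theory Num.Theory.
Local Open Scope ring_scope.
Local Open Scope complex_scope.
Context {R : realType}.
Implicit Types (z w : R[i]) (f p q : {poly R[i]}) (g h : R -> R[i]).

(** Distance from z to the point of the same modulus in direction phi: the deviation in angle,
    scaled by |z|, without a branch of the argument. *)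
Definition off_dir z (phi : R) : R := nrm (z - (nrm z)%:C * cexp phi).

Definition dir g (phi : R) : Prop := forall e : R, 0 < e ->
  exists T : R, forall t, T <= t -> off_dir (g t) phi < e * nrm (g t).

Lemma off_dir_tri z (a b : R) : nrm z * nrm (cexp a - cexp b) <= off_dir z a + off_dir z b.
Proof.
have -> : nrm z * nrm (cexp a - cexp b) =
    nrm ((nrm z)%:C * cexp a - (nrm z)%:C * cexp b).
  by rewrite -mulrBr nrmM nrm_real ger0_norm ?nrm_ge0.
rewrite /off_dir (nrmB z ((nrm z)%:C * cexp a)); exact: nrm_tri.
Qed.

Lemma nrm_Xn_sub_cexp n z (r psi : R) : 0 < r -> 
  nrm (z ^+ n.+1 - (r ^+ n.+1)%:C * cexp psi) =
  \prod_(0 <= l < n.+1) nrm (z - r%:C * cexp ((psi + 2 * pi * l%:R) / n.+1%:R)).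
Proof.
move=> r0; pose c := r%:C * cexp (psi / n.+1%:R).
have rC0 : r%:C != 0 :> R[i] by rewrite -nrm_gt0 nrm_real normr_gt0 gt_eqF.
have c0 : c != 0 by rewrite mulf_neq0 ?cexp_neq0.
have -> : (r ^+ n.+1)%:C * cexp psi = c ^+ n.+1.
  by rewrite exprMn rmorphXn /= cexpX divfK // pnatr_eq0.
have -> : z ^+ n.+1 - c ^+ n.+1 = c ^+ n.+1 * ((z / c) ^+ n.+1 - 1).
  by rewrite mulrBr -exprMn mulrC divfK // mulr1.
rewrite nrmM nrm_Xn_sub1 // nrmX -[in X in X * _](subn0 n.+1) -prodr_const_nat.
rewrite -big_split /=; apply: eq_bigr => l _.
rewrite -nrmM mulrBr mulrC divfK // /c -(mulrA r%:C) -cexpD; congr (nrm (_ - _ * cexp _)).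
by rewrite [RHS]mulrDl.
Qed.

(** By [nrm_Xn_sub_cexp] the left side is a product of n + 1 distances to points of modulus |z| in
    the admissible directions, so not all of them can reach d |z|. *)
Lemma near_dir n z (psi d : R) : 0 < nrm z -> 0 <= d ->
  nrm (z ^+ n.+1 - (nrm z ^+ n.+1)%:C * cexp psi) < (d * nrm z) ^+ n.+1 ->
  exists2 l, (l < n.+1)%N & off_dir z ((psi + 2 * pi * l%:R) / n.+1%:R) < d * nrm z.
Proof.
move=> z0 d0; rewrite nrm_Xn_sub_cexp // => H; apply: contrapT => N.
have := H; rewrite ltNge => /negP; apply.
rewrite -[in leLHS](subn0 n.+1) -prodr_const_nat big_nat [leRHS]big_nat.
apply: ler_prod => l /andP[_ ln]; rewrite mulr_ge0 ?nrm_ge0 //=.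
by rewrite leNgt; apply/negP => hl; apply: N; exists l.
Qed.

Lemma cexp_root n (a b : R) : cexp (a * n.+1%:R) = cexp (b * n.+1%:R) ->
  exists2 l, (l < n.+1)%N & cexp a = cexp (b + 2 * pi * l%:R / n.+1%:R).
Proof.
move=> ab; have : nrm (cexp (a - b) ^+ n.+1 - 1) = 0.
  by rewrite cexpX mulrBl cexpD ab -cexpD subrr cexp0 subrr nrm0.
rewrite nrm_Xn_sub1 // => /eqP; rewrite prodf_seq_eq0 => /hasP[l].
rewrite mem_index_iota => /andP[_ ln] /=; rewrite nrm_eq0 subr_eq0 => /eqP e.
by exists l => //; rewrite cexpD -e -cexpD addrC subrK.
Qed.

Lemma unit_sep n : exists2 s : R, 0 < s & forall a b : R,
  cexp (a * n.+1%:R) = cexp (b * n.+1%:R) -> nrm (cexp a - cexp b) < s -> cexp a = cexp b.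
Proof.
pose x l : R := nrm (cexp (2 * pi * l%:R / n.+1%:R) - 1 : R[i]).
have [s s0 hs] : exists2 s : R, 0 < s & forall l, (l < n.+1)%N -> x l <> 0 -> s <= x l.
  elim: (n.+1) => [|m [s s0 hs]]; first by exists 1.
  have [xm|xm] := eqVneq (x m) 0.
    exists s => // l; rewrite ltnS leq_eqVlt => /predU1P[->|/hs//]; by rewrite xm.
  exists (Num.min s (x m)).
    by rewrite lt_min s0 lt_neqAle eq_sym xm nrm_ge0.
  move=> l; rewrite ltnS leq_eqVlt => /predU1P[->|/hs h]; first by rewrite ge_min lexx orbT.
  by move=> /h; rewrite ge_min => ->.
exists s => // a b /cexp_root[l ln ->]; rewrite cexpD -{2}[cexp b]mulr1 -mulrBr nrmM nrm_cexp mul1r.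
move=> h; have [xl|/eqP xl] := eqVneq (x l) 0.
  by move/eqP: xl; rewrite nrm_eq0 subr_eq0 => /eqP ->; rewrite mulr1.
by have := hs _ ln xl; rewrite leNgt h.
Qed.

Lemma far f n (e : R) : f \is monic -> size f = n.+2 -> 0 < e ->
  exists2 T, 0 <= T & forall z (psi t : R), T <= t -> f.[z] = t%:C * cexp psi ->
    1 <= nrm z /\ nrm (z ^+ n.+1 - (nrm z ^+ n.+1)%:C * cexp psi) <= e * nrm z ^+ n.+1.
Proof.
move=> fm sf e0; have e2 : 0 < e / 2 by rewrite divr_gt0.
have [rho r1 hr] := monic_growth fm sf e2.
have [M M0 hM] := poly_bounded f rho.
exists (M + 1); first by rewrite addr_ge0 // ltW.
move=> z psi t tM fz; have t0 : 0 <= t by lra.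
have zr : rho <= nrm z.
  rewrite leNgt; apply/negP => /ltW/hM; rewrite fz nrm_target ger0_norm //; lra.
split; first exact: le_trans zr.
have := hr z zr; rewrite fz => h1.
have h2 : `|t - nrm z ^+ n.+1| <= e / 2 * nrm z ^+ n.+1.
  have := nrm_dist (t%:C * cexp psi) (z ^+ n.+1).
  by rewrite nrm_target nrmX (ger0_norm t0) => h; apply: le_trans h h1.
rewrite -(target_dist _ _ psi) in h2; rewrite nrmB in h1.
apply: le_trans (nrm_tri _ (t%:C * cexp psi) _) _.
by rewrite [e]splitr mulrDl lerD.
Qed.

Lemma far_dir f n (d : R) : f \is monic -> size f = n.+2 -> 0 < d ->
  exists2 T, 0 <= T & forall z (psi t : R), T <= t -> f.[z] = t%:C * cexp psi ->
    1 <= nrm z /\ exists2 l, (l < n.+1)%N &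
      off_dir z ((psi + 2 * pi * l%:R) / n.+1%:R) < d * nrm z.
Proof.
move=> fm sf d0; have e0 : 0 < d ^+ n.+1 / 2 by rewrite divr_gt0 // exprn_gt0.
have [T T0 h] := far fm sf e0; exists T => // z psi t Tt fz.
have [z1 hz] := h z psi t Tt fz; split=> //; have z0 : 0 < nrm z by lra.
apply: near_dir => //; first exact: ltW.
apply: le_lt_trans hz _; rewrite exprMn ltr_pM2r ?exprn_gt0 //.
by rewrite ltr_pdivrMr // ltr_pMr ?exprn_gt0 // ltr1n.
Qed.

Lemma contR_off g phi (c : R) : contp g ->
  contR (fun t => off_dir (g t) phi - c * nrm (g t)).
Proof.
move=> cg t e e0; pose k : R := 2 + `|c|.
have k0 : 0 < k by rewrite ltr_wpDr.
have ek : 0 < e / k by rewrite divr_gt0.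
have [d d0 hd] := cg t _ ek; exists d => // s /hd; rewrite ltr_pdivlMr // => h.
apply: le_lt_trans h.
have -> : off_dir (g s) phi - c * nrm (g s) - (off_dir (g t) phi - c * nrm (g t)) =
   (off_dir (g s) phi - off_dir (g t) phi) - c * (nrm (g s) - nrm (g t)) by ring.
apply: le_trans (ler_normB _ _) _; rewrite normrM /k mulrDr lerD //; last first.
  by rewrite mulrC ler_wpM2r // nrm_dist.
apply: le_trans (nrm_dist _ _) _.
have -> : g s - (nrm (g s))%:C * cexp phi - (g t - (nrm (g t))%:C * cexp phi) =
  (g s - g t) - ((nrm (g s))%:C * cexp phi - (nrm (g t))%:C * cexp phi) by ring.
apply: le_trans (nrmD _ _) _; rewrite nrmN target_dist mulrDr mulr1 lerD //.
exact: nrm_dist.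
Qed.

(** Far out a lift is within s / 4, relative to its modulus, of one of the admissible directions,
    and these are s apart. So it cannot meet the barrier at s / 2 from phi, and the direction it is
    close to remains phi. *)
Lemma end_lock f n : f \is monic -> size f = n.+2 ->
  exists2 d0, 0 < d0 & exists2 T0, 0 <= T0 & forall psi phi g (t0 : R),
    is_ray f psi g -> cexp (phi * n.+1%:R) = cexp psi -> T0 <= t0 ->
    off_dir (g t0) phi < d0 * nrm (g t0) -> dir g phi.
Proof.
move=> fm sf; have [s s0 hs] := unit_sep n.
have s4 : 0 < s / 4 by rewrite divr_gt0.
have [T0 T00 hT0] := far_dir fm sf s4.
exists (s / 2); first by rewrite divr_gt0.
exists T0 => // psi phi g t0 [cg fg] pp Tt0 h0.
have labelE l : cexp ((psi + 2 * pi * l%:R) / n.+1%:R * n.+1%:R) = cexp (phi * n.+1%:R).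
  by rewrite divfK ?pnatr_eq0 // cexpD2pin pp.
have close z l (d : R) : 1 <= nrm z -> d <= s / 4 ->
    off_dir z ((psi + 2 * pi * l%:R) / n.+1%:R) < d * nrm z ->
    off_dir z phi <= s / 2 * nrm z -> off_dir z phi < d * nrm z.
  move=> z1 ds hl hp; have z0 : 0 < nrm z by lra.
  suff e : cexp ((psi + 2 * pi * l%:R) / n.+1%:R) = cexp phi.
    by move: hl; rewrite /off_dir e.
  apply: hs (labelE l) _; rewrite -(ltr_pM2l z0).
  have := off_dir_tri z ((psi + 2 * pi * l%:R) / n.+1%:R) phi.
  have : d * nrm z <= s / 4 * nrm z by rewrite ler_pM2r.
  by rewrite (mulrC _ s); nra.
have stay t : t0 <= t -> off_dir (g t) phi < s / 2 * nrm (g t).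
  move=> tt; rewrite -subr_lt0.
  have L := @avoid_lt _ _ t0 t 0 (contR_off phi (s / 2) cg) tt.
  apply: L => /=; last by rewrite subr_lt0.
  move=> u /andP[tu _] /= /eqP; rewrite subr_eq0 => /eqP hu.
  have Tu : T0 <= u by lra.
  have u0 : 0 <= u by lra.
  have [z1 [l ln hl]] := hT0 _ _ _ Tu (fg u u0).
  have := close _ _ _ z1 (lexx _) hl; rewrite hu lexx => /(_ isT).
  by rewrite ltr_pM2r; lra.
move=> e e0; have m0 : 0 < Num.min e (s / 4) by rewrite lt_min e0.
have [T1 T10 hT1] := far_dir fm sf m0.
exists (Num.max t0 T1) => t; rewrite ge_max => /andP[tt T1t].
have t0' : 0 <= t by lra.
have [z1 [l ln hl]] := hT1 _ _ _ T1t (fg t t0').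
have := close _ _ (Num.min e (s / 4)) z1; rewrite ge_min lexx orbT => /(_ _ isT hl (ltW (stay t tt))).
move=> h; apply: lt_le_trans h _.
by rewrite ler_wpM2r ?nrm_ge0 // ge_min lexx.
Qed.

Lemma pend_exists f n psi g : f \is monic -> size f = n.+2 -> is_ray f psi g ->
  exists2 l, (l < n.+1)%N & dir g ((psi + 2 * pi * l%:R) / n.+1%:R).
Proof.
move=> fm sf rg; have [d0 d00 [T0 T00 H]] := end_lock fm sf.
have [T1 T10 hT1] := far_dir fm sf d00.
pose t := Num.max T0 T1; have T1t : T1 <= t by rewrite le_max lexx orbT.
have t0 : 0 <= t by lra.
have [z1 [l ln hl]] := hT1 _ _ _ T1t (proj2 rg t t0).
exists l => //; apply: (H psi _ g t) => //; last by rewrite le_max lexx.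
by rewrite divfK ?pnatr_eq0 // cexpD2pin.
Qed.

Lemma ray_large f n psi g (B : R) : f \is monic -> size f = n.+2 -> is_ray f psi g ->
  exists T, forall t, T <= t -> B <= nrm (g t).
Proof.
move=> fm sf [cg fg]; have [M M0 hM] := poly_bounded f B.
exists (M + 1) => t tM; have t0 : 0 <= t by lra.
rewrite leNgt; apply/negP => /ltW/hM; rewrite fg // nrm_target ger0_norm //; lra.
Qed.

Lemma dir_uniq g (a b : R) : dir g a -> dir g b -> cexp a = cexp b.
Proof.
move=> ga gb; apply/eqP; rewrite -subr_eq0 -nrm_eq0 eq_le nrm_ge0 andbT leNgt.
apply/negP => h; have h4 : 0 < nrm (cexp a - cexp b) / 4 by rewrite divr_gt0.
have [[T1 h1] [T2 h2]] := (ga _ h4, gb _ h4).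
pose t := Num.max T1 T2.
have := h1 t; have := h2 t; rewrite !le_max !lexx orbT => /(_ isT) h2t /(_ isT) h1t.
have := off_dir_tri (g t) a b; have := nrm_ge0 (g t).
have : 0 <= off_dir (g t) a by exact: nrm_ge0.
have : 0 <= off_dir (g t) b by exact: nrm_ge0.
move: h1t h2t h; move: (off_dir _ _) (off_dir _ _) (nrm _) (nrm _) => x y c d; nra.
Qed.

End Directions.

(** * Injectivity far out: distinct roots have distinct ends *)

Section Ends.
Import Order.TTheory GRing.Theory Num.Theory.
Local Open Scope ring_scope.
Local Open Scope complex_scope.
Context {R : realType}.
Implicit Types (z w : R[i]) (f p q : {poly R[i]}) (g h : R -> R[i]).

Lemma poly_lipschitz_le p n : (size p <= n.+1)%N -> exists2 K, 0 < K &
  forall z w m, 1 <= m -> nrm z <= m -> nrm w <= m ->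
    nrm (p.[z] - p.[w]) * m <= K * m ^+ n * nrm (z - w).
Proof.
elim: n p => [|n IH] p.
  move=> /size1_polyC ->; exists 1 => // z w m _ _ _.
  by rewrite !hornerC subrr nrm0 mul0r mulr1 mul1r nrm_ge0.
move=> sp; rewrite -(poly_take_drop 1 p) expr1.
have sd : (size (drop_poly 1 p) <= n.+1)%N by rewrite size_drop_poly; lia.
have [K K0 hK] := IH _ sd; have [K' K'0 hK'] := poly_growth_le sd.
have -> : take_poly 1 p = (p`_0)%:P.
  by apply/polyP => i; rewrite coef_take_poly coefC; case: i.
exists (K + K'); first by rewrite addr_gt0.
move=> z w m m1 zm wm; rewrite !hornerD !hornerC !hornerMX.
set q := drop_poly 1 p in hK hK' *; have m0 : 0 <= m by lra.
have -> : p`_0 + q.[z] * z - (p`_0 + q.[w] * w) = (q.[z] - q.[w]) * z + q.[w] * (z - w).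
  by ring.
have h1 : nrm (q.[z] - q.[w]) * nrm z * m <= K * m ^+ n.+1 * nrm (z - w).
  rewrite mulrAC.
  have -> : K * m ^+ n.+1 * nrm (z - w) = K * m ^+ n * nrm (z - w) * m.
    by rewrite exprSr; ring.
  by rewrite ler_pM ?mulr_ge0 ?nrm_ge0 ?hK.
have h2 : nrm q.[w] * nrm (z - w) * m <= K' * m ^+ n.+1 * nrm (z - w).
  rewrite mulrAC ler_wpM2r ?nrm_ge0 // exprSr mulrA ler_wpM2r //.
  exact: hK'.
apply: (@le_trans _ _ ((nrm ((q.[z] - q.[w]) * z) + nrm (q.[w] * (z - w))) * m)).
  by rewrite ler_wpM2r // nrmD.
by rewrite !nrmM mulrDl (mulrDl K) (mulrDl (K * _)) lerD.
Qed.

Lemma expr1D_le (e : R) n : 0 <= e <= 1 -> (1 + e) ^+ n <= 1 + e * 2 ^+ n.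
Proof.
move=> /andP[e0 e1]; elim: n => [|n IH]; first by rewrite !expr0 mulr1 lerDl.
have h : (1 + e) ^+ n <= 2 ^+ n by apply: lerXn2r; rewrite ?nnegrE //; lra.
have : e * (1 + e) ^+ n <= e * 2 ^+ n by rewrite ler_wpM2l.
rewrite !exprS mulrDl mul1r mulrCA; lra.
Qed.

Lemma near_one_mul (e : R) x y i j : nrm x <= e -> nrm y <= e ->
  nrm ((1 + x) ^+ i * (1 + y) ^+ j - 1) <= (1 + e) ^+ (i + j) - 1.
Proof.
move=> xe ye; have e0 : 0 <= e by apply: le_trans xe; exact: nrm_ge0.
have step z a k : nrm z <= e -> nrm (a - 1) <= (1 + e) ^+ k - 1 ->
    nrm ((1 + z) * a - 1) <= (1 + e) ^+ k.+1 - 1.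
  move=> ze ha; have -> : (1 + z) * a - 1 = (a - 1) * (1 + z) + z by ring.
  apply: le_trans (nrmD _ _) _; rewrite nrmM.
  have h1 : nrm (1 + z) <= 1 + e.
    by apply: le_trans (nrmD _ _) _; rewrite nrm1 lerD2l.
  have -> : (1 + e) ^+ k.+1 - 1 = ((1 + e) ^+ k - 1) * (1 + e) + e.
    by rewrite exprS; ring.
  by rewrite lerD // ler_pM ?nrm_ge0.
elim: i => [|i IH].
  rewrite expr0 mul1r add0n; elim: j => [|j IH]; first by rewrite !expr0 !subrr nrm0.
  by rewrite exprS; apply: step.
by rewrite addSn exprS -mulrA; apply: step.
Qed.

(* Far out in a narrow sector the difference quotient of f is dominated by the
   quotient of the leading power, so f is injective there. *)
Lemma far_inj f n : f \is monic -> size f = n.+2 -> exists2 e : R, 0 < e &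
  exists m0 : R, forall z w phi, m0 <= nrm z -> m0 <= nrm w ->
    off_dir z phi < e * nrm z -> off_dir w phi < e * nrm w ->
    f.[z] = f.[w] -> z = w.
Proof.
(* Chosen so that (1 + e)^n - 1 <= 1 / 2: a product of n factors within e of 1 then has real part at
   least 1 / 2. *)
move=> fm sf; pose e : R := (2 * 2 ^+ n)^-1.
have p2 : 1 <= 2 ^+ n :> R by rewrite exprn_ege1 // ler1n.
have e0 : 0 < e by rewrite invr_gt0; lra.
have e1 : e <= 1 by rewrite invf_le1; lra.
have en : (1 + e) ^+ n - 1 <= 1 / 2.
  have h := @expr1D_le e n; rewrite (ltW e0) e1 in h; have {h} h := h isT.
  have : e * 2 ^+ n = 1 / 2 by rewrite /e invfM -mulrA mulVf ?mulr1 ?div1r // gt_eqF //; lra.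
  lra.
have [|K K0 hK] := @poly_lipschitz_le (f - 'X^(n.+1)) n.
  apply/leq_sizeP => j; rewrite leq_eqVlt => /predU1P[<-|nj].
    rewrite coefB coefXn eqxx; have := monicP fm.
    by rewrite lead_coefE sf /= => ->; rewrite subrr.
  by rewrite coefB coefXn nth_default ?sf // gtn_eqF // subr0.
exists e => //; exists (2 * K + 1) => z w phi zm wm oz ow fzw.
apply/eqP; apply: contraTT isT => zw.
have zw0 : 0 < nrm (z - w) by rewrite nrm_gt0 subr_eq0.
pose m := Num.max (nrm z) (nrm w).
have m1 : 2 * K + 1 <= m by rewrite le_max zm.
have m0 : 0 < m by lra.
have polar u : 2 * K + 1 <= nrm u -> off_dir u phi < e * nrm u ->
    exists2 x, nrm x <= e & u = (nrm u)%:C * cexp phi * (1 + x).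
  move=> um ou; have u0 : 0 < nrm u by lra.
  have c0 : (nrm u)%:C * cexp phi != 0.
    by rewrite -nrm_gt0 nrm_target gtr0_norm.
  exists (u / ((nrm u)%:C * cexp phi) - 1); last by rewrite addrC subrK mulrC divfK.
  rewrite -(ler_pM2r u0) -{2}(gtr0_norm u0) -(nrm_target _ phi) -nrmM mulrBl mul1r divfK //.
  exact: ltW.
have [x xe zx] := polar z zm oz; have [y ye wy] := polar w wm ow.
(* The left side is z^(n+1) - w^(n+1). As f z = f w, it comes from the lower order terms alone,
   which bounds it by K m^(n-1) |z - w|. *)
have S : (z - w) * \sum_(i < n.+1) z ^+ (n - i) * w ^+ i =
    - ((f - 'X^(n.+1)).[z] - (f - 'X^(n.+1)).[w]).
  rewrite !hornerD !hornerN !hornerXn fzw -subrXX; ring.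
have h1 := hK z w m; rewrite -[X in nrm X * m <= _]opprK nrmN -S nrmM in h1.
have {}h1 : nrm (\sum_(i < n.+1) z ^+ (n - i) * w ^+ i) * m <= K * m ^+ n.
  rewrite -(ler_pM2l zw0) mulrA (mulrC _ (K * _)); apply: h1; first by lra.
    by rewrite le_max lexx.
  by rewrite le_max lexx orbT.
suff h2 : m ^+ n / 2 <= nrm (\sum_(i < n.+1) z ^+ (n - i) * w ^+ i).
  have : m ^+ n / 2 * m <= K * m ^+ n by apply: le_trans h1; rewrite ler_pM2r.
  rewrite (mulrC K) -mulrA ler_pM2l ?exprn_gt0 //; lra.
(* After division by e^(i phi n) every term has real part at least half its modulus, and the term of
   largest modulus alone contributes m^n / 2. *)
have term i : (i < n.+1)%N -> nrm z ^+ (n - i) * nrm w ^+ i / 2 <=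
    complex.Re (cexp (- (phi * n%:R)) * (z ^+ (n - i) * w ^+ i)).
  move=> iN; have zE : z ^+ (n - i) * w ^+ i = cexp (phi * n%:R) *
     ((nrm z ^+ (n - i) * nrm w ^+ i)%:C * ((1 + x) ^+ (n - i) * (1 + y) ^+ i)).
    have -> : phi * n%:R = phi * (n - i)%:R + phi * i%:R.
      by rewrite -mulrDr -natrD subnK.
    rewrite {1}zx {1}wy cexpD -!cexpX.
    by rewrite !exprMn rmorphM !rmorphXn /=; ring.
  rewrite zE mulrA cexpNM mul1r ReZ ler_wpM2l ?mulr_ge0 ?exprn_ge0 ?nrm_ge0 //.
  have := near_one_mul (n - i) i xe ye; rewrite subnK // => h.
  have := le_trans h en; have := nrm_Re ((1 + x) ^+ (n - i) * (1 + y) ^+ i - 1).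
  rewrite ReB /= ler_norml => /andP[]; lra.
apply: le_trans (_ : complex.Re (cexp (- (phi * n%:R)) *
  \sum_(i < n.+1) z ^+ (n - i) * w ^+ i) <= _); last first.
  apply: le_trans (ler_norm _) _; apply: le_trans (nrm_Re _) _.
  by rewrite nrmM nrm_cexp mul1r.
rewrite mulr_sumr (raddf_sum (@complex.Re R : Rcomplex R -> R)).
apply: le_trans (_ : \sum_(i < n.+1) nrm z ^+ (n - i) * nrm w ^+ i / 2 <= _); last first.
  by apply: ler_sum => i _; apply: term.
have pos (i : 'I_n.+1) : 0 <= nrm z ^+ (n - i) * nrm w ^+ i / 2.
  by rewrite divr_ge0 // mulr_ge0 // exprn_ge0 // nrm_ge0.
rewrite /m; case: (leP (nrm z) (nrm w)) => _.
  rewrite (bigD1 ord_max) //= subnn expr0 mul1r lerDl; exact: sumr_ge0.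
rewrite (bigD1 ord0) //= subn0 expr0 mulr1 lerDl; exact: sumr_ge0.
Qed.

(* For psi = th + pi * k this says that the component of z in the curve at angle
   th contains the asymptote with label k. *)
Definition reach f (N : nat) z (psi : R) : Prop :=
  exists g, [/\ is_ray f psi g, g 0 = z & dir g (psi / N%:R)].

(** Uniqueness backwards in time: from t down to 0, the distance of the two lifts starts at 0 and
    cannot take the value r / 2, since separation makes any distance below r vanish. *)
Lemma ray_meet f n psi g h (t : R) : f \is monic -> size f = n.+2 ->
  nonsing f psi -> is_ray f psi g -> is_ray f psi h -> 0 <= t -> g t = h t -> g 0 = h 0.
Proof.
move=> fm sf ns [cg fg] [ch fh] t0 ght.
have [B hB] := value_bound t fm sf; have [r r0 hr] := sep B sf ns.
pose x s := nrm (g (t - s) - h (t - s)).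
have cx : contR x.
  apply: contR_nrm; have cb : contR (fun s => t - s).
    apply: contR_lip1 => s u; rewrite opprB addrC addrA subrK distrC //.
  by apply: contpB; [exact: (contp_comp cg cb)|exact: (contp_comp ch cb)].
have B' s u : 0 <= s <= t -> f.[u] = s%:C * cexp psi -> nrm u <= B.
  by move=> /andP[s0 st] fu; apply: hB; rewrite fu nrm_target ger0_norm.
have eq s : 0 <= s <= t -> nrm (g s - h s) < r -> g s = h s.
  move=> st; have s0 : 0 <= s by case/andP: st.
  by apply: (hr _ _ s); rewrite ?(B' s) ?fg ?fh.
suff : x t < r / 2.
  rewrite /x subrr => xt; apply: eq; first by rewrite lexx.
  by lra.
apply: (avoid_lt cx t0); last by rewrite /x subr0 ght subrr nrm0 divr_gt0.
move=> s /andP[s0 st] xs; have ts : 0 <= t - s <= t by lra.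
have : g (t - s) = h (t - s) by apply: eq => //; rewrite -/(x s) xs; lra.
by move/eqP; rewrite -subr_eq0 -nrm_eq0 -/(x s) xs => /eqP; lra.
Qed.

(** Far out, equal values and nearly equal directions force equal points by [far_inj]; [ray_meet]
    carries the coincidence back to the roots. *)
Lemma reach_inj f n psi z w : f \is monic -> size f = n.+2 -> nonsing f psi ->
  reach f n.+1 z psi -> reach f n.+1 w psi -> z = w.
Proof.
move=> fm sf ns [g [rg <- dg]] [h [rh <- dh]].
have [e e0 [m0 H]] := far_inj fm sf.
have [[T1 h1] [T2 h2]] := (ray_large m0 fm sf rg, ray_large m0 fm sf rh).
have [[T3 h3] [T4 h4]] := (dg e e0, dh e e0).
pose t := Num.max (Num.max T1 T2) (Num.max (Num.max T3 T4) 0).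
have tE : [&& T1 <= t, T2 <= t, T3 <= t, T4 <= t & 0 <= t].
  by rewrite !le_max !lexx ?orbT.
have /and5P[t1 t2 t3 t4 t0] := tE.
apply: (ray_meet (t := t) fm sf ns rg rh t0).
apply: (H _ _ (psi / n.+1%:R)); rewrite ?h1 ?h2 ?h3 ?h4 //.
by case: rg rh => [_ ->] // [_ ->].
Qed.

End Ends.

(** * Stability of ends under small changes of the angle *)

Section Stability.
Import Order.TTheory GRing.Theory Num.Theory.
Local Open Scope ring_scope.
Local Open Scope complex_scope.
Context {R : realType}.
Implicit Types (z w : R[i]) (f p q : {poly R[i]}) (g h : R -> R[i]).

Lemma seq_bound (rs : seq R[i]) (x : R[i] -> R) :
  exists2 M, 0 < M & forall r, r \in rs -> x r <= M.
Proof.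
elim: rs => [|r rs [M M0 h]]; first by exists 1.
exists (Num.max M (x r)); first by rewrite lt_max M0.
move=> r'; rewrite inE => /predU1P[->|/h]; rewrite le_max ?lexx ?orbT //.
by move=> ->.
Qed.

Lemma nonsing_open f n psi : size f = n.+2 -> nonsing f psi ->
  exists2 d, 0 < d & forall psi', `|psi' - psi| < d -> nonsing f psi'.
Proof.
move=> sf ns; have [mu mu0 hmu] := crit_gap sf ns.
have [rs rsP] := root_seq (deriv_neq0 sf).
have [M M0 hM] := seq_bound rs (fun c => nrm f.[c]).
have e0 : 0 < mu / M by rewrite divr_gt0.
have [d d0 hd] := cexp_cont (- psi) e0; exists d => // psi' pp c rc im0.
have := hd (- psi'); rewrite -opprD normrN => /(_ pp); rewrite ltr_pdivlMr // => h.
have := hmu c rc; rewrite leNgt => /negP; apply.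
have -> : complex.Im (cexp (- psi) * f.[c]) =
    - complex.Im ((cexp (- psi') - cexp (- psi)) * f.[c]).
  by rewrite mulrBl ImB im0 sub0r opprK.
rewrite normrN; apply: le_lt_trans (nrm_Im _) _; rewrite nrmM.
by apply: le_lt_trans h; rewrite ler_wpM2l ?nrm_ge0 // hM // -rsP.
Qed.

Lemma nonsing_cexp f (a b : R) : cexp a = cexp b \/ cexp a = - cexp b ->
  nonsing f a -> nonsing f b.
Proof.
have E (x y : R) : cexp x = cexp y -> cexp (- x) = cexp (- y).
  by move=> e; rewrite -!cexp_inv e.
move=> ab ns c /ns; case: ab => [/E -> //|ab].
have -> : cexp (- a) = - cexp (- b) by rewrite -!cexp_inv ab invrN.
by rewrite mulNr => h e; apply: h; rewrite -sub0r ImB e subr0.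
Qed.

Lemma is_ray_cexp f (a b : R) g : cexp a = cexp b -> is_ray f a g -> is_ray f b g.
Proof. by move=> ab [cg fg]; split=> // t t0; rewrite fg // ab. Qed.

Lemma dir_cexp g (a b : R) : cexp a = cexp b -> dir g a -> dir g b.
Proof. by move=> ab ga e /ga[T h]; exists T => t /h; rewrite /off_dir ab. Qed.

Lemma reach_cexp f N z (a b : R) : cexp a = cexp b ->
  cexp (a / N%:R) = cexp (b / N%:R) -> reach f N z a -> reach f N z b.
Proof.
move=> ab ab' [g [rg g0 dg]]; exists g; split=> //.
  exact: is_ray_cexp rg.
exact: dir_cexp dg.
Qed.

Lemma reach_period f N z (a : R) (k : nat) : (0 < N)%N ->
  reach f N z (a + 2 * pi * (N * k)%:R) <-> reach f N z a.
Proof.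
move=> N0; have N0' : N%:R != 0 :> R by rewrite pnatr_eq0 -lt0n.
have e1 : cexp (a + 2 * pi * (N * k)%:R) = cexp a by rewrite cexpD2pin.
have e2 : cexp ((a + 2 * pi * (N * k)%:R) / N%:R) = cexp (a / N%:R).
  have -> : (a + 2 * pi * (N * k)%:R) / N%:R = a / N%:R + 2 * pi * k%:R.
    by rewrite natrM; field.
  by rewrite cexpD2pin.
by split; apply: reach_cexp.
Qed.

Lemma reach_root f N z psi : reach f N z psi -> f.[z] = 0.
Proof. by move=> [g [[_ fg] <- _]]; rewrite fg // mul0r. Qed.

Lemma reach_exists f n psi z : f \is monic -> size f = n.+2 -> nonsing f psi ->
  f.[z] = 0 -> exists2 l, (l < n.+1)%N & reach f n.+1 z (psi + 2 * pi * l%:R).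
Proof.
move=> fm sf ns fz; have [g [rg g0]] := ray_exists fm sf ns fz.
have [l ln dg] := pend_exists fm sf rg; exists l => //; exists g; split=> //.
by apply: is_ray_cexp rg; rewrite cexpD2pin.
Qed.

Lemma reach_label f n z (a b : R) : f \is monic -> size f = n.+2 -> nonsing f a ->
  cexp a = cexp b -> reach f n.+1 z a -> reach f n.+1 z b ->
  cexp (a / n.+1%:R) = cexp (b / n.+1%:R).
Proof.
move=> fm sf ns ab [g [rg g0 dg]] [h [rh h0 dh]].
apply: (@dir_uniq _ g) => // e /dh[T hT]; exists (Num.max T 0) => t.
rewrite ge_max => /andP[tT t0].
have rh' : is_ray f a h by apply: is_ray_cexp rh.
by rewrite (ray_uniq fm sf ns rg rh' _ t0) ?g0 ?h0 //; apply: hT.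
Qed.

(** Up to a fixed time T the lift at a nearby angle stays in a tube around the given one; beyond T
    [end_lock] holds it in its direction. *)
Lemma reach_open f n psi z : f \is monic -> size f = n.+2 -> nonsing f psi ->
  reach f n.+1 z psi -> exists2 d, 0 < d &
    forall psi', `|psi' - psi| < d -> reach f n.+1 z psi'.
Proof.
move=> fm sf ns [g [rg gz dg]].
have [d1 d10 ns1] := nonsing_open sf ns.
have [d0 d00 [T0 T00 lockE]] := end_lock fm sf.
have d02 : 0 < d0 / 2 by rewrite divr_gt0.
have [T1 hT1] := dg _ d02; have [T2 hT2] := ray_large 1 fm sf rg.
pose T := Num.max (Num.max T0 T1) T2.
have tE : [&& T0 <= T, T1 <= T & T2 <= T] by rewrite !le_max !lexx ?orbT.
have /and3P[t0T t1T t2T] := tE; have T_0 : 0 <= T by lra.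
have [B [r0 [r00 tub]]] := tube T fm sf ns.
(* As |g T| >= 1, the bound 1 / 16 gives |h T| >= 15 / 16; the errors from d, from the direction of
   g and from the change of angle then add up to less than d0 |h T|. *)
pose d := Num.min r0 (Num.min (1 / 16) (d0 / 32)).
have dpos : 0 < d by rewrite !lt_min r00 /=; lra.
have [dr0 d116 d32] : [/\ d <= r0, d <= 1 / 16 & d <= d0 / 32].
  by split; rewrite !ge_min lexx ?orbT.
have [eta eta0 H] := tub d dpos dr0.
have d08 : 0 < d0 / 8 by rewrite divr_gt0.
have [d2 d20 h2] := cexp_cont (psi / n.+1%:R) d08.
have eT : 0 < eta / (T + 1) by rewrite divr_gt0 //; lra.
have [d3 d30 h3] := cexp_cont psi eT.
exists (Num.min d1 (Num.min d2 d3)); first by rewrite !lt_min d10 d20.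
move=> psi'; rewrite !lt_min => /and3P[p1 p2 p3].
have [h [rh hz]] := ray_exists fm sf (ns1 _ p1) (reach_root (ex_intro _ g (And3 rg gz dg))).
exists h; split=> //; apply: (lockE psi' _ h T) => //.
  by rewrite divfK // pnatr_eq0.
have near : nrm (h T - g T) < d.
  apply: (H g h (is_ray_on _ rg) (proj1 rh)); last by rewrite T_0 lexx.
    move=> t /andP[t0 tT] _; rewrite (proj2 rh) // -mulrBr nrmM nrm_real ger0_norm //.
    have := h3 _ p3; rewrite ltr_pdivlMr; last by lra.
    have := nrm_ge0 (cexp psi' - cexp psi); nra.
  by rewrite hz gz subrr nrm0.
clear gz hz.
have p2' : `|psi' / n.+1%:R - psi / n.+1%:R| < d2.
  rewrite -mulrBl normrM normfV (ger0_norm (ler0n _ _)).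
  by apply: le_lt_trans p2; rewrite ler_pdivrMr ?ltr0n // ler_peMr // ler1n.
have c1 := h2 _ p2'; have g1 := hT2 _ t2T; have o1 := hT1 _ t1T.
move: (nrm_dist (h T) (g T)); rewrite ler_norml => /andP[n1 n2].
rewrite /off_dir in o1 *.
set a := cexp (psi' / _) in c1 *; set b := cexp (psi / _) in c1 o1.
have -> : h T - (nrm (h T))%:C * a = (h T - g T) + (g T - (nrm (g T))%:C * b)
   + (((nrm (g T))%:C - (nrm (h T))%:C) * b - (nrm (h T))%:C * (a - b)) by ring.
apply: le_lt_trans (nrmD _ _) _.
have t1 := nrmD (h T - g T) (g T - (nrm (g T))%:C * b).
have t2 : nrm (((nrm (g T))%:C - (nrm (h T))%:C) * b - (nrm (h T))%:C * (a - b)) <=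
    `|nrm (g T) - nrm (h T)| + nrm (h T) * nrm (a - b).
  apply: le_trans (nrmD _ _) _; rewrite nrmN !nrmM nrm_cexp mulr1 -rmorphB !nrm_real.
  by rewrite (ger0_norm (nrm_ge0 (h T))).
have n3 : `|nrm (g T) - nrm (h T)| <= d 
  by rewrite ler_norml; clear -n1 n2 near; apply/andP; split; lra.
have hc : nrm (h T) * nrm (a - b) <= nrm (h T) * (d0 / 8).
  by rewrite ler_wpM2l ?nrm_ge0 // ltW.
move: t1 t2 hc near n1 n2 n3 o1 g1; move: (nrm (h T)) (nrm (g T)) => x y.
move: (nrm (h T - g T)) (nrm (g T - y%:C * b)) (nrm (h T - g T + _)) => k1 k2 k3.
move: (nrm (_ - x%:C * _)) `|y - x| (x * nrm (a - b)) => k4 k5 k6.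
move=> t1 t2 hc near n1 n2 n3 o1 g1.
have q1 : d0 * y <= d0 * (x + 1 / 16).
  by rewrite ler_wpM2l ?(ltW d00) //; clear -n1 near d116; clearbody d; lra.
have q2 : d0 * (15 / 16) <= d0 * x.
  by rewrite ler_wpM2l ?(ltW d00) //; clear -n1 n2 near g1 d116; clearbody d; lra.
clear -t1 t2 hc near n1 n2 n3 o1 g1 q1 q2 d32 d116 d00; clearbody d; lra.
Qed.

End Stability.

(** * Attaching a root near +oo *)

Section UpperArgument.
Import Order.TTheory GRing.Theory Num.Theory.
Local Open Scope ring_scope.
Local Open Scope complex_scope.
Context {R : realType}.
Implicit Types (z w u v : R[i]) (f p q : {poly R[i]}) (g h : R -> R[i]).

(* An argument of u only when u lies in the upper half plane. *)
Definition carg u : R := acos (complex.Re u / nrm u).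

Lemma carg_ratio u : 0 < complex.Im u -> -1 < complex.Re u / nrm u < 1.
Proof.
move=> iu; have n2 := nrm_sqr u.
have i2 : 0 < complex.Im u ^+ 2 by rewrite exprn_gt0.
have n0 : 0 < nrm u by rewrite lt_neqAle nrm_ge0 andbT eq_sym -sqrf_eq0; apply/eqP; nra.
rewrite ltr_pdivlMr // ltr_pdivrMr //.
rewrite mulN1r mul1r -ltr_norml ltNge; apply/negP => h.
have : nrm u ^+ 2 <= `|complex.Re u| ^+ 2 by rewrite lerXn2r ?nnegrE ?normr_ge0 ?(ltW n0).
by rewrite real_normK ?num_real // n2; lra.
Qed.

Lemma carg_polar u : 0 < complex.Im u ->
  0 < carg u < pi /\ u = (nrm u)%:C * cexp (carg u).
Proof.
move=> iu; have /andP[r1 r2] := carg_ratio iu.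
split; first by rewrite /carg acos_gt0 ?acos_ltpi // ?r1 ?r2 ?ltW.
have n0 : 0 < nrm u by rewrite nrm_gt0; apply: contraTneq iu => ->; rewrite ltxx.
apply: complex_ext; rewrite ?ReZ ?ImZ /=.
  by rewrite acosK ?in_itv /= ?(ltW r1) ?(ltW r2) // mulrC divfK // gt_eqF.
rewrite sin_acos ?(ltW r1) ?(ltW r2) //.
have -> : 1 - (complex.Re u / nrm u) ^+ 2 = (complex.Im u / nrm u) ^+ 2.
  rewrite !expr_div_n nrm_sqr; field.
  by rewrite -nrm_sqr expf_neq0 // gt_eqF.
rewrite sqrtr_sqr ger0_norm; first by rewrite mulrC divfK // gt_eqF.
by rewrite divr_ge0 // ltW.
Qed.

Lemma carg_cont u (e : R) : 0 < complex.Im u -> 0 < e ->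
  exists2 d, 0 < d & forall v, nrm (v - u) < d -> `|carg v - carg u| < e.
Proof.
move=> iu e0; have n0 : 0 < nrm u.
  by rewrite nrm_gt0; apply: contraTneq iu => ->; rewrite ltxx.
have /cvgrPdist_lt/(_ _ e0)/nbhs_ballP[d1 /= d10 h1] := continuous_acos (carg_ratio iu).
have d2 : 0 < d1 * nrm u / 4 by rewrite divr_gt0 // mulr_gt0.
exists (Num.min (nrm u / 2) (d1 * nrm u / 4)); first by rewrite lt_min d2 divr_gt0.
move=> v; rewrite lt_min => /andP[v1 v2].
rewrite distrC; apply: h1; rewrite /ball /=.
have nv := nrm_dist v u; have rv := nrm_Re (v - u); rewrite ReB in rv.
have nv2 : nrm u / 2 < nrm v.
  by move: nv; rewrite ler_norml => /andP[]; lra.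
have v0 : 0 < nrm v by lra.
have -> : complex.Re u / nrm u - complex.Re v / nrm v =
    (complex.Re u * (nrm v - nrm u) - (complex.Re v - complex.Re u) * nrm u) / (nrm u * nrm v).
  by field; rewrite !gt_eqF.
rewrite normrM normfV (gtr0_norm (mulr_gt0 n0 v0)) ltr_pdivrMr ?mulr_gt0 //.
apply: le_lt_trans (ler_normB _ _) _; rewrite !normrM (gtr0_norm n0).
have ru := nrm_Re u.
have q1 : `|complex.Re u| * `|nrm v - nrm u| <= nrm u * nrm (v - u) by apply: ler_pM.
have q2 : `|complex.Re v - complex.Re u| * nrm u <= nrm (v - u) * nrm u by rewrite ler_pM2r.
have q3 : nrm u * nrm (v - u) < nrm u * (d1 * nrm u / 4) by rewrite ltr_pM2l.
have q4 : d1 * nrm u * (nrm u / 2) < d1 * nrm u * nrm v by rewrite ltr_pM2l // mulr_gt0.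
have -> : d1 * (nrm u * nrm v) = d1 * nrm u * nrm v by ring.
rewrite (mulrC (nrm (v - u))) in q2.
by clear -q1 q2 q3 q4; lra.
Qed.

Lemma contR_carg g : contp g -> (forall t, 0 < complex.Im (g t)) ->
  contR (fun t => carg (g t)).
Proof.
move=> cg ig t e e0; have [d d0 hd] := carg_cont (ig t) e0.
by have [d' d'0 hd'] := cg t d d0; exists d' => // s /hd'/hd.
Qed.

Lemma carg_scale (r : R) u : 0 < r -> carg (r%:C * u) = carg u.
Proof.
move=> r0; have [->|u0] := eqVneq u 0; first by rewrite mulr0.
have n0 : 0 < nrm u by rewrite nrm_gt0.
by rewrite /carg ReZ nrmM nrm_real gtr0_norm //; congr acos; field; rewrite !gt_eqF.
Qed.

Lemma carg_near (phi eta : R) : 0 < phi < pi -> 0 < eta ->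
  exists2 e, 0 < e & forall u, off_dir u phi < e * nrm u ->
    0 < complex.Im u /\ `|carg u - phi| < eta.
Proof.
move=> pp eta0; have s0 : 0 < complex.Im (cexp phi) by exact: sin_gt0_pi.
have [d d0 hd] := carg_cont s0 eta0.
have cE : carg (cexp phi) = phi.
  by rewrite /carg nrm_cexp divr1 /= cosK // in_itv /=; case/andP: pp => ? ?; rewrite !ltW.
exists (Num.min d (complex.Im (cexp phi))); first by rewrite lt_min d0 s0.
move=> u hu; have u0 : 0 < nrm u.
  rewrite nrm_gt0; apply: contraTneq hu => ->.
  by rewrite nrm0 mulr0 -leNgt nrm_ge0.
pose v := (nrm u)^-1%:C * u.
have uv : u = (nrm u)%:C * v by rewrite mulrA -rmorphM divff ?gt_eqF // mul1r.
have {hu} hv : nrm (v - cexp phi) < Num.min d (complex.Im (cexp phi)).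
  rewrite -(ltr_pM2r u0); apply: le_lt_trans hu.
  rewrite /off_dir {2}uv -mulrBr nrmM nrm_real (gtr0_norm u0) mulrC //.
move: hv; rewrite lt_min => /andP[v1 v2]; have := nrm_Im (v - cexp phi).
rewrite ImB ler_norml => /andP[v3 v4].
have iv : 0 < complex.Im v by lra.
split; first by rewrite uv ImZ mulr_gt0.
by rewrite uv carg_scale // -cE; apply: hd.
Qed.

Lemma sin_gt0_lt_pi (x : R) : 0 < x < 2 * pi -> 0 < sin x -> x < pi.
Proof.
move=> /andP[x0 x2] sx; rewrite ltNge; apply/negP => px.
have : 0 <= sin (x - pi).
  apply: sin_ge0_pi; move: (pi_gt0 R) x2 px; move: pi => c *; apply/andP; split; lra.
by rewrite sinB cospi sinpi mulrN1 mulr0 subr0 oppr_ge0 leNgt sx.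
Qed.

Lemma cos_lt0_gt (x : R) : 0 < x < pi -> cos x < 0 -> pi / 2 < x.
Proof.
move=> /andP[x0 xp] cx; rewrite ltNge; apply/negP => px.
have : 0 <= cos x.
  apply: cos_ge0_pihalf; move: (pi_gt0 R) x0 xp px; move: pi => c *; apply/andP; split; lra.
by rewrite leNgt cx.
Qed.

Lemma cos_gt0_lt (x : R) : - pi < x < pi -> 0 < cos x -> - (pi / 2) < x < pi / 2.
Proof.
have H (y : R) : 0 <= y -> y < pi -> 0 < cos y -> y < pi / 2.
  move=> y0 yp cy; rewrite ltNge; apply/negP => py.
  have := @ltr_cos R y (pi / 2); rewrite !in_itv /= cos_pihalf.
  have p0 := pi_gt0 R; move: (pi_ge0 R); rewrite y0 (ltW yp) => p00.
  have -> : 0 <= (pi : R) / 2 <= pi by apply/andP; split; move: p0; move: pi => c; lra.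
  by move=> /(_ isT isT); rewrite cy => /esym; rewrite ltNge py.
move=> /andP[x1 x2] cx; have [x0|x0] := leP 0 x.
  rewrite H // andbT; move: (pi_gt0 R) x0; move: pi => c; lra.
have := H (- x); rewrite cosN oppr_ge0 (ltW x0) ltrNl => /(_ isT x1 cx).
move: (pi_gt0 R) x0; move: pi => c p0 x0 h; apply/andP; split; lra.
Qed.

End UpperArgument.

(** * Critical values after a root has been attached *)

Section AttachNonsingular.
Import Order.TTheory GRing.Theory Num.Theory.
Local Open Scope ring_scope.
Local Open Scope complex_scope.
Context {R : realType}.
Implicit Types (z u v : R[i]) (f p q G : {poly R[i]}) (g h : R -> R[i]) (w : R).

Lemma off_dir_lip u v (phi : R) : off_dir u phi <= off_dir v phi + 2 * nrm (u - v).
Proof.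
rewrite /off_dir.
have -> : u - (nrm u)%:C * cexp phi = (v - (nrm v)%:C * cexp phi) +
  ((u - v) - ((nrm u)%:C * cexp phi - (nrm v)%:C * cexp phi)) by ring.
apply: le_trans (nrmD _ _) _; rewrite lerD2l.
apply: le_trans (nrmD _ _) _; rewrite nrmN target_dist mulrDl mul1r lerD2l.
exact: nrm_dist.
Qed.

Lemma off_dir0_mul u v : off_dir (u * v) 0 <= off_dir u 0 * nrm v + nrm u * off_dir v 0.
Proof.
rewrite /off_dir !cexp0 !mulr1 nrmM rmorphM /=.
have -> : u * v - (nrm u)%:C * (nrm v)%:C =
  (u - (nrm u)%:C) * v + (nrm u)%:C * (v - (nrm v)%:C) by ring.
by apply: le_trans (nrmD _ _) _; rewrite !nrmM nrm_real (ger0_norm (nrm_ge0 u)).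
Qed.

Lemma off_dir0_exp u (e : R) k : off_dir u 0 <= e * nrm u ->
  off_dir (u ^+ k) 0 <= k%:R * e * nrm u ^+ k.
Proof.
move=> ue; elim: k => [|k IH].
  by rewrite expr0 /off_dir nrm1 cexp0 mulr1 subrr nrm0 !mul0r.
rewrite exprS; apply: le_trans (off_dir0_mul _ _) _; rewrite nrmX.
have h1 : off_dir u 0 * nrm u ^+ k <= e * nrm u * nrm u ^+ k.
  by rewrite ler_wpM2r // exprn_ge0 // nrm_ge0.
have h2 : nrm u * off_dir (u ^+ k) 0 <= nrm u * (k%:R * e * nrm u ^+ k).
  by rewrite ler_wpM2l // nrm_ge0.
apply: le_trans (lerD h1 h2) _.
by rewrite -[k.+1%:R]natr1 exprS le_eqVlt; apply/orP; left; apply/eqP; ring.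
Qed.

Lemma off_dir0_near u (a e : R) : 0 <= a -> nrm (u - a%:C) <= e -> off_dir u 0 <= 2 * e.
Proof.
move=> a0 ue; have := off_dir_lip u a%:C 0.
have -> : off_dir a%:C 0 = 0.
  by rewrite /off_dir nrm_real ger0_norm // cexp0 mulr1 subrr nrm0.
lra.
Qed.

Lemma off_dir0_Im u (psi : R) : 0 < nrm u -> off_dir u 0 < `|sin psi| * nrm u ->
  complex.Im (cexp (- psi) * u) <> 0.
Proof.
move=> u0 hu im0; pose v := u - (nrm u)%:C.
have e : u = v + (nrm u)%:C by rewrite subrK.
have := im0; rewrite e mulrDr mulrC [cexp _ * _%:C]mulrC.
have -> : complex.Im (v * cexp (- psi) + (nrm u)%:C * cexp (- psi)) =
  complex.Im (v * cexp (- psi)) - nrm u * sin psi.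
  by rewrite -{1}[(nrm u)%:C * _]opprK ImB -mulNr -rmorphN ImZ /= sinN; ring.
move/eqP; rewrite subr_eq0 => /eqP h.
have := nrm_Im (v * cexp (- psi)); rewrite h normrM ger0_norm ?nrm_ge0 //.
rewrite nrmM nrm_cexp mulr1; move: hu; rewrite /off_dir cexp0 mulr1 -/v mulrC; lra.
Qed.

Definition attach G w : {poly R[i]} := G * ('X - (w%:C)%:P).

Lemma attach_monic G w : G \is monic -> attach G w \is monic.
Proof. by move=> Gm; rewrite monicMl // monicXsubC. Qed.

Lemma attach_size G w n : G \is monic -> size G = n.+2 -> size (attach G w) = n.+3.
Proof.
by move=> Gm sG; rewrite size_Mmonic ?monicXsubC ?monic_neq0 // size_XsubC sG addn2.
Qed.

Lemma attach_horner G w z : (attach G w).[z] = G.[z] * (z - w%:C).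
Proof. by rewrite hornerM hornerXsubC. Qed.

Lemma attach_crit G w c : root (attach G w)^`() c -> G^`().[c] * (w%:C - c) = G.[c].
Proof.
rewrite rootE derivM derivXsubC mulr1 hornerD hornerM hornerXsubC => /eqP h.
by apply/eqP; rewrite -subr_eq0 -oppr_eq0; apply/eqP; rewrite -[RHS]h; ring.
Qed.

(** In a bounded region G'(c) = G(c) / (w - c) is small, so c is near a critical point c0 of G. Up
    to the real factor - w the critical value is G(c) (1 - c / w), close to G(c0), which is off the
    line by mu. *)
Lemma attach_nonsing_small G n (psi rho : R) : size G = n.+2 -> nonsing G psi ->
  exists W, forall w, W <= w -> forall c, nrm c <= rho ->
    G^`().[c] * (w%:C - c) = G.[c] ->
    complex.Im (cexp (- psi) * (attach G w).[c]) <> 0.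
Proof.
move=> sG ns; have [mu mu0 hmu] := crit_gap sG ns.
have [M M0 hM] := poly_bounded G rho.
have [L L0 hL] := poly_lipschitz G (rho + 1).
pose d := Num.min 1 (mu / (4 * L)).
have d0 : 0 < d by rewrite lt_min ltr01 divr_gt0 // mulr_gt0.
have [e e0 he] := deriv_root_near sG d0.
(* The term M / e yields |G'(c)| < e, the next one |G(c) c / w| <= mu / 4. *)
exists (`|rho| + M / e + 4 * M * `|rho| / mu + 1) => w wW c cr crit im0.
have rho0 : 0 <= rho by apply: le_trans cr; exact: nrm_ge0.
rewrite (ger0_norm rho0) in wW.
have Me : 0 <= M / e by rewrite divr_ge0 // ltW.
have Mm : 0 <= 4 * M * rho / mu.
  by apply: divr_ge0; [apply: mulr_ge0 => //; apply: mulr_ge0 => //; exact: ltW|exact: ltW].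
have w0 : 0 < w by lra.
have wc : w - rho <= nrm (w%:C - c).
  by have := nrm_subr w%:C c; rewrite nrm_real gtr0_norm //; lra.
have G'c : nrm G^`().[c] < e.
  have : nrm G^`().[c] * nrm (w%:C - c) <= M by rewrite -nrmM crit hM.
  have h1 : M < e * (w - rho) by rewrite -ltr_pdivrMl // mulrC; lra.
  have h2 := nrm_ge0 G^`().[c]; move=> h3; rewrite ltNge; apply/negP => h4.
  have : e * (w - rho) <= nrm G^`().[c] * nrm (w%:C - c).
    by apply: ler_pM => //; [exact: ltW|lra].
  lra.
have [c0 rc0] := he _ G'c; rewrite lt_min => /andP[cc1 cc2].
have := hmu _ rc0; rewrite leNgt => /negP; apply.
have c0r : nrm c0 <= rho + 1.
  by have := nrm_subr c0 c; rewrite nrmB; lra.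
have crr : nrm c <= rho + 1 by lra.
have h1 := hL _ _ c0r crr; rewrite (nrmB c0) in h1.
have h2 : L * nrm (c - c0) < mu / 4.
  have : L * nrm (c - c0) < L * (mu / (4 * L)) by rewrite ltr_pM2l.
  suff -> : L * (mu / (4 * L)) = mu / 4 by [].
  by field; rewrite gt_eqF.
have wn0 : w%:C != 0 :> R[i] by rewrite -nrm_gt0 nrm_real normr_gt0 gt_eqF.
have h3 : nrm (G.[c] * (c / w%:C)) <= mu / 4.
  rewrite !nrmM nrmV nrm_real gtr0_norm // mulrA ler_pdivrMr //.
  apply: (@le_trans _ _ (M * rho)); first by apply: ler_pM; rewrite ?nrm_ge0 ?hM.
  have : 4 * M * rho / mu <= w by lra.
  rewrite ler_pdivrMr //; lra.
have : complex.Im (cexp (- psi) * (G.[c] - G.[c] * (c / w%:C))) = 0.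
  apply/eqP; have : - w * complex.Im (cexp (- psi) * (G.[c] - G.[c] * (c / w%:C))) = 0.
    rewrite -ImZ -[RHS]im0 attach_horner rmorphN /=; congr complex.Im.
    by field.
  by move/eqP; rewrite mulf_eq0 oppr_eq0 (gt_eqF w0).
have -> : cexp (- psi) * (G.[c] - G.[c] * (c / w%:C)) = cexp (- psi) * G.[c0] -
   (cexp (- psi) * (G.[c0] - G.[c] + G.[c] * (c / w%:C))) by ring.
rewrite ImB => /eqP; rewrite subr_eq0 => /eqP ->.
apply: le_lt_trans (nrm_Im _) _; rewrite nrmM nrm_cexp mul1r.
by apply: le_lt_trans (nrmD _ _) _; lra.
Qed.

(** Far out c G'(c) / G(c) is nearly N = n + 1, so N (w - c) is nearly c, and c nearly w N / (N +
    1). There G(c) and w - c are both nearly positive, so the critical value is nearly negative and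
    off every line with nonzero sine. *)
Lemma attach_nonsing_large G n (psi : R) : G \is monic -> size G = n.+2 ->
  sin psi != 0 -> exists rho, forall w, 0 < w -> forall c, rho <= nrm c ->
    G^`().[c] * (w%:C - c) = G.[c] ->
    complex.Im (cexp (- psi) * (attach G w).[c]) <> 0.
Proof.
move=> Gm sG sp; pose s : R := `|sin psi|; have s0 : 0 < s by rewrite normr_gt0.
have s1 : s <= 1 by rewrite ler_norml sin_geN1 sin_le1.
have [N Ndef] : exists N : R, N = n.+1%:R by exists n.+1%:R.
have N1 : 1 <= N by rewrite Ndef ler1n.
have N0 : 0 < N by lra.
(* With k0 (N + 1) = s / 128, both the error of G(c), about 8 N k0, and that of w - c, whose size is
   only about w / (N + 1), are small against s. *)
pose k0 : R := s / (128 * (N + 1)).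
have k00 : 0 < k0 by rewrite divr_gt0 // mulr_gt0 //; lra.
have N10 : N + 1 != 0 by rewrite gt_eqF //; lra.
have k0N : k0 * (N + 1) = s / 128.
  by rewrite /k0; field.
have k0s : 2 * k0 <= s / 128 by rewrite -k0N mulrC ler_pM2l //; lra.
have x0 : 0 < s / 32 by rewrite divr_gt0.
have [rho r1 hr] := monic_growth Gm sG x0.
(* The leading terms cancel, so P has lower degree than G and k = P(c) / G(c) = N - c G'(c) / G(c)
   is small far out. *)
pose P := N%:C *: G - 'X * G^`().
have sP : (size P <= n.+1)%N.
  apply/leq_sizeP => j nj; rewrite coefB coefZ coefXM coef_deriv.
  case: j nj => // j; rewrite ltnS leq_eqVlt => /predU1P[<-|nj] /=.
    by rewrite -mulr_natl Ndef rmorph_nat subrr.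
  by rewrite [G`_j.+1]nth_default ?sG // mulr0 mul0rn subrr.
have [K K0 hK] := poly_growth_le sP.
exists (Num.max rho (2 * K / k0)) => w w0 c; rewrite ge_max => /andP[cr cK] crit.
have c1 : 1 <= nrm c by apply: le_trans cr.
have c0 : 0 < nrm c by lra.
have cN0 : 0 < nrm c ^+ n.+1 by rewrite exprn_gt0.
have Gc := hr c cr.
have Gc2 : nrm c ^+ n.+1 / 2 <= nrm G.[c].
  have := nrm_subr (c ^+ n.+1) G.[c]; rewrite nrmX (nrmB (c ^+ n.+1)) => h.
  have : s / 32 * nrm c ^+ n.+1 <= 1 / 32 * nrm c ^+ n.+1 by rewrite ler_pM2r //; lra.
  lra.
have Gc0 : 0 < nrm G.[c] by apply: lt_le_trans Gc2; rewrite divr_gt0.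
have G0 : G.[c] != 0 by rewrite -nrm_gt0.
have Pc : nrm P.[c] <= k0 * nrm G.[c].
  have h1 := hK c _ c1 (lexx _).
  have h2 : 2 * K * nrm c ^+ n <= k0 * nrm c ^+ n.+1.
    rewrite exprS mulrA ler_wpM2r ?exprn_ge0 ?nrm_ge0 //.
    by rewrite [leRHS]mulrC -ler_pdivrMr.
  have : k0 * (nrm c ^+ n.+1 / 2) <= k0 * nrm G.[c] by rewrite ler_pM2l.
  lra.
pose k := P.[c] / G.[c].
have kk : nrm k <= k0 by rewrite nrmM nrmV ler_pdivrMr.
have PE : P.[c] = N%:C * G.[c] - c * G^`().[c].
  by rewrite hornerD hornerN hornerZ hornerM hornerX.
have k01 : k0 <= 1 / 128 by lra.
have NE : (N%:C - k) * (w%:C - c) = c.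
  rewrite /k PE -[RHS]mulr1 -(divff G0) -{3}crit; field.
  exact: G0.
clearbody k; clear PE Pc hK hr cK cr sP sG Gm sp r1 K0 P K rho; clearbody k0.
have nN1 : nrm (N%:C + 1) = N + 1.
  have -> : N%:C + 1 = (N + 1)%:C :> R[i] by rewrite rmorphD.
  by rewrite nrm_real ger0_norm //; lra.
have den0 : 1 <= nrm (N%:C + 1 - k).
  have := nrm_subr (N%:C + 1) k; rewrite -[1]/(1%:C) -rmorphD nrm_real ger0_norm; lra.
have den : N%:C + 1 - k != 0 by rewrite -nrm_gt0; lra.
have N1C : N%:C + 1 != 0 :> R[i].
  by rewrite -nrm_gt0 -[1]/(1%:C) -rmorphD nrm_real normr_gt0.
pose a := w * (N / (N + 1)).
have aC : a%:C = w%:C * (N%:C / (N%:C + 1)).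
  by rewrite /a !rmorphM fmorphV rmorphD.
have diffE : c - a%:C = - (w%:C * k / ((N%:C + 1) * (N%:C + 1 - k))).
  have cE : c = w%:C * ((N%:C - k) / (N%:C + 1 - k)).
    have e1 : (N%:C + 1 - k) * c = w%:C * (N%:C - k).
      apply/eqP; rewrite -subr_eq0.
      have -> : (N%:C + 1 - k) * c - w%:C * (N%:C - k) = c - (N%:C - k) * (w%:C - c) by ring.
      by rewrite NE subrr.
    by rewrite mulrA -e1 mulrAC divff // mul1r.
  by rewrite {1}cE aC; field; rewrite den N1C.
have diff : nrm (c - a%:C) <= w * k0.
  rewrite diffE nrmN !nrmM nrmV nrm_real gtr0_norm //.
  rewrite ler_pdivrMr; last by rewrite nrmM mulr_gt0 ?nrm_gt0.
  rewrite -mulrA ler_pM2l //.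
  apply: (@le_trans _ _ (k0 * 1)); first by rewrite mulr1.
  rewrite ler_pM2l // nrmM nN1; move: den0; move: (nrm _) => x x1.
  have : 1 * 1 <= (N + 1) * x by apply: ler_pM => //; lra.
  by rewrite mulr1.
clear diffE aC den N1C NE G0 crit.
have aw : w / 2 <= a.
  rewrite /a mulrA ler_pdivlMr; last by lra.
  have : w * 1 <= w * N by rewrite ler_pM2l.
  lra.
have a0 : 0 <= a by lra.
have wk : w * k0 <= w / 128.
  have : w * k0 <= w * (1 / 128) by rewrite ler_pM2l.
  lra.
have cw : w / 4 <= nrm c.
  by have := nrm_subr a%:C c; rewrite nrm_real ger0_norm // nrmB; lra.
have offc : off_dir c 0 <= 8 * k0 * nrm c.
  have := off_dir0_near a0 diff.
  have : 8 * k0 * (w / 4) <= 8 * k0 * nrm c by rewrite ler_pM2l // mulr_gt0.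
  lra.
pose b := w / (N + 1); have b0 : 0 <= b by rewrite divr_ge0 //; lra.
have wcb : nrm (w%:C - c - b%:C) <= w * k0.
  have -> : w%:C - c - b%:C = - (c - a%:C).
    have -> : w%:C = a%:C + b%:C by rewrite -rmorphD; congr real_complex_def; rewrite /a /b; field.
    by ring.
  by rewrite nrmN.
have wk2 : w * k0 <= b * s / 128.
  have -> : b * s / 128 = b * (N + 1) * k0 by rewrite -!mulrA (mulrC (N + 1)) k0N.
  by rewrite divfK.
have b00 : 0 < b by rewrite divr_gt0 //; lra.
have bs0 : 0 < b * s by rewrite mulr_gt0.
have bs : b * s <= b by rewrite ler_piMr.
have wcn : b / 2 <= nrm (w%:C - c).
  by have := nrm_subr b%:C (w%:C - c); rewrite nrm_real ger0_norm // (nrmB b%:C (w%:C - c)); lra.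
have offwc : off_dir (w%:C - c) 0 <= s / 4 * nrm (w%:C - c).
  have := off_dir0_near b0 wcb.
  have : s / 4 * (b / 2) <= s / 4 * nrm (w%:C - c) by rewrite ler_pM2l // divr_gt0.
  lra.
have offG : off_dir G.[c] 0 <= s / 4 * nrm G.[c].
  have h1 := off_dir_lip G.[c] (c ^+ n.+1) 0.
  have h2 := off_dir0_exp n.+1 offc; rewrite -Ndef in h2.
  have h3 : N * (8 * k0) * nrm c ^+ n.+1 <= s / 16 * nrm c ^+ n.+1.
    rewrite ler_pM2r //; have : N * k0 <= (N + 1) * k0 by rewrite ler_pM2r //; lra.
    lra.
  have h4 : s / 4 * (nrm c ^+ n.+1 / 2) <= s / 4 * nrm G.[c].
    by rewrite ler_pM2l // divr_gt0.
  lra.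
rewrite attach_horner; have -> : cexp (- psi) * (G.[c] * (c - w%:C)) =
    - (cexp (- psi) * (G.[c] * (w%:C - c))) by ring.
rewrite -sub0r ImB sub0r => /eqP; rewrite oppr_eq0 => /eqP.
have wc0 : 0 < nrm (w%:C - c) by lra.
apply: off_dir0_Im; first by rewrite nrmM mulr_gt0.
apply: le_lt_trans (off_dir0_mul _ _) _; rewrite -/s nrmM.
have h1 : off_dir G.[c] 0 * nrm (w%:C - c) <= s / 4 * nrm G.[c] * nrm (w%:C - c).
  by rewrite ler_pM2r.
have h2 : nrm G.[c] * off_dir (w%:C - c) 0 <= nrm G.[c] * (s / 4 * nrm (w%:C - c)).
  by rewrite ler_pM2l.
have h3 : 0 < s * (nrm G.[c] * nrm (w%:C - c)) by rewrite !mulr_gt0.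
move: h1 h2 h3; move: (nrm G.[c]) (nrm (w%:C - c)) => x y; lra.
Qed.

Lemma attach_nonsing G n (psi : R) : G \is monic -> size G = n.+2 ->
  nonsing G psi -> sin psi != 0 ->
  exists W, forall w, W <= w -> nonsing (attach G w) psi.
Proof.
move=> Gm sG ns sp; have [rho hl] := attach_nonsing_large Gm sG sp.
have [W hs] := attach_nonsing_small rho sG ns.
exists (Num.max W 1) => w; rewrite ge_max => /andP[wW w1] c /attach_crit crit.
have [cr|/ltW cr] := leP (nrm c) rho; first exact: (hs w).
by apply: hl => //; lra.
Qed.

End AttachNonsingular.

(** * Arguments along a lift of the product *)

Section AttachReach.
Import Order.TTheory GRing.Theory Num.Theory.
Local Open Scope ring_scope.
Local Open Scope complex_scope.
Context {R : realType}.
Implicit Types (z u v : R[i]) (f p q G : {poly R[i]}) (g h : R -> R[i]) (w : R).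

Lemma cexp_Re (x : R) : complex.Re (cexp x) = cos x. Proof. by []. Qed.
Lemma cexp_Im (x : R) : complex.Im (cexp x) = sin x. Proof. by []. Qed.

(* On the real axis G(z) (1 - z / w) is nearly real far out, while cexp psi is not. *)
Lemma value_not_real G n (psi c t : R) w z : 0 < w -> 0 < t -> c < `|sin psi| ->
  nrm (G.[z] - z ^+ n) <= c * nrm z ^+ n -> 0 < nrm z ->
  G.[z] * (1 - z / w%:C) = t%:C * cexp psi -> complex.Im z <> 0.
Proof.
move=> w0 t0 cs gz z0 Fz iz.
have zE : z = (complex.Re z)%:C by apply: complex_ext.
set x := complex.Re z in zE; pose e := G.[z] - z ^+ n.
have GE : G.[z] = (x ^+ n)%:C + e by rewrite rmorphXn /= -zE /e addrC subrK.
pose r : R := 1 - x / w.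
have rE : 1 - z / w%:C = r%:C by rewrite zE rmorphB rmorphM fmorphV.
rewrite rE in Fz.
have r0 : r != 0.
  apply: contraTneq t0 => r0; move: Fz; rewrite r0 mulr0 => /eqP.
  rewrite eq_sym mulf_eq0 (negPf (cexp_neq0 psi)) orbF -nrm_eq0 nrm_real normr_eq0.
  by move/eqP ->; rewrite ltxx.
have : complex.Im (cexp (- psi) * (G.[z] * r%:C)) = 0.
  by rewrite Fz mulrCA cexpNM mulr1.
have -> : cexp (- psi) * (G.[z] * r%:C) = r%:C * (cexp (- psi) * G.[z]) by ring.
rewrite ImZ => /eqP; rewrite mulf_eq0 (negPf r0) /= GE => /eqP.
have -> : cexp (- psi) * ((x ^+ n)%:C + e) = cexp (- psi) * e - (- (x ^+ n))%:C * cexp (- psi).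
  by rewrite rmorphN; ring.
rewrite ImB ImZ cexp_Im sinN mulrNN => /eqP; rewrite subr_eq0 => /eqP h.
have := nrm_Im (cexp (- psi) * e); rewrite h nrmM nrm_cexp mul1r normrM normrX.
have nx : `|x| = nrm z by rewrite zE nrm_real.
rewrite nx => h2; have zn : 0 < nrm z ^+ n by rewrite exprn_gt0.
have := le_trans h2 gz; rewrite mulrC ler_pM2r // leNgt => /negP; apply.
exact: cs.
Qed.

(** Up to an error of at most half its modulus, G(z) is z^n. Hence the cosine of the phase is above
    - 1 / 2 and its sine at most 1 / 2 in modulus, which together force a positive cosine. *)
Lemma value_phase G n (psi c t a b m : R) w z : 0 < t -> c <= 1 / 2 -> 0 < m ->
  nrm (G.[z] - z ^+ n) <= c * nrm z ^+ n -> 0 < nrm z ->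
  z = (nrm z)%:C * cexp a -> 1 - z / w%:C = m%:C * cexp (- b) ->
  G.[z] * (1 - z / w%:C) = t%:C * cexp psi -> 0 < cos (a * n%:R - b - psi).
Proof.
move=> t0 c2 m0 gz z0 za zb Fz; pose e := G.[z] - z ^+ n.
have GE : G.[z] = z ^+ n + e by rewrite /e addrC subrK.
have zn : 0 < nrm z ^+ n by rewrite exprn_gt0.
pose A := a * n%:R - b - psi; pose d := cexp (- b - psi) * e.
have nd : nrm d <= 1 / 2 * nrm z ^+ n.
  rewrite nrmM nrm_cexp mul1r; apply: le_trans gz _; by rewrite ler_pM2r.
have key : m%:C * ((nrm z ^+ n)%:C * cexp A + d) = t%:C.
  have -> : t%:C = cexp (- psi) * (G.[z] * (1 - z / w%:C)).
    by rewrite Fz mulrCA cexpNM mulr1.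
  rewrite zb GE {2}za exprMn cexpX rmorphXn /= /d /A !cexpD; ring.
have rk := congr1 (@complex.Re R) key; have ik := congr1 (@complex.Im R) key.
rewrite ReZ in rk; rewrite ImZ in ik.
have -> : cos A = complex.Re (cexp A) by [].
have rD : complex.Re ((nrm z ^+ n)%:C * cexp A + d) =
    nrm z ^+ n * cos A + complex.Re d.
  by rewrite -[d]opprK ReB ReZ -[in RHS]sub0r ReB /= sub0r.
have iD : complex.Im ((nrm z ^+ n)%:C * cexp A + d) =
    nrm z ^+ n * sin A + complex.Im d.
  by rewrite -[d]opprK ImB ImZ -[in RHS]sub0r ImB /= sub0r.
rewrite cexp_Re; rewrite rD /= in rk; rewrite iD /= in ik.
have {}ik : nrm z ^+ n * sin A + complex.Im d = 0.
  by move/eqP: ik; rewrite mulf_eq0 gt_eqF //= => /eqP.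
have {}rk : 0 < nrm z ^+ n * cos A + complex.Re d by rewrite -(pmulr_rgt0 _ m0) rk.
have dR := nrm_Re d; have dI := nrm_Im d.
have := cos2Dsin2 A; move: (cos A) (sin A) rk ik => C S rk ik cs.
move: dR dI; rewrite !ler_norml => /andP[r1 r2] /andP[i1 i2].
have S1 : nrm z ^+ n * S <= nrm z ^+ n * (1 / 2) by lra.
have S2 : nrm z ^+ n * (- (1 / 2)) <= nrm z ^+ n * S by lra.
have C1 : nrm z ^+ n * (- (1 / 2)) < nrm z ^+ n * C by lra.
rewrite ler_pM2l // in S1; rewrite ler_pM2l // in S2; rewrite ltr_pM2l // in C1.
by clear -cs S1 S2 C1; nra.
Qed.

Lemma conj_sub (w : R) z : (1 - z / w%:C)^*%C = 1 - z^*%C / w%:C.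
Proof. by rewrite rmorphB rmorph1 rmorphM fmorphV /= -complexr0 /= oppr0. Qed.

(* a + b is an argument of z * conj (1 - z / w) = z - |z|^2 / w. *)
Lemma args_sum (w a b m : R) z : 0 < w -> 0 < complex.Im z -> 0 < m ->
  0 < a < pi -> 0 < b < pi -> z = (nrm z)%:C * cexp a -> w < nrm z ->
  1 - z / w%:C = m%:C * cexp (- b) -> pi / 2 < a + b < pi.
Proof.
move=> w0 iz m0 /andP[a0 ap] /andP[b0 bp] za wz zb.
have z0 : 0 < nrm z by lra.
have E : ((nrm z * m)%:C * cexp (a + b)) = z - (nrm z ^+ 2 / w)%:C.
  have -> : (nrm z * m)%:C * cexp (a + b) = (nrm z)%:C * cexp a * (m%:C * cexp (- b))^*%C.
    have -> : (m%:C * cexp (- b))^*%C = m%:C * cexp b.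
      by rewrite /Defs.cexp cosN sinN; apply: complex_ext => /=; ring.
    by rewrite rmorphM cexpD; ring.
  rewrite -za -zb conj_sub mulrBr mulr1 mulrA; congr (_ - _).
  have -> : z * z^*%C = (nrm z ^+ 2)%:C.
    rewrite nrm_sqr; case: (z) => x y; apply: complex_ext; rewrite ?ReM ?ImM /=; ring.
  by rewrite [RHS]rmorphM fmorphV.
have q0 : 0 < nrm z * m by rewrite mulr_gt0.
have iE := congr1 (@complex.Im R) E; have rE := congr1 (@complex.Re R) E.
rewrite ImZ ImB cexp_Im /= subr0 in iE; rewrite ReZ ReB cexp_Re /= in rE.
have sp : 0 < sin (a + b) by rewrite -(pmulr_rgt0 _ q0) iE.
have abp : a + b < pi.
  apply: sin_gt0_lt_pi sp; move: a0 ap b0 bp; move: pi => c *; apply/andP; split; lra.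
apply/andP; split=> //; apply: cos_lt0_gt.
  by rewrite abp andbT addr_gt0.
(* Since |z| > w, the subtracted |z|^2 / w exceeds |z| and the real part is negative. *)
rewrite -(pmulr_rlt0 _ q0) rE subr_lt0; apply: le_lt_trans (ler_norm _) _.
apply: le_lt_trans (nrm_Re z) _; rewrite ltr_pdivlMr // expr2 ltr_pM2l //.
Qed.

(** The angle (2 pi l - x) / (n + 2) stays between pi / (n + 2) and 2 pi - pi / (n + 2), where the
    cosine is at most cos (pi / (n + 2)). *)
Lemma cexp_gap n (x : R) l : (0 < l < n.+2)%N -> - pi < x < pi ->
  1 - cos (pi / n.+2%:R) <= nrm (cexp ((x - 2 * pi * l%:R) / n.+2%:R) - 1).
Proof.
move=> /andP[l0 ln] /andP[x1 x2]; set N : R := n.+2%:R.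
have N2 : 2 <= N by rewrite ler_nat.
have N0 : 0 < N by lra.
have p0 := pi_gt0 R; set c : R := pi in x1 x2 p0 *.
have l1 : 1 <= l%:R :> R by rewrite ler1n.
have l2 : l%:R + 1 <= N by rewrite natr1 ler_nat.
pose y := (2 * c * l%:R - x) / N.
have y1 : c / N <= y by rewrite ler_pM2r ?invr_gt0 //; nra.
have y2 : y <= 2 * c - c / N.
  have -> : 2 * c - c / N = (2 * c * N - c) / N by field; rewrite gt_eqF.
  rewrite ler_pM2r ?invr_gt0 //; nra.
have cN0 : 0 <= c / N by rewrite divr_ge0 // ltW.
have cN1 : c / N <= c by rewrite ler_pdivrMr // ler_peMr //; [exact: ltW|lra].
suff cy : cos y <= cos (c / N).
  have -> : (x - 2 * c * l%:R) / N = - y by rewrite /y -[RHS]mulNr opprB.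
  apply: le_trans (nrm_Re _); rewrite ReB cexp_Re cosN /=.
  by rewrite distrC; apply: le_trans (ler_norm _); rewrite lerD2l lerN2.
have mono (u v : R) : 0 <= u -> u <= v -> v <= c -> cos v <= cos u.
  move=> u0 uv vc; rewrite leNgt; apply/negP => h.
  have := @ltr_cos R v u; rewrite !in_itv /= u0 vc (le_trans uv) ?(le_trans u0) //.
  by move=> /(_ isT isT); rewrite h => /esym; lra.
have [yc|cy] := leP y c; first exact: mono.
have -> : cos y = cos (2 * c - y).
  by rewrite -[in RHS]cosN opprB; rewrite -[RHS]cosD2pi; congr cos; rewrite -mulr_natl -/c; ring.
by apply: mono => //; clearbody y; move: y2 cy; move: (c / N) => k; lra.
Qed.

End AttachReach.

Section AttachUpper.
Import Order.TTheory GRing.Theory Num.Theory.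
Local Open Scope ring_scope.
Local Open Scope complex_scope.
Context {R : realType}.
Implicit Types (z u v : R[i]) (f p q G : {poly R[i]}) (g h : R -> R[i]) (w : R).

Lemma contR_affine (x y : R -> R) (c d : R) : contR x -> contR y ->
  contR (fun t => x t * c - y t - d).
Proof.
move=> cx cy t e e0; have k0 : 0 < 2 * (`|c| + 1) by have := normr_ge0 c; lra.
have [d1 d10 h1] := cx t _ (divr_gt0 e0 k0).
have e2 : 0 < e / 2 by rewrite divr_gt0.
have [d2 d20 h2] := cy t _ e2.
exists (Num.min d1 d2); first by rewrite lt_min d10.
move=> s; rewrite lt_min => /andP[/h1 s1 /h2 s2].
have -> : x s * c - y s - d - (x t * c - y t - d) = (x s - x t) * c - (y s - y t) by ring.
apply: le_lt_trans (ler_normB _ _) _; rewrite [ltRHS]splitr ler_ltD //.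
rewrite ltr_pdivlMr // in s1; rewrite normrM.
have := normr_ge0 (x s - x t); have := normr_ge0 c.
move: s1; move: (`|x s - x t|) (`|c|) => a b; nra.
Qed.

Lemma contR_scale (c : R) : contR (fun t => c * t).
Proof.
move=> t e e0; have k0 : 0 < `|c| + 1 by rewrite ltr_wpDl.
exists (e / (`|c| + 1)); first by rewrite divr_gt0.
move=> s; rewrite ltr_pdivlMr // -mulrBr normrM => h.
by apply: le_lt_trans h; rewrite mulrC ler_wpM2l // lerDl.
Qed.

Lemma contp_conj g : contp g -> contp (fun t => (g t)^*%C).
Proof.
by move=> cg t e /(cg t)[d d0 hd]; exists d => // s /hd; rewrite -rmorphB nrm_conj.
Qed.

Lemma off_dir_polar z (a phi : R) : z = (nrm z)%:C * cexp a ->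
  off_dir z phi = nrm z * nrm (cexp (a - phi) - 1).
Proof.
move=> za; rewrite /off_dir {1}za -mulrBr nrmM nrm_real ger0_norm ?nrm_ge0 //.
have -> : cexp a - cexp phi = (cexp (a - phi) - 1) * cexp phi.
  by rewrite mulrBl mul1r -cexpD subrK.
by rewrite nrmM nrm_cexp mulr1.
Qed.

Lemma Im_conj_sub (w : R) z : complex.Im (1 - z / w%:C)^*%C = complex.Im z / w.
Proof.
rewrite conj_sub ImB /= sub0r.
have -> : (w%:C)^-1 = (w^-1)%:C by rewrite fmorphV.
by case: z => x y /=; rewrite mulr0 add0r mulNr opprK.
Qed.

(* From time T on, h is far away in the upper half plane, where the argument
   of G(z) (1 - z / w) is A = a (n + 1) - b up to an error below pi / 2. *)
Lemma phase_locked G n (psi c T : R) w h : 0 < w -> 0 < T ->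
  c <= 1 / 2 -> c < `|sin psi| -> contp h ->
  (forall t, T <= t -> G.[h t] * (1 - h t / w%:C) = t%:C * cexp psi) ->
  (forall t, T <= t -> 0 < nrm (h t) /\
      nrm (G.[h t] - h t ^+ n.+1) <= c * nrm (h t) ^+ n.+1) ->
  0 < complex.Im (h T) -> nrm (h T) < w ->
  `|carg (h T) * n.+1%:R - psi| < pi / 2 ->
  forall t, T <= t -> exists a b m : R, [/\ [/\ 0 < m, 0 < a < pi & 0 < b < pi],
     h t = (nrm (h t))%:C * cexp a, 1 - h t / w%:C = m%:C * cexp (- b),
     0 < complex.Im (h t) & - (pi / 2) < a * n.+1%:R - b - psi < pi / 2].
Proof.
move=> w0 T0 c2 cs ch Fh far iT hTw aT.
have im t : T <= t -> 0 < complex.Im (h t).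
  move=> Tt; have x := contR_Im (contpN ch).
  have im0 u : complex.Im (- u) = - complex.Im u :> R by rewrite -sub0r ImB sub0r.
  rewrite -oppr_lt0 -im0; apply: (avoid_lt x Tt); last by rewrite /= im0 oppr_lt0.
  move=> s /andP[Ts _] /eqP; rewrite im0 oppr_eq0 => /eqP.
  by have [s0 hs] := far s Ts; apply: (value_not_real w0 _ cs hs s0 (Fh s Ts)); lra.
(* Frozen before T, so that the path is in the upper half plane, and [carg] continuous along it, at
   all times. *)
pose k t := h (Num.max t T).
have Tm t : T <= Num.max t T by rewrite le_max lexx orbT.
have ck : contp k.
  by apply: (contp_comp ch); apply: contR_lip1 => *; exact: lip1_max.
have ik t : 0 < complex.Im (k t) by apply: im.
have ck' : contp (fun t => (1 - k t / w%:C)^*%C).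
  apply: contp_conj; apply: contpB; first exact: contp_cst.
  by apply: contp_ext (contpZ (w%:C)^-1 ck) => t; rewrite mulrC.
have ik' t : 0 < complex.Im (1 - k t / w%:C)^*%C by rewrite Im_conj_sub divr_gt0.
pose a t := carg (k t); pose b t := carg (1 - k t / w%:C)^*%C.
have ca : contR a by exact: contR_carg.
have cb : contR b by exact: contR_carg ck' ik'.
have ap t := carg_polar (ik t); have bp t := carg_polar (ik' t).
have bE t : 1 - k t / w%:C = (nrm (1 - k t / w%:C)^*%C)%:C * cexp (- b t).
  have [_ e] := bp t; rewrite -[LHS]conjcK {1}e -/(b t).
  rewrite /Defs.cexp cosN sinN; apply: complex_ext => /=; ring.
have m0 t : 0 < nrm (1 - k t / w%:C)^*%C.
  by rewrite nrm_gt0; apply: contraTneq (ik' t) => ->; rewrite ltxx.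
pose A t := a t * n.+1%:R - b t - psi.
have cA : contR A by exact: contR_affine.
have cosA t : 0 < cos (A t).
  have [_ ae] := ap t; have [s0 hs] := far _ (Tm t).
  apply: (value_phase (w := w) _ c2 (m0 t) hs s0 ae (bE t) (Fh _ (Tm t))).
  by apply: lt_le_trans (Tm t).
have kT : k T = h T by rewrite /k maxxx.
(* |h T| < w puts 1 - h T / w in the right half plane. With b T below pi / 2 the initial phase lies
   within (- pi, pi), where a positive cosine means within pi / 2. *)
have bT : b T < pi / 2.
  have [/andP[b0 b1] be] := bp T.
  have : 0 < cos (b T).
    have := congr1 (@complex.Re R) (bE T); rewrite ReZ cexp_Re cosN kT ReB /= => e.
    rewrite -(pmulr_rgt0 _ (m0 T)) kT -e subr_gt0.
    apply: le_lt_trans (ler_norm _) _; apply: le_lt_trans (nrm_Re _) _.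
    by rewrite nrmM nrmV nrm_real gtr0_norm // ltr_pdivrMr // mul1r.
  move=> cb0; have := @cos_gt0_lt R (b T); rewrite cb0 b1 andbT => /(_ _ isT).
  case/(_ _)/andP => //; apply: lt_trans b0; by rewrite oppr_lt0 pi_gt0.
have AT : - (pi / 2) < A T < pi / 2.
  apply: cos_gt0_lt (cosA T); have [/andP[b0 _] _] := bp T.
  move: aT; rewrite ltr_norml -kT -/(a T) /A => /andP[a1 a2].
  have p0 := pi_gt0 R; rewrite -/(b T) in b0.
  clear -p0 b0 bT a1 a2; move: (a T * _) (b T) bT b0 a1 a2 => x y.
  by move: pi p0 => q p0 h1 h2 h3 h4; apply/andP; split; lra.
have cpi : cos (pi / 2) = 0 :> R by exact: cos_pihalf.
have up t : T <= t -> A t < pi / 2.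
  move=> Tt; apply: (avoid_lt cA Tt); last by case/andP: AT.
  by move=> s _ e; have := cosA s; rewrite e cpi ltxx.
have cA' : contR (fun t => - A t).
  by move=> t e /(cA t)[d d0 hd]; exists d => // s /hd; rewrite -opprD normrN.
have low t : T <= t -> - A t < pi / 2.
  move=> Tt; apply: (avoid_lt cA' Tt); last by case/andP: AT; rewrite ltrNl.
  by move=> s _ e; have := cosA s; rewrite -cosN e cpi ltxx.
move=> t Tt; exists (a t), (b t), (nrm (1 - k t / w%:C)^*%C).
have kE : k t = h t by rewrite /k (elimT max_idPl).
have [a1 a2] := ap t; have [b1 _] := bp t.
split=> //; rewrite -?kE // -/(A t).
by rewrite up // andbT ltrNl low.
Qed.

End AttachUpper.

(** * Following a lift of the product to its end *)

Section AttachEnds.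
Import Order.TTheory GRing.Theory Num.Theory.
Local Open Scope ring_scope.
Local Open Scope complex_scope.
Context {R : realType}.
Implicit Types (z u v : R[i]) (f p q G : {poly R[i]}) (g h : R -> R[i]) (w : R).

(** Beyond the circle of radius w, [args_sum] puts a + b between pi / 2 and pi. Added to the phase,
    this shows a (n + 2) to be within pi of psi + pi, and only l = 0 is compatible with that. *)
Lemma end_stage n (psi a b m w e : R) z l : 0 < w -> w < nrm z -> 0 < complex.Im z ->
  0 < m -> 0 < a < pi -> 0 < b < pi -> z = (nrm z)%:C * cexp a ->
  1 - z / w%:C = m%:C * cexp (- b) -> - (pi / 2) < a * n.+1%:R - b - psi < pi / 2 ->
  (l < n.+2)%N -> e <= 1 - cos (pi / n.+2%:R) ->
  off_dir z ((psi + pi + 2 * pi * l%:R) / n.+2%:R) < e * nrm z -> l = 0%N.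
Proof.
move=> w0 wz iz m0 ha hb za zb hA ln he off; have z0 : 0 < nrm z by lra.
have hab := args_sum w0 iz m0 ha hb za wz zb.
apply/eqP; rewrite -leqn0 leqNgt; apply/negP => l0.
pose y := a * n.+2%:R - (psi + pi).
have hy : - pi < y < pi.
  have -> : y = (a * n.+1%:R - b - psi) + (a + b) - pi.
    by rewrite /y -[n.+2%:R]natr1; ring.
  move: hab hA (pi_gt0 R); move: (_ - _ - psi) (a + b) => x s.
  by move: pi => p /andP[h1 h2] /andP[h3 h4] h5; apply/andP; split; lra.
have lN : (0 < l < n.+2)%N by rewrite l0.
have := cexp_gap lN hy; rewrite leNgt => /negP; apply.
have -> : (y - 2 * pi * l%:R) / n.+2%:R = a - (psi + pi + 2 * pi * l%:R) / n.+2%:R.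
  have N0 : n.+2%:R != 0 :> R by rewrite pnatr_eq0.
  by rewrite /y; move: (n.+2%:R) N0 => N N0; field.
rewrite (off_dir_polar _ za) mulrC ltr_pM2r // in off.
exact: lt_le_trans off he.
Qed.

(** G (X - w) is - w G (1 - X / w): the factor w rescales time and the sign adds pi to the angle. *)
Lemma attach_value G w z (t psi : R) : 0 < w ->
  (attach G w).[z] = (w * t)%:C * cexp (psi + pi) ->
  G.[z] * (1 - z / w%:C) = t%:C * cexp psi.
Proof.
move=> w0; rewrite attach_horner cexpDpi => h.
have wn0 : w%:C != 0 :> R[i] by rewrite -nrm_gt0 nrm_real normr_gt0 gt_eqF.
apply: (mulfI wn0).
have -> : w%:C * (G.[z] * (1 - z / w%:C)) = - (G.[z] * (z - w%:C)) by field.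
by rewrite h rmorphM; ring.
Qed.

(** Up to time T the factor 1 - z / w is nearly 1 and the lift follows that of G in a tube. From T
    on it is far out in the upper half plane, where [phase_locked] and [end_stage] determine its
    end. *)
Lemma attach_upper G n psi z : G \is monic -> size G = n.+2 -> nonsing G psi ->
  0 < psi / n.+1%:R < pi -> sin psi != 0 -> reach G n.+1 z psi ->
  exists W, forall w, W <= w -> reach (attach G w) n.+2 z (psi + pi).
Proof.
move=> Gm sG ns hphi sp rz; have Gz := reach_root rz.
have [g [rg gz dg]] := rz.
have [W0 hns] := attach_nonsing Gm sG ns sp.
have s0 : 0 < `|sin psi| by rewrite normr_gt0.
pose c := Num.min (1 / 2) (`|sin psi| / 2).
have c0 : 0 < c by rewrite lt_min divr_gt0 ?divr_gt0.
have c2 : c <= 1 / 2 by rewrite ge_min lexx.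
have cs : c < `|sin psi|.
  have : c <= `|sin psi| / 2 by rewrite ge_min lexx orbT.
  lra.
clearbody c.
have [rho r1 hr] := monic_growth Gm sG c0.
have [M M0 hM] := poly_bounded G rho.
have pi2 : 0 < pi / 2 / n.+1%:R :> R by rewrite !divr_gt0 ?pi_gt0 ?ltr0n.
have [e1 e10 he1] := carg_near hphi pi2.
pose e := Num.min e1 1.
have e0 : 0 < e by rewrite lt_min e10 ltr01.
have ee1 : e <= e1 by rewrite ge_min lexx.
have e11 : e <= 1 by rewrite ge_min lexx orbT.
clearbody e.
have e2 : 0 < e / 2 by rewrite divr_gt0.
have [T1 hT1] := dg _ e2; have [T2 hT2] := ray_large 1 Gm sG rg.
(* On the disc of radius rho, |G (1 - z / w)| is at most 2 M, so h has left this disc from time T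
   on. *)
pose T := Num.max (Num.max T1 T2) (2 * M + 1).
have [t1T t2T TM] : [/\ T1 <= T, T2 <= T & 2 * M + 1 <= T].
  by split; rewrite !le_max lexx ?orbT.
clearbody T; have T0 : 0 < T by lra.
have [B [r0 [r00 tub]]] := tube T Gm sG ns.
pose d := Num.min r0 (e / 16).
have d0 : 0 < d by rewrite lt_min r00 divr_gt0.
have dr0 : d <= r0 by rewrite ge_min lexx.
have de : d <= e / 16 by rewrite ge_min lexx orbT.
clearbody d.
have [eta eta0 hT] := tub d d0 dr0.
have [M' M'0 hM'] := poly_bounded G B.
(* In turn: nonsingularity of the product; |z| / w <= 1 on the disc of radius rho; h T inside the
   circle of radius w; the error |G(h) h / w| below the tolerance eta of the tube. *)
exists (Num.max (Num.max W0 rho) (Num.max (nrm (g T) + 2) (M' * `|B| / eta + 1))) => w.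
rewrite !ge_max => /andP[/andP[wW0 wr] /andP[wgT wB]].
have w0 : 0 < w by lra.
set H := attach G w; have Hm : H \is monic by exact: attach_monic.
have sH : size H = n.+3 by exact: attach_size.
have nsH : nonsing H (psi + pi).
  by apply: nonsing_cexp (hns w wW0); right; rewrite cexpDpi opprK.
have Hz : H.[z] = 0 by rewrite attach_horner Gz mul0r.
have [h' [rh' h'0]] := ray_exists Hm sH nsH Hz.
pose h t := h' (w * t).
have ch : contp h by apply: (contp_comp (proj1 rh')); exact: contR_scale.
have Fh t : 0 <= t -> G.[h t] * (1 - h t / w%:C) = t%:C * cexp psi.
  move=> t0; apply: attach_value => //.
  by rewrite -(proj2 rh') ?mulr_ge0 // ltW.
have hg : nrm (h T - g T) < d.
  apply: (hT g h (is_ray_on _ rg) ch); last by rewrite lexx ltW.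
    move=> t /andP[t0 _] hB; rewrite -Fh //.
    have -> : G.[h t] - G.[h t] * (1 - h t / w%:C) = G.[h t] * (h t / w%:C) by ring.
    rewrite !nrmM nrmV nrm_real gtr0_norm // mulrA ltr_pdivrMr //.
    have : nrm G.[h t] * nrm (h t) <= M' * `|B|.
      by apply: ler_pM; rewrite ?nrm_ge0 ?hM' //; apply: le_trans hB (ler_norm _).
    have : M' * `|B| / eta < w by lra.
    by rewrite ltr_pdivrMr // => h1 h2; apply: le_lt_trans h2 _; rewrite (mulrC eta).
  by rewrite /h mulr0 h'0 gz subrr nrm0.
clear gz Hz Gz.
have hTg : nrm (h T) <= nrm (g T) + d by have := nrm_subr (h T) (g T); lra.
have gTh : nrm (g T) <= nrm (h T) + d.
  by have := nrm_subr (g T) (h T); rewrite (nrmB (g T)); lra.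
have offT : off_dir (h T) (psi / n.+1%:R) < e1 * nrm (h T).
  have h1 := hT1 _ t1T; have h2 := hT2 _ t2T.
  have h3 := off_dir_lip (h T) (g T) (psi / n.+1%:R).
  have h4 : e * nrm (g T) <= e * (nrm (h T) + d) by rewrite ler_pM2l.
  have h5 : e * d <= 1 * d by rewrite ler_pM2r.
  have h6 : e * (1 / 2) <= e * nrm (h T) by rewrite ler_pM2l //; clear -h2 gTh de e11; lra.
  have h7 : e * nrm (h T) <= e1 * nrm (h T) by rewrite ler_wpM2r ?nrm_ge0.
  by clear -h1 h3 h4 h5 h6 h7 hg de e0; lra.
have [iT aT] := he1 _ offT.
have far t : T <= t -> 0 < nrm (h t) /\
    nrm (G.[h t] - h t ^+ n.+1) <= c * nrm (h t) ^+ n.+1.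
  move=> Tt; have t0 : 0 <= t by exact: le_trans (ltW T0) Tt.
  have hrho : rho <= nrm (h t).
    rewrite leNgt; apply/negP => /ltW hrho.
    have := congr1 nrm (Fh t t0); rewrite nrm_target ger0_norm // nrmM.
    have h1 := hM _ hrho.
    have h2 : nrm (1 - h t / w%:C) <= 2.
      apply: le_trans (nrmD _ _) _; rewrite nrm1 nrmN nrmM nrmV nrm_real gtr0_norm //.
      have : nrm (h t) / w <= 1 by rewrite ler_pdivrMr // mul1r; clear -wr hrho; lra.
      by clear; lra.
    have := ler_pM (nrm_ge0 _) (nrm_ge0 _) h1 h2; clear -TM Tt; lra.
  by split; [clear -r1 hrho; lra|apply: hr].
have aT' : `|carg (h T) * n.+1%:R - psi| < pi / 2.
  have n0 : 0 < n.+1%:R :> R by rewrite ltr0n.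
  have -> : carg (h T) * n.+1%:R - psi = (carg (h T) - psi / n.+1%:R) * n.+1%:R.
    by rewrite mulrBl divfK // gt_eqF.
  by rewrite normrM (gtr0_norm n0) -ltr_pdivlMr.
have hTw : nrm (h T) < w by clear -hTg wgT de e11; lra.
have locked := phase_locked w0 T0 c2 cs ch (fun t Tt => Fh t (ltW (lt_le_trans T0 Tt)))
   far iT hTw aT'.
have [d1 d10 [T3 T30 lockH]] := end_lock Hm sH.
have gap0 : 0 < 1 - cos (pi / n.+2%:R) :> R.
  have N0 : 0 < n.+2%:R :> R by rewrite ltr0n.
  have p0 := pi_gt0 R.
  have := @ltr_cos R 0 (pi / n.+2%:R); rewrite !in_itv /= lexx (ltW p0) cos0 subr_gt0.
  rewrite divr_ge0 ?(ltW p0) ?(ltW N0) //= ler_pdivrMr // ler_peMr ?(ltW p0) ?ler1n //.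
  by move=> /(_ isT isT) ->; rewrite divr_gt0.
pose e' := Num.min d1 (1 - cos (pi / n.+2%:R)).
have e'0 : 0 < e' by rewrite lt_min d10.
have [T4 T40 hT4] := far_dir Hm sH e'0.
have [T5 hT5] := ray_large (w + 1) Hm sH rh'.
pose s := Num.max (w * T) (Num.max T3 (Num.max T4 T5)).
have [sT s3 s4 s5] : [/\ w * T <= s, T3 <= s, T4 <= s & T5 <= s].
  by split; rewrite !le_max lexx ?orbT.
clearbody s; pose t := s / w.
have Tt : T <= t by rewrite ler_pdivlMr // mulrC.
have ht : h t = h' s by rewrite /h /t mulrC divfK // gt_eqF.
have s_0 : 0 <= s by exact: le_trans T30 s3.
have [_ [l ln hl]] := hT4 _ _ _ s4 (proj2 rh' s s_0).
have [a [b [m [[m0 ha hb] za zb iz hA]]]] := locked t Tt.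
have wz : w < nrm (h t).
  by rewrite ht; have := hT5 _ s5; clear; lra.
have e'g : e' <= 1 - cos (pi / n.+2%:R) by rewrite ge_min lexx orbT.
rewrite -ht in hl; have l0 := end_stage w0 wz iz m0 ha hb za zb hA ln e'g hl.
exists h'; split=> //; apply: (lockH (psi + pi) _ h' s) => //.
  by rewrite divfK // pnatr_eq0.
move: hl; rewrite l0 mulr0 addr0 -ht => hl; apply: lt_le_trans hl _.
by rewrite ler_wpM2r ?nrm_ge0 // ge_min lexx.
Qed.

End AttachEnds.

(** * Realizing necklaces at sample angles *)

Section Symmetries.
Import Order.TTheory GRing.Theory Num.Theory.
Local Open Scope ring_scope.
Local Open Scope complex_scope.
Context {R : realType}.
Implicit Types (z u v : R[i]) (f p q G : {poly R[i]}) (g h : R -> R[i]) (w : R).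

Definition conjp f : {poly R[i]} := map_poly (@conjc R) f.

Lemma conjp_horner f z : (conjp f).[z^*%C] = (f.[z])^*%C.
Proof. by rewrite /conjp horner_map. Qed.

Lemma conjpK f : conjp (conjp f) = f.
Proof. by apply/polyP => i; rewrite !coef_map /= conjcK. Qed.

Lemma off_dir_conj z (phi : R) : off_dir z^*%C (- phi) = off_dir z phi.
Proof.
rewrite /off_dir nrm_conj -[RHS]nrm_conj; congr nrm; rewrite /Defs.cexp cosN sinN.
by move: (nrm z) => r; case: z => x y; apply: complex_ext => /=; ring.
Qed.

Lemma reach_conj f N z (psi : R) : reach f N z psi -> reach (conjp f) N z^*%C (- psi).
Proof.
move=> [g [[cg fg] gz dg]]; exists (fun t => (g t)^*%C); split.
- split; first exact: contp_conj.
  move=> t t0; rewrite conjp_horner fg // /Defs.cexp cosN sinN.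
  by apply: complex_ext => /=; ring.
- by rewrite gz.
- by move=> e /dg[T hT]; exists T => t /hT; rewrite mulNr off_dir_conj nrm_conj.
Qed.

Lemma nonsing_conj f (psi : R) : nonsing f psi -> nonsing (conjp f) (- psi).
Proof.
move=> ns c; rewrite /conjp deriv_map => rc.
have rc' : root f^`() c^*%C.
  by move: rc; rewrite -{1}(conjcK c) fmorph_root.
move=> im; apply: (ns _ rc'); rewrite -[c]conjcK conjp_horner in im.
move: im; rewrite opprK /Defs.cexp cosN sinN; case: (f.[_]) => x y /=.
by move: (cos psi) (sin psi) => C S; lra.
Qed.

Lemma conjp_attach G w : conjp (attach G w) = attach (conjp G) w.
Proof. by rewrite /conjp /attach rmorphM rmorphB /= map_polyX map_polyC /= oppr0. Qed.

(** Conjugation exchanges the half planes and respects the product because w is real. *)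
Lemma attach_lower G n psi z : G \is monic -> size G = n.+2 -> nonsing G psi ->
  - pi < psi / n.+1%:R < 0 -> sin psi != 0 -> reach G n.+1 z psi ->
  exists W, forall w, W <= w -> reach (attach G w) n.+2 z (psi - pi).
Proof.
move=> Gm sG ns hphi sp rz.
have [||||||W hW] := @attach_upper _ (conjp G) n (- psi) z^*%C.
- by rewrite map_monic.
- by rewrite size_map_poly.
- exact: nonsing_conj.
- by rewrite mulNr oppr_gt0 ltrNl andbC.
- by rewrite sinN oppr_eq0.
- exact: reach_conj.
exists W => w /hW /reach_conj; rewrite conjcK conjp_attach conjpK.
by rewrite opprD opprK.
Qed.

(* Rotation of target and source that keeps f monic and takes label k at angle
   th to label k at angle th - a. *)
Definition rotp (N : nat) (a : R) f : {poly R[i]} :=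
  cexp (- a) *: (f \Po (cexp (a / N%:R) *: 'X)).

Lemma rotp_horner N a f z : (rotp N a f).[z] = cexp (- a) * f.[cexp (a / N%:R) * z].
Proof. by rewrite hornerZ horner_comp hornerZ hornerX. Qed.

Lemma size_rotp N a f : size (rotp N a f) = size f.
Proof.
rewrite size_scale ?cexp_neq0 // size_comp_poly2 // size_scale ?cexp_neq0 //.
by rewrite size_polyX.
Qed.

Lemma rotp_monic N a f : f \is monic -> size f = N.+1 -> (0 < N)%N ->
  rotp N a f \is monic.
Proof.
move=> fm sf N0; rewrite monicE lead_coefZ lead_coef_comp; last first.
  by rewrite size_scale ?cexp_neq0 // size_polyX.
rewrite (monicP fm) mul1r lead_coefZ lead_coefX mulr1 sf /= cexpX divfK.
  by rewrite cexpNM.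
by rewrite pnatr_eq0 -lt0n.
Qed.

Lemma reach_rotp N a f z (psi : R) : reach f N z psi ->
  reach (rotp N a f) N (cexp (- (a / N%:R)) * z) (psi - a).
Proof.
move=> [g [[cg fg] gz dg]]; exists (fun t => cexp (- (a / N%:R)) * g t); split.
- split; first exact: contpZ.
  move=> t t0; rewrite rotp_horner mulrA cexpMN mul1r fg // cexpD; ring.
- by rewrite gz.
- move=> e /dg[T hT]; exists T => t /hT; rewrite nrmM nrm_cexp mul1r.
  suff -> : off_dir (cexp (- (a / N%:R)) * g t) ((psi - a) / N%:R) =
      off_dir (g t) (psi / N%:R) by [].
  rewrite /off_dir nrmM nrm_cexp mul1r mulrBl (addrC (psi / N%:R)) cexpD.
  set c := cexp (- (a / _)); set e1 := cexp (psi / _); set r := (nrm _)%:C.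
  have -> : c * g t - r * (c * e1) = c * (g t - r * e1) by ring.
  by rewrite nrmM nrm_cexp mul1r.
Qed.

Lemma nonsing_rotp N a f (psi : R) : nonsing f psi -> nonsing (rotp N a f) (psi - a).
Proof.
move=> ns c; rewrite /rotp derivZ deriv_comp derivZ derivX.
rewrite rootZ ?cexp_neq0 // rootM [root (_ *: _) _]rootZ ?cexp_neq0 // (negPf (root1 _)) orbF.
rewrite rootE horner_comp hornerZ hornerX -rootE => /ns.
rewrite -/(rotp N a f) rotp_horner mulrA -cexpD.
by have -> : - (psi - a) + - a = - psi by ring.
Qed.

End Symmetries.

(** * Matchings realized at one angle *)

Section Realization.
Import Order.TTheory GRing.Theory Num.Theory.
Local Open Scope ring_scope.
Local Open Scope complex_scope.
Context {R : realType}.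
Implicit Types (z u v : R[i]) (f G : {poly R[i]}) (w th : R) (p q : nat -> nat).

Definition realizes f (N : nat) th p : Prop :=
  nonsing f th /\ forall k, (k < 2 * N)%N -> exists z,
    reach f N z (th + pi * k%:R) /\ reach f N z (th + pi * (p k)%:R).

Lemma cexp_pin th k : cexp (th + pi * k%:R) = cexp th \/ cexp (th + pi * k%:R) = - cexp th.
Proof.
elim: k => [|k IH]; first by left; rewrite mulr0 addr0.
rewrite -[k.+1%:R]natr1 mulrDr mulr1 addrA cexpDpi.
by case: IH => ->; [right|left; rewrite opprK].
Qed.

Lemma nonsing_label f th k : nonsing f th -> nonsing f (th + pi * k%:R).
Proof.
apply: nonsing_cexp; case: (cexp_pin th k) => ->; first by left.
by right; rewrite opprK.
Qed.

Lemma eventually_all (K : nat) (P : nat -> R -> Prop) :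
  (forall k, (k < K)%N -> exists W, forall w, W <= w -> P k w) ->
  exists W, forall w, W <= w -> forall k, (k < K)%N -> P k w.
Proof.
elim: K => [|K IH] H; first by exists 0.
have [|W1 h1] := IH; first by move=> k kK; apply: H; apply: leqW.
have [W2 h2] := H K (ltnSn K).
exists (Num.max W1 W2) => w; rewrite ge_max => /andP[w1 w2] k.
by rewrite ltnS leq_eqVlt => /predU1P[->|]; [exact: h2|exact: h1].
Qed.

Lemma nearby_all (K : nat) (P : nat -> R -> Prop) (x : R) :
  (forall k, (k < K)%N -> exists2 d, 0 < d & forall y, `|y - x| < d -> P k y) ->
  exists2 d, 0 < d & forall y, `|y - x| < d -> forall k, (k < K)%N -> P k y.
Proof.
elim: K => [|K IH] H; first by exists 1.
have [|d1 d10 h1] := IH; first by move=> k kK; apply: H; apply: leqW.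
have [d2 d20 h2] := H K (ltnSn K).
exists (Num.min d1 d2); first by rewrite lt_min d10.
move=> y; rewrite lt_min => /andP[y1 y2] k.
by rewrite ltnS leq_eqVlt => /predU1P[->|]; [exact: h2|exact: h1].
Qed.

Lemma realizes_open f n th p : f \is monic -> size f = n.+2 -> realizes f n.+1 th p ->
  exists2 d, 0 < d & forall th', `|th' - th| < d -> realizes f n.+1 th' p.
Proof.
move=> fm sf [ns H].
have [d1 d10 h1] := nonsing_open sf ns.
have [|d2 d20 h2] := @nearby_all (2 * n.+1) (fun k th' => exists z,
    reach f n.+1 z (th' + pi * k%:R) /\ reach f n.+1 z (th' + pi * (p k)%:R)) th.
  move=> k /H[z [r1 r2]].
  have [e1 e10 H1] := reach_open fm sf (@nonsing_label _ _ k ns) r1.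
  have [e2 e20 H2] := reach_open fm sf (@nonsing_label _ _ (p k) ns) r2.
  exists (Num.min e1 e2); first by rewrite lt_min e10.
  move=> y; rewrite lt_min => /andP[y1 y2]; exists z.
  have E (k' : nat) : y + pi * k'%:R - (th + pi * k'%:R) = y - th by ring.
  by split; [apply: H1|apply: H2]; rewrite E.
exists (Num.min d1 d2); first by rewrite lt_min d10.
by move=> y; rewrite lt_min => /andP[y1 y2]; split; [exact: h1|exact: h2].
Qed.

(** [l] is true before the leaf flip; with that flip at angle 0, earlier samples are negative. *)
Definition sample_range (l : bool) th : bool :=
  if l then - pi < th < 0 else 0 < th < pi.

Lemma sin_label (l : bool) th k : sample_range l th -> sin (th + pi * k%:R) != 0.
Proof.
move=> hl; have s0 : sin th != 0.
  move: hl; rewrite /sample_range; case: l => h.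
    by rewrite -oppr_eq0 -sinN gt_eqF // sin_gt0_pi // oppr_gt0 ltrNl andbC.
  by rewrite gt_eqF // sin_gt0_pi.
have := cexp_pin th k; case=> /(congr1 (@complex.Im R)); rewrite !cexp_Im => ->.
  by [].
by rewrite -sub0r ImB sub0r oppr_eq0.
Qed.

(** The target angle changes by + pi for ends in the upper and by - pi for ends in the lower half
    plane. As labels now count modulo 2 (n + 2) instead of 2 (n + 1), both changes send K to K + 1,
    except that K = 0 at a negative angle becomes the last label; this is [emb]. *)
Lemma attach_label (l : bool) G n th z K : G \is monic -> size G = n.+2 ->
  nonsing G th -> sample_range l th -> (K < 2 * n.+1)%N ->
  reach G n.+1 z (th + pi * K%:R) ->
  exists W, forall w, W <= w ->
    reach (attach G w) n.+2 z (th + pi * (emb n.+2 l K)%:R).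
Proof.
move=> Gm sG ns hl KN rz; have nsK := @nonsing_label _ _ K ns.
have sK := sin_label K hl; have p0 := pi_gt0 R.
have N0 : 0 < n.+1%:R :> R by rewrite ltr0n.
have rl := hl; rewrite /sample_range in rl.
pose A : R := th + pi * K%:R.
have upper : 0 < A < pi * n.+1%:R -> emb n.+2 l K = K.+1 ->
    exists W, forall w, W <= w ->
    reach (attach G w) n.+2 z (th + pi * (emb n.+2 l K)%:R).
  move=> /andP[a0 a1] ->.
  have [|W hW] := attach_upper Gm sG nsK _ sK rz.
    by rewrite divr_gt0 // ltr_pdivrMr.
  exists W => w /hW; suff -> : th + pi * K%:R + pi = th + pi * K.+1%:R by [].
  by rewrite -[K.+1%:R]natr1; ring.
have lower x (k' : nat) : x + 2 * pi * (n.+1 * k')%:R = A -> - (pi * n.+1%:R) < x < 0 ->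
    x - pi + 2 * pi * (n.+2 * 1)%:R = th + pi * (emb n.+2 l K)%:R ->
    exists W, forall w, W <= w ->
    reach (attach G w) n.+2 z (th + pi * (emb n.+2 l K)%:R).
  move=> xA /andP[x0 x1] <-; rewrite -/A -xA in rz nsK sK.
  have cx : cexp (x + 2 * pi * (n.+1 * k')%:R) = cexp x by rewrite cexpD2pin.
  have [||||W hW] := @attach_lower _ G n x z Gm sG.
  - by apply: nonsing_cexp nsK; left.
  - by rewrite ltr_pdivlMr // ltr_pdivrMr // mul0r mulNr x0.
  - by have := congr1 (@complex.Im R) cx; rewrite !cexp_Im => <-.
  - by move: rz; rewrite reach_period.
  by exists W => w /hW; rewrite reach_period.
have emb0 : emb n.+2 l K = (if (K == 0%N) && l then (2 * n.+2).-1 else K.+1) by [].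
(* At a negative angle the label n + 1 still points into the upper half plane, whence the summand
   [l]. *)
have [nK|Kn] := leqP (n.+1 + l) K.
  have K0 : (K == 0%N) = false by apply/eqP; lia.
  apply: (lower (A - 2 * pi * n.+1%:R) 1%N).
  - by rewrite muln1 subrK.
  - rewrite /A; have kk : n.+1%:R + (if l then 1 else 0) <= K%:R :> R.
      by move: nK; case: (l); rewrite ?addn0 ?addr0 ?addn1 ?natr1 ler_nat.
    have k2 : K%:R + 1 <= 2 * n.+1%:R :> R by rewrite natr1 -natrM ler_nat.
    have kl := ler_wpM2l (ltW p0) kk; have k2l := ler_wpM2l (ltW p0) k2.
    move: rl kl k2l; case: (l) => /andP[t1 t2];
      move: t1 t2; move: (pi : R) p0 => c *; apply/andP; split; lra.
  - rewrite emb0 K0 /A -[K.+1%:R]natr1 muln1 -[n.+2%:R]natr1; ring.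
case: (posnP K) => [K0|K0].
  have : emb n.+2 l K = (if l then (2 * n.+2).-1 else 1%N) by rewrite emb0 K0.
  move: hl rl upper lower; case: (l) => hl /andP[t1 t2] upper lower eE.
  - apply: (lower th 0%N).
    + by rewrite muln0 mulr0 addr0 /A K0 mulr0 addr0.
    + rewrite t2 andbT; apply: le_lt_trans t1; rewrite lerN2.
      by rewrite ler_peMr ?ler1n // ltW.
    + rewrite eE muln1.
      have -> : (2 * n.+2).-1%:R = 2 * n.+2%:R - 1 :> R.
        by rewrite -natrM -subn1 natrB.
      ring.
  - apply: upper; last by rewrite K0.
    rewrite /A K0 mulr0 addr0 t1 /=; apply: lt_le_trans t2 _.
    by rewrite ler_peMr ?ler1n // ltW.
apply: upper; last by rewrite emb0 gtn_eqF.
rewrite /A; have k1 : 1 <= K%:R :> R by rewrite ler1n.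
have kk : K%:R + 1 <= n.+1%:R + (if l then 1 else 0) :> R.
  by move: Kn; case: (l); rewrite ?addn0 ?addr0 ?addn1 !natr1 ler_nat.
have kl := ler_wpM2l (ltW p0) kk; have k1l := ler_wpM2l (ltW p0) k1.
move: rl kl k1l; case: (l) => /andP[t1 t2];
  move: t1 t2; move: (pi : R) p0 => c *; apply/andP; split; lra.
Qed.

(** The roots of G reach every label but 0 and p 0. Distinct roots having distinct ends, these two
    are left for w, and parity distributes them: w reaches an even and an odd label, and p 0 is
    odd. *)
Lemma attach_realizes (l : bool) G n th p : G \is monic -> size G = n.+2 ->
  sample_range l th -> pairing (2 * n.+2) p -> leaf1 n.+2 l p ->
  realizes G n.+1 th (reduce1 n.+2 l p) ->
  exists W, forall w, W <= w -> realizes (attach G w) n.+2 th p.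
Proof.
move=> Gm sG hl pp lf [ns H].
have s0 : sin th != 0 by have := sin_label 0 hl; rewrite mulr0 addr0.
have [W1 h1] := attach_nonsing Gm sG ns s0.
have [|W2 h2] := @eventually_all (2 * n.+1) (fun K w => exists z, [/\ G.[z] = 0,
    reach (attach G w) n.+2 z (th + pi * (emb n.+2 l K)%:R) &
    reach (attach G w) n.+2 z (th + pi * (p (emb n.+2 l K))%:R)]).
  move=> K KN; have [z [r1 r2]] := H K KN.
  have [kE _] := embP l (isT : (1 < n.+2)%N) KN.
  have kP := kept_partner (isT : (1 < n.+2)%N) pp lf kE.
  have [rN rE] := retP (isT : (1 < n.+2)%N) kP.
  have [Wa ha] := attach_label Gm sG ns hl KN r1.
  have [Wb hb] := attach_label Gm sG ns hl rN r2.
  exists (Num.max Wa Wb) => w; rewrite ge_max => /andP[wa wb].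
  exists z; split; [exact: reach_root r1|exact: ha|].
  by rewrite -rE; apply: hb.
have [rho r0 hr] := poly_large 1 Gm sG.
exists (Num.max (Num.max W1 W2) rho) => w; rewrite !ge_max => /andP[/andP[w1 w2] w3].
have Hm := attach_monic w Gm; have sH := attach_size w Gm sG.
have nsH := h1 w w1.
(* w is too large to be a root of G, hence differs from the roots considered so far. *)
have Gw : G.[w%:C] <> 0.
  move=> e; have := hr w%:C; rewrite nrm_real e nrm0 (ger0_norm (le_trans (ltW r0) w3)).
  by move=> /(_ w3); rewrite ler10.
have keptP x : kept n.+2 l x -> exists z, [/\ G.[z] = 0,
    reach (attach G w) n.+2 z (th + pi * x%:R) &
    reach (attach G w) n.+2 z (th + pi * (p x)%:R)].
  move=> kx; have [rN rE] := retP (isT : (1 < n.+2)%N) kx.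
  by have := h2 w w2 _ rN; rewrite rE.
have n0 : (0 < 2 * n.+2)%N by [].
have [LN L0 pL] := pp 0%N n0.
have free x : (x < 2 * n.+2)%N -> reach (attach G w) n.+2 w%:C (th + pi * x%:R) ->
    x = 0%N \/ x = p 0%N.
  move=> xN rx; case: (pselect (kept n.+2 l x)) => [kx|nk].
    have [z [Gz rz _]] := keptP x kx.
    have e := reach_inj Hm sH (@nonsing_label _ _ x nsH) rx rz.
    by case: Gw; rewrite e.
  move: nk xN; rewrite /kept lf; case: (l) => nk xN.
    have : ~ (1 < x)%N by move=> h; apply: nk.
    by lia.
  have : ~ ((0 < x) && (x < (2 * n.+2).-1))%N by move=> h; apply: nk.
  by lia.
have Hw : (attach G w).[w%:C] = 0 by rewrite attach_horner subrr mulr0.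
have oddL : odd (p 0%N) by rewrite lf; case: (l) => //; lia.
(* The two rays issuing from w, one for each parity of the label, both have an end. *)
have rw (c : nat) : (c < 2)%N -> exists x, [/\ (x < 2 * n.+2)%N, odd x = odd c &
    reach (attach G w) n.+2 w%:C (th + pi * x%:R)].
  move=> c2; have [l' ln r] := reach_exists Hm sH (@nonsing_label _ _ c nsH) Hw.
  exists (c + 2 * l')%N; split; [by lia|by rewrite oddD mul2n odd_double addbF|].
  move: r; rewrite natrD natrM.
  by have -> : th + pi * c%:R + 2 * pi * l'%:R = th + pi * (c%:R + 2%:R * l'%:R) by ring.
have rw0 : reach (attach G w) n.+2 w%:C (th + pi * 0%:R).
  have [x [xN ox r]] := rw 0%N isT; case: (free x xN r) => e; first by rewrite -e.
  by rewrite e oddL in ox.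
have rwL : reach (attach G w) n.+2 w%:C (th + pi * (p 0%N)%:R).
  have [x [xN ox r]] := rw 1%N isT; case: (free x xN r) => e; last by rewrite -e.
  by rewrite e in ox.
split=> // x xN; case: (pselect (kept n.+2 l x)) => [kx|nk].
  by have [z [_ a b]] := keptP x kx; exists z.
have [->|->] : x = 0%N \/ x = p 0%N.
  move: nk xN; rewrite /kept lf; case: (l) => nk xN.
    have : ~ (1 < x)%N by move=> h; apply: nk.
    by lia.
  have : ~ ((0 < x) && (x < (2 * n.+2).-1))%N by move=> h; apply: nk.
  by lia.
- by exists w%:C.
- by exists w%:C; rewrite pL.
Qed.

Lemma rotp_realizes f n th p a : realizes f n th p -> realizes (rotp n a f) n (th - a) p.
Proof.
move=> [ns H]; split; first exact: nonsing_rotp.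
move=> k /H[z [r1 r2]]; exists (cexp (- (a / n%:R)) * z).
have E (x : nat) : th - a + pi * x%:R = th + pi * x%:R - a by ring.
by rewrite !E; split; apply: reach_rotp.
Qed.

Lemma rotdown_realizes f n th p : (0 < n)%N -> pairing (2 * n) p ->
  realizes f n th (rotdown (2 * n) p) -> realizes (rotp n (- pi) f) n th p.
Proof.
move=> n0 pp [ns H]; split.
  have -> : th = (th - pi) - (- pi) by ring.
  by apply: nonsing_rotp; apply: nonsing_cexp ns; right; rewrite cexpBpi opprK.
move=> k kN; have dN := dn_lt kN; have [z [r1 r2]] := H _ dN.
rewrite /rotdown dnK // in r2; have [pN _ _] := pp _ kN.
exists (cexp (- (- pi / n%:R)) * z).
have S x : (x < 2 * n)%N -> reach f n z (th + pi * (dn (2 * n) x)%:R) ->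
    reach (rotp n (- pi) f) n (cexp (- (- pi / n%:R)) * z) (th + pi * x%:R).
  move=> xN /(reach_rotp (- pi)); rewrite /dn; case: eqP => [->|/eqP x0].
    rewrite -(reach_period _ _ (th + pi * 0%:R) 1 n0) muln1.
    have -> : (2 * n).-1%:R = 2 * n%:R - 1 :> R by rewrite -subn1 natrB ?natrM //; lia.
    suff -> : th + pi * (2 * n%:R - 1) - - pi = th + pi * 0%:R + 2 * pi * n%:R by [].
    ring.
  have -> : x.-1%:R = x%:R - 1 :> R by rewrite -subn1 natrB // lt0n.
  suff -> : th + pi * (x%:R - 1) - - pi = th + pi * x%:R by [].
  ring.
by split; apply: S.
Qed.

End Realization.

(** * Induction on the order of the necklace *)

Section NecklaceRealization.
Import Order.TTheory GRing.Theory Num.Theory.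
Local Open Scope ring_scope.
Local Open Scope complex_scope.
Context {R : realType}.
Implicit Types (z u v : R[i]) (f G : {poly R[i]}) (w th : R) (p : nat -> nat -> nat).

Definition sampled f n p (eta : nat -> R) : Prop :=
  [/\ f \is monic, size f = n.+2,
      forall s, (s < n.+1)%N -> 0 < eta s < pi /\ realizes f n.+1 (eta s) (p s)
    & forall s, (s.+1 < n.+1)%N -> eta s < eta s.+1].

Lemma sampled_base p : pnecklace 1 p -> exists f eta, sampled f 0 p eta.
Proof.
move=> [pn _ _]; have [pp _] := pn 0%N isT.
exists 'X, (fun=> pi / 2); split=> //; rewrite ?monicX ?size_polyX //.
move=> s; rewrite ltnS leqn0 => /eqP ->; split.
  by rewrite divr_gt0 ?pi_gt0 // ltr_pdivrMr // ltr_pMr ?pi_gt0 // ltr1n.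
have R0 (psi : R) : reach 'X 1 0 psi.
  exists (fun t => t%:C * cexp psi); split.
  - split; last by move=> t _; rewrite hornerX.
    move=> t e e0; exists e => // s'; rewrite -mulrBl -rmorphB nrmM nrm_cexp mulr1.
    by rewrite nrm_real.
  - by rewrite mul0r.
  - move=> e e0; exists 1 => t t1; have t0 : 0 < t by lra.
    rewrite /off_dir divr1 nrm_target gtr0_norm // subrr nrm0.
    by rewrite mulr_gt0.
split; first by move=> c; rewrite derivX (negPf (root1 _)).
by move=> k kN; exists 0.
Qed.

(* The leaf flip is inserted at an angle al between eta m and a new sample b
   with the same reduced matching: after turning al into 0, a new root at a
   large w > 0 has its sheet joined to the label 1 before 0 and -1 after it. *)
Lemma sampled_step n m p g eta : pnecklace n.+2 p -> (m.+1 < n.+2)%N ->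
  leafed n.+2 p m 0 -> sampled g n (reduce n.+2 m p) eta ->
  exists f eta', sampled f n.+1 p eta'.
Proof.
move=> [pn fl pl] mn [l1 l2] [gm sg rg inc].
have mN : (m < n.+1)%N by [].
have [em rm] := rg m mN.
have [d d0 hd] := realizes_open gm sg rm.
(* The new sample must stay below the next old one, or below pi if there is none. *)
have [nx [nx0 nx1 nx2]] : exists nx, [/\ eta m < nx, nx <= pi &
    (m.+1 < n.+1)%N -> nx <= eta m.+1].
  have [h|h] := ltnP m.+1 n.+1.
    exists (eta m.+1); split=> //; first exact: inc.
    by have [/andP[_ /ltW]] := rg _ h.
  by exists pi; split=> //; case/andP: em.
pose b := Num.min (eta m + d / 2) ((eta m + nx) / 2).
have d2 : 0 < d / 2 by rewrite divr_gt0.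
have b1 : eta m < b by rewrite lt_min ltrDl d2 /=; lra.
have b2 : b < nx.
  have : b <= (eta m + nx) / 2 by rewrite ge_min lexx orbT.
  lra.
have b3 : b <= eta m + d / 2 by rewrite ge_min lexx.
clearbody b.
have rb : realizes g n.+1 b (reduce n.+2 m p m).
  by apply: hd; rewrite ger0_norm; lra.
pose al := (eta m + b) / 2.
have [al1 al2] : eta m < al /\ al < b by rewrite /al; split; lra.
have eta_le s s' : (s <= s')%N -> (s' < n.+1)%N -> eta s <= eta s'.
  elim: s' => [|s' IH]; first by rewrite leqn0 => /eqP ->.
  rewrite leq_eqVlt => /predU1P[->//|]; rewrite ltnS => ss' sn.
  by apply: le_trans (IH ss' (ltnW sn)) (ltW (inc _ sn)).
(* The old samples with b inserted at position m + 1. *)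
pose ze s := if (s <= m)%N then eta s else if s == m.+1 then b else eta s.-1.
have al0 : 0 < al by case/andP: em => ? _; lra.
have alpi : al < pi by lra.
have zeP s : (s < n.+2)%N -> [/\ 0 < ze s < pi, sample_range (s <= m)%N (ze s - al) &
    realizes g n.+1 (ze s) (reduce1 n.+2 (s <= m)%N (p s))].
  move=> sn; rewrite /ze /sample_range; case: (leqP s m) => sm.
    have sn' : (s < n.+1)%N by exact: leq_ltn_trans sm mN.
    have [e r] := rg s sn'; have le := eta_le s m sm mN.
    split=> //; first by case/andP: e => ? ?; apply/andP; split; lra.
    by move: r; rewrite /reduce sm.
  case: (s =P m.+1) => [->|sm'].
    have b0 : 0 < b by lra.
    split; [by apply/andP; split; lra|by apply/andP; split; lra|].
    have [ns H] := rb; split=> // k kN.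
    have [[p1 _] [p2 _]] := (pn m (ltnW mn), pn _ mn).
    (* What g realizes at b is the reduced matching of time m, which is also that of time m + 1 with
       the leaf on its other side. *)
    have rE := reduce_leaf_flip (isT : (1 < n.+2)%N) p1 p2 _ _ (fl _ mn) kN.
    have := H k kN; rewrite /reduce leqnn rE //.
      by rewrite /leaf1 l1.
    by rewrite /leaf1 l2.
  have sn' : (s.-1 < n.+1)%N by clear -sm sn; lia.
  have ms : (m.+1 <= s.-1)%N by clear -sm sm'; lia.
  have [e r] := rg _ sn'; have le := eta_le _ _ ms sn'.
  have m1n : (m.+1 < n.+1)%N by exact: leq_ltn_trans ms sn'.
  have := nx2 m1n => h.
  split=> //; first by case/andP: e => ? ?; apply/andP; split; lra.
  by move: r; rewrite /reduce leqNgt ms /= prednK // (leq_ltn_trans (leq0n m) sm).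
have zinc s : (s.+1 < n.+2)%N -> ze s < ze s.+1.
  move=> sn; rewrite /ze; case: (ltngtP s m) => sm.
  - by apply: inc; exact: leq_ltn_trans sm mN.
  - have -> : (s.+1 == m.+1) = false by rewrite eqSS gtn_eqF.
    case: (s =P m.+1) => [e|sm'].
      rewrite e /=; by apply: lt_le_trans b2 (nx2 _); move: sn; rewrite e.
    have s0 : (0 < s)%N by exact: leq_ltn_trans sm.
    by rewrite -{2}(prednK s0) /=; apply: inc; rewrite prednK.
  - by rewrite sm eqxx.
pose G := rotp n.+1 al g.
have Gm : G \is monic by apply: rotp_monic.
have sG : size G = n.+2 by rewrite size_rotp.
(* There are finitely many samples, so a single W serves all of them. *)
have [|W hW] := @eventually_all R n.+2 (fun s w => realizes (attach G w) n.+2 (ze s - al) (p s)).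
  move=> s sn; have [_ hl r] := zeP s sn; have [pp _] := pn s sn.
  apply: (attach_realizes Gm sG hl pp); last exact: rotp_realizes.
  by rewrite /leaf1; case: leqP => sm; [rewrite l1|rewrite l2].
exists (rotp n.+2 (- al) (attach G W)), ze; split.
- by apply: rotp_monic; rewrite ?attach_monic // (attach_size _ Gm sG).
- by rewrite size_rotp (attach_size _ Gm sG).
- move=> s sn; have [z1 _ _] := zeP s sn; split=> //.
  have := rotp_realizes (- al) (hW W (lexx _) s sn).
  by rewrite opprK subrK.
- exact: zinc.
Qed.

Lemma sampled_rotdown n p f eta : pnecklace n.+1 p ->
  sampled f n (fun s => rotdown (2 * n.+1) (p s)) eta -> exists f', sampled f' n p eta.
Proof.
move=> [pn _ _] [fm sf rf inc]; exists (rotp n.+1 (- pi) f); split=> //.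
- exact: rotp_monic.
- by rewrite size_rotp.
- move=> s sn; have [e r] := rf s sn; split=> //.
  by have [pp _] := pn s sn; apply: rotdown_realizes.
Qed.

(** Inside the induction on the order, a second one moves the leaf down to the label 0 by
    rotations. *)
Lemma necklace_sampled n p : pnecklace n.+1 p -> exists f eta, sampled f n p eta.
Proof.
elim: n p => [|n IH] p pn; first exact: sampled_base.
have [j [m [jN mn l1 l2]]] := leaf_exists (isT : (1 < n.+2)%N) pn.
have lf : leafed n.+2 p m j by [].
elim: j p pn jN lf {l1 l2} => [|j IHj] p pn jN lf.
  have [g [eta sg]] := IH _ (pnecklace_reduce (isT : (1 < n.+2)%N) mn pn lf).
  exact: sampled_step pn mn lf sg.
have pn' := pnecklace_rotdown (isT : (0 < n.+2)%N) pn.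
have lf' := leafed_rotdown (isT : (0 < n.+2)%N) jN lf.
have [f [eta sf]] := IHj _ pn' (ltnW jN) lf'.
by have [f' sf'] := sampled_rotdown pn sf; exists f', eta.
Qed.

End NecklaceRealization.

(** * Components, asymptotes and singular angles *)

Section Sheets.
Import Order.TTheory GRing.Theory Num.Theory.
Import numFieldNormedType.Exports.
Local Open Scope ring_scope.
Local Open Scope complex_scope.
Local Open Scope classical_set_scope.
Context {R : realType}.
Implicit Types (z u v : R[i]) (f G : {poly R[i]}) (g h : R -> R[i]) (w th : R).

(** The rays at th and th + pi from the same root as one path, parametrized by the signed value of
    e^(- i th) f; this is a whole sheet of the curve. *)
Definition is_line f th z g : Prop :=
  [/\ contp g, g 0 = z & forall s, f.[g s] = s%:C * cexp th].

Lemma line_exists f n th z : f \is monic -> size f = n.+2 -> nonsing f th ->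
  f.[z] = 0 -> exists g, is_line f th z g.
Proof.
move=> fm sf ns fz.
have ns' : nonsing f (th + pi).
  by apply: nonsing_cexp ns; right; rewrite cexpDpi opprK.
have [g [[cg fg] g0]] := ray_exists fm sf ns fz.
have [h [[ch fh] h0]] := ray_exists fm sf ns' fz.
have cM : contR (fun t : R => Num.max t 0) by apply: contR_lip1 => *; exact: lip1_max.
have cN : contR (fun t : R => Num.max (- t) 0).
  apply: contR_lip1 => s t; apply: le_trans (lip1_max _ _ _) _.
  by rewrite -opprD normrN.
exists (fun t => g (Num.max t 0) + (h (Num.max (- t) 0) - z)); split.
- apply: contpD; first exact: (contp_comp cg cM).
  by apply: contpB; [exact: (contp_comp ch cN)|exact: contp_cst].
- by rewrite oppr0 maxxx g0 h0 subrr addr0.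
- move=> s; have [s0|s0] := leP 0 s.
    by rewrite (elimT max_idPr) ?oppr_le0 // h0 subrr addr0 fg.
  rewrite (elimT max_idPl) ?oppr_ge0 ?(ltW s0) // g0 addrC subrK fh ?oppr_ge0 ?ltW //.
  by rewrite cexpDpi rmorphN mulrNN.
Qed.

Lemma line_ray f n th z g h k : f \is monic -> size f = n.+2 -> nonsing f th ->
  is_line f th z g -> is_ray f (th + pi * k%:R) h -> h 0 = z ->
  forall t, 0 <= t -> exists s, h t = g s.
Proof.
move=> fm sf ns [cg g0 fg] rh h0 t t0.
have nsk := @nonsing_label _ _ _ k ns.
case: (cexp_pin th k) => e.
  exists t; apply: (ray_uniq fm sf nsk rh _ _ t0); last by rewrite h0 g0.
  by split=> // s s0; rewrite fg e.
exists (- t); have r : is_ray f (th + pi * k%:R) (fun t => g (- t)).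
  split.
    have cN : contR (fun t : R => - t).
      by apply: contR_lip1 => s s'; rewrite -opprD normrN.
    exact: (contp_comp cg cN).
  by move=> s s0; rewrite fg e rmorphN mulNr mulrN.
by apply: (ray_uniq fm sf nsk rh r _ t0); rewrite h0 oppr0 g0.
Qed.

Lemma curveP f th z : curve f th z <-> exists s : R, f.[z] = s%:C * cexp th.
Proof.
split=> [h|[s e]]; last first.
  by rewrite /curve /= e mulrCA cexpNM mulr1.
exists (complex.Re (cexp (- th) * f.[z])).
have -> : (complex.Re (cexp (- th) * f.[z]))%:C = cexp (- th) * f.[z].
  by apply: complex_ext => //=; rewrite h.
by rewrite mulrAC cexpNM mul1r.
Qed.

Lemma lines_disjoint f n th z z' g g' s s' : f \is monic -> size f = n.+2 ->
  nonsing f th -> is_line f th z g -> is_line f th z' g' -> g s = g' s' -> z = z'.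
Proof.
move=> fm sf ns [cg g0 fg] [cg' g0' fg'] e.
have ss : s = s'.
  have := fg s; rewrite e fg' => /(mulIf (cexp_neq0 th)) []; exact: esym.
rewrite -{}ss in e; rewrite -g0 -g0'.
have [s0|/ltW s0] := leP 0 s.
  by apply: (ray_meet fm sf ns (g := g) (h := g') _ _ s0 e); split=> // t _.
have cN : contR (fun t : R => - t).
  by apply: contR_lip1 => t t'; rewrite -opprD normrN.
have ns' : nonsing f (th + pi).
  by apply: nonsing_cexp ns; right; rewrite cexpDpi opprK.
have r x : (forall s, f.[x s] = s%:C * cexp th) -> contp x ->
    is_ray f (th + pi) (fun t => x (- t)).
  move=> fx cx; split; first exact: (contp_comp cx cN).
  by move=> t _; rewrite fx cexpDpi rmorphN mulNr mulrN.
have s0' : 0 <= - s by rewrite oppr_ge0.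
have := ray_meet fm sf ns' (r g fg cg) (r g' fg' cg') s0'.
by rewrite opprK oppr0 => /(_ e).
Qed.

(* Nearby points of the curve with the same value coincide, so a point of the
   curve near the sheet of z lies on that sheet, and conversely. *)
Lemma line_clopen f n th z g x : f \is monic -> size f = n.+2 -> nonsing f th ->
  is_line f th z g -> curve f th x -> exists2 e : R, 0 < e & forall y, curve f th y ->
    nrm (y - x) < e -> (exists s, g s = x) <-> (exists s, g s = y).
Proof.
move=> fm sf ns [cg g0 fg] /curveP[s fx].
have [B hB] := value_bound (`|s| + 1) fm sf.
have [r r0 hr] := sep B sf ns.
have r2 : 0 < r / 2 by rewrite divr_gt0.
have [d d0 hd] := cg s _ r2.
have [L L0 hL] := poly_lipschitz f (nrm x + 1).
pose e := Num.min (Num.min 1 (r / 2)) (Num.min 1 d / L).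
have e0 : 0 < e by rewrite !lt_min ltr01 r2 divr_gt0 // lt_min ltr01.
exists e => // y /curveP[s' fy] yx.
have [y1 y2 y3] : [/\ nrm (y - x) < 1, nrm (y - x) < r / 2 &
    L * nrm (y - x) < Num.min 1 d].
  move: yx; rewrite !lt_min => /andP[/andP[a b] c]; split=> //.
  by move: c; rewrite ltr_pdivlMr // mulrC lt_min.
have ss : `|s' - s| < Num.min 1 d.
  apply: le_lt_trans y3; rewrite -(target_dist _ _ th) -fx -fy; apply: hL.
    by have := nrm_subr y x; lra.
  by lra.
move: ss; rewrite lt_min => /andP[ss1 ss2].
have gg := hd _ ss2.
have sB : `|s| <= `|s| + 1 by rewrite lerDl.
have s'B : `|s'| <= `|s| + 1.
  by rewrite -[s'](subrK s); apply: le_trans (ler_normD _ _) _; lra.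
have xB : nrm x <= B by apply: hB; rewrite fx nrm_target.
have yB : nrm y <= B by apply: hB; rewrite fy nrm_target.
have gB : nrm (g s) <= B by apply: hB; rewrite fg nrm_target.
have g'B : nrm (g s') <= B by apply: hB; rewrite fg nrm_target.
have val u t : f.[u] = t%:C * cexp th -> (exists t', g t' = u) -> g t = u.
  move=> fu [t' gt]; rewrite -gt; congr g; have := fg t'; rewrite gt fu.
  by move/(mulIf (cexp_neq0 th)) => [].
split=> [/(val _ _ fx) gx|/(val _ _ fy) gy].
  exists s'; apply: (hr _ _ s') => //.
  have := nrm_tri (g s') (g s) y; rewrite -gx in y2 *; rewrite (nrmB (g s) y); lra.
exists s; apply: (hr _ _ s) => //.
have := nrm_tri (g s) (g s') x; rewrite (nrmB (g s) (g s')) {2}gy; lra.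
Qed.

Lemma norm_nrm (z : R[i]^o) : `|z| = (nrm z)%:C.
Proof. by rewrite normc_def nrmE. Qed.

Lemma ball_nrm (x y : R[i]^o) (e : R) : ball x e%:C y <-> nrm (x - y) < e.
Proof. by rewrite -ball_normE /ball_ /= norm_nrm ltcR. Qed.

Lemma nbhs_nrm (x : R[i]^o) (A : set R[i]^o) :
  nbhs x A <-> exists2 e : R, 0 < e & forall y, nrm (y - x) < e -> A y.
Proof.
split=> [/nbhs_ballP[e /= e0 h]|[e e0 h]].
  have eE : e = (complex.Re e)%:C.
    by apply: complex_ext => //=; move: e0; rewrite ltcE => /andP[/eqP -> _].
  have e0' : 0 < complex.Re e by move: e0; rewrite eE ltcR.
  exists (complex.Re e) => // y xy; apply: h; rewrite eE; apply/ball_nrm.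
  by rewrite nrmB.
apply/nbhs_ballP; exists e%:C; first by rewrite /= ltcR.
by move=> y /ball_nrm; rewrite nrmB => /h.
Qed.

(** By [line_clopen] the sheet is relatively open and closed in the curve, so a connected K that
    meets it lies in it. *)
Lemma component_sub_line f n th z g (K : set R[i]^o) s : f \is monic ->
  size f = n.+2 -> nonsing f th -> is_line f th z g ->
  is_component (curve f th) K -> K (g s) -> forall x, K x -> exists t, g t = x.
Proof.
move=> fm sf ns lg [x0 cx0 KE] Kg.
have Kc : connected K by rewrite KE; exact: component_connected.
have KA : K `<=` curve f th by rewrite KE; exact: connected_component_sub.
pose S : set R[i]^o := [set x | exists t, g t = x].
suff KS : K `&` S = K by move=> x; rewrite -KS => -[].
apply: Kc.
- by exists (g s); split=> //; exists s.
(* The witness must be open in the plane: adding the complement of the curve and taking the interior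
   leaves the trace on K unchanged. *)
- exists ((S `|` ~` curve f th)°); first exact: open_interior.
  apply/seteqP; split=> x [Kx Sx]; split=> //.
    have [e e0 he] := line_clopen fm sf ns lg (KA _ Kx).
    apply/nbhs_nrm; exists e => // y yx.
    have [cy|ncy] := pselect (curve f th y); last by right.
    by left; apply/(he y cy yx).
  by have := @interior_subset _ _ _ Sx; case=> // /(_ (KA _ Kx)).
- exists (closure S); first exact: closed_closure.
  apply/seteqP; split=> x [Kx Sx]; split=> //; first exact: subset_closure.
  have [e e0 he] := line_clopen fm sf ns lg (KA _ Kx).
  have /Sx[y [Sy yx]] : nbhs (x : R[i]^o) [set y : R[i]^o | nrm (y - x) < e].
    by apply/nbhs_nrm; exists e.
  apply/(he y) => //; case: Sy => t <-; apply/curveP; exists t.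
  by case: lg.
Qed.

End Sheets.

(** * Asymptotes of components and the matching of the curve *)

Section Asymptotes.
Import Order.TTheory GRing.Theory Num.Theory.
Import numFieldNormedType.Exports.
Local Open Scope ring_scope.
Local Open Scope complex_scope.
Local Open Scope classical_set_scope.
Context {R : realType}.
Implicit Types (z u v : R[i]) (f G : {poly R[i]}) (g h : R -> R[i]) (w th : R).

Lemma contp_continuous g : contp g -> continuous (g : R -> R[i]^o).
Proof.
move=> cg t A /nbhs_nrm[e e0 he]; have [d d0 hd] := cg t e e0.
by apply/nbhs_ballP; exists d => // s; rewrite /ball /= distrC => /hd/he.
Qed.

Lemma component_line f th z g : is_line f th z g ->
  forall s, connected_component (curve f th) (z : R[i]^o) (g s).
Proof.
move=> [cg g0 fg] s.
have cz : curve f th z by apply/curveP; exists 0; rewrite -g0 fg.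
have sub : range (g : R -> R[i]^o) `<=` curve f th.
  by move=> _ [t _ <-]; apply/curveP; exists t.
have Bz : range (g : R -> R[i]^o) z by exists 0.
apply: (connected_component_max Bz sub); last by exists s.
apply: connected_continuous_connected.
  by apply/connected_intervalP => x y _ _ t _.
exact/continuous_subspaceT/contp_continuous.
Qed.

Lemma off_dir_rot u (a b : R) : off_dir (cexp b * u) (a + b) = off_dir u a.
Proof.
rewrite /off_dir nrmM nrm_cexp mul1r cexpD.
have -> : cexp b * u - (nrm u)%:C * (cexp a * cexp b) =
  cexp b * (u - (nrm u)%:C * cexp a) by ring.
by rewrite nrmM nrm_cexp mul1r.
Qed.

(** Turning the direction phi to pi / 2 brings the far part of the ray into the upper half plane,
    where [carg] gives arguments that converge as real numbers and not only modulo 2 pi. *)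
Lemma has_asymptote_dir f n psi g (K : set R[i]^o) phi : f \is monic -> size f = n.+2 ->
  is_ray f psi g -> dir g phi -> (forall s, 0 <= s -> K (g s)) -> has_asymptote K phi.
Proof.
move=> fm sf rg dg Kg.
have hpi : 0 < (pi / 2 : R) < pi.
  by rewrite divr_gt0 ?pi_gt0 // ltr_pdivrMr // ltr_pMr ?pi_gt0 // ltr1n.
have pi2 : 0 < pi / 2 :> R by case/andP: hpi.
pose v t := cexp (pi / 2 - phi) * g t.
have offv t : off_dir (v t) (pi / 2) = off_dir (g t) phi.
  by have := off_dir_rot (g t) phi (pi / 2 - phi); rewrite [phi + _]addrC subrK.
have nv t : nrm (v t) = nrm (g t) by rewrite nrmM nrm_cexp mul1r.
have near eta : 0 < eta -> exists T, forall t, T <= t ->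
    0 < complex.Im (v t) /\ `|carg (v t) - pi / 2| < eta.
  move=> eta0; have [e e0 he] := carg_near hpi eta0.
  by have [T hT] := dg e e0; exists T => t /hT; rewrite -offv -nv => /he.
have [T0 hT0] := near _ pi2.
pose tau (m : nat) : R := Num.max T0 0 + m%:R.
have tau0 m : T0 <= tau m /\ 0 <= tau m.
  have h1 : Num.max T0 0 <= tau m by rewrite lerDl.
  by split; apply: le_trans h1; rewrite le_max lexx ?orbT.
have tau_big (A : R) : exists N, forall m, (N <= m)%N -> A <= tau m.
  exists (Num.truncn `|A|).+1 => m Nm; have /andP[_ h] := truncn_itv (normr_ge0 A).
  have h1 : (Num.truncn `|A|).+1%:R <= m%:R :> R by rewrite ler_nat.
  have h2 : m%:R <= tau m by rewrite lerDr le_max lexx orbT.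
  by apply: le_trans (ler_norm A) (le_trans (ltW h) (le_trans h1 h2)).
exists (fun m => nrm (g (tau m))), (fun m => carg (v (tau m)) + (phi - pi / 2)); split.
- move=> m; have [h1 h2] := tau0 m; have [iv _] := hT0 _ h1.
  have [_ ve] := carg_polar iv; split.
    by rewrite -nv nrm_gt0; apply: contraTneq iv => ->; rewrite ltxx.
  suff -> : (nrm (g (tau m)))%:C * cexp (carg (v (tau m)) + (phi - pi / 2)) = g (tau m).
    exact: Kg.
  rewrite cexpD mulrA -nv -ve /v mulrAC -cexpD.
  by have -> : pi / 2 - phi + (phi - pi / 2) = 0 :> R by [ring]; rewrite cexp0 mul1r.
- apply/cvgryPge => A; have [T hT] := ray_large A fm sf rg.
  have [N hN] := tau_big T; exists N => // m /= Nm; apply: hT; exact: hN.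
- apply/cvgrPdist_lt => e e0; have [T hT] := near e e0.
  have [N hN] := tau_big T; exists N => // m /= Nm.
  have [_ h] := hT _ (hN _ Nm); rewrite distrC.
  suff -> : carg (v (tau m)) + (phi - pi / 2) - phi = carg (v (tau m)) - pi / 2 by [].
  ring.
Qed.

Lemma asymptote_point (K : set R[i]^o) phi (e B : R) : has_asymptote K phi -> 0 < e ->
  exists x, [/\ K x, B <= nrm x & off_dir x phi < e * nrm x].
Proof.
move=> [r [t [h hr ht]]] e0.
have [d d0 hd] := cexp_cont phi e0.
have /cvgryPge/(_ B)[N1 _ h1] := hr.
have /cvgrPdist_lt/(_ d d0)[N2 _ h2] := ht.
pose m := maxn N1 N2; have [r0 Kx] := h m.
have nx : nrm ((r m)%:C * cexp (t m)) = r m by rewrite nrm_target gtr0_norm.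
exists ((r m)%:C * cexp (t m)); split=> //.
  by rewrite nx; apply: h1; rewrite /= leq_maxl.
rewrite /off_dir nx -mulrBr nrmM nrm_real gtr0_norm // mulrC ltr_pM2r //.
by apply: hd; rewrite distrC; apply: h2; rewrite /= leq_maxr.
Qed.

(** The asymptote only provides isolated points of K. Such a point, far out and near the direction
    phi, has a value t e^(i psi) with t large, so [far_inj] identifies it with the point h t of the
    ray, which lies on the sheet. *)
Lemma asymptote_hits f n th k z g (K : set R[i]^o) : f \is monic -> size f = n.+2 ->
  nonsing f th -> K `<=` curve f th -> is_line f th z g ->
  reach f n.+1 z (th + pi * k%:R) ->
  has_asymptote K ((th + pi * k%:R) / n.+1%:R) -> exists s, K (g s).
Proof.
move=> fm sf ns KA lg [h [rh h0 dh]] hK; set phi := _ / _ in dh hK.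
set psi := th + pi * k%:R in rh phi dh hK.
have [e1 e10 [m0 inj]] := far_inj fm sf.
have [L L0 hL] := @poly_lipschitz R 'X^(n.+1) 1.
have q0 : 0 < 1 / 4 :> R by rewrite divr_gt0.
have [rho r1 hr] := monic_growth fm sf q0.
have [T1 hT1] := dh e1 e10; have [T2 hT2] := ray_large m0 fm sf rh.
(* L is a Lipschitz constant of the power on the unit disc, so 1 / (4 L) bounds the relative
   deviation of x^(n+1) by a quarter; with the quarter from [rho] this gives t >= |x|^(n+1) / 2. *)
pose e := Num.min e1 (1 / (4 * L)).
have e0 : 0 < e by rewrite lt_min e10 divr_gt0 // mulr_gt0.
have ee1 : e <= e1 by rewrite ge_min lexx.
have eL : L * e <= 1 / 4.
  have : L * e <= L * (1 / (4 * L)) by rewrite ler_pM2l // ge_min lexx orbT.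
  by have -> : L * (1 / (4 * L)) = 1 / 4 by field; rewrite gt_eqF.
clearbody e.
pose T := Num.max (Num.max T1 T2) 0.
have [x [Kx xB xo]] := asymptote_point (Num.max m0 (Num.max rho (2 * T + 1))) hK e0.
move: xB; rewrite !ge_max => /and3P[x1 x2 x3].
have x1' : 1 <= nrm x by apply: le_trans x2.
have x0 : 0 < nrm x by lra.
have xn0 : 0 < nrm x ^+ n.+1 by rewrite exprn_gt0.
have [s fx] : exists s : R, f.[x] = s%:C * cexp th by apply/curveP/KA.
have [t ft] : exists t : R, f.[x] = t%:C * cexp psi.
  case: (cexp_pin th k) => ce; [exists s|exists (- s)]; rewrite /psi ce fx //.
  by rewrite rmorphN mulrNN.
have pn : cexp phi ^+ n.+1 = cexp psi by rewrite cexpX divfK // pnatr_eq0.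
have h1 := hr x x2.
have h2 : nrm (x ^+ n.+1 - (nrm x ^+ n.+1)%:C * cexp psi) <= 1 / 4 * nrm x ^+ n.+1.
  have xC : (nrm x)%:C != 0 :> R[i] by rewrite -nrm_gt0 nrm_real normr_gt0 gt_eqF.
  pose u := x / (nrm x)%:C; have xu : x = (nrm x)%:C * u by rewrite mulrC divfK.
  have nu : nrm u = 1 by rewrite nrmM nrmV nrm_real gtr0_norm // divff // gt_eqF.
  have := hL u (cexp phi); rewrite nu nrm_cexp => /(_ (lexx _) (lexx _)).
  rewrite !hornerXn pn => hq; rewrite {1}xu exprMn -rmorphXn -mulrBr nrmM nrm_real.
  rewrite (gtr0_norm xn0) mulrC ler_pM2r //; apply: le_trans hq _; apply: le_trans eL.
  rewrite ler_pM2l //; apply: ltW; rewrite -(ltr_pM2r x0); apply: le_lt_trans xo.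
  rewrite /off_dir {2}xu -mulrBr nrmM nrm_real (gtr0_norm x0) mulrC //.
have h3 : `|t - nrm x ^+ n.+1| <= nrm x ^+ n.+1 / 2.
  rewrite -(target_dist _ _ psi) -ft; apply: le_trans (nrm_tri _ (x ^+ n.+1) _) _; lra.
have xn : nrm x <= nrm x ^+ n.+1 by rewrite exprS ler_peMr ?exprn_ege1 // ltW.
have tT : T <= t by move: h3; rewrite ler_norml => /andP[]; lra.
have [t1 t2 t0] : [/\ T1 <= t, T2 <= t & 0 <= t].
  by split; apply: le_trans tT; rewrite !le_max lexx ?orbT.
have xh : x = h t.
  apply: (inj _ _ phi) => //; first exact: hT2.
  - by apply: lt_le_trans xo _; rewrite ler_pM2r.
  - exact: hT1.
  - by rewrite ft (proj2 rh).
have [s' hs] := line_ray fm sf ns lg rh h0 t0.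
by exists s'; rewrite -hs -xh.
Qed.

Lemma label_inj n (th : R) k k' : (k < 2 * n.+1)%N -> (k' < 2 * n.+1)%N ->
  cexp ((th + pi * k%:R) / n.+1%:R) = cexp ((th + pi * k'%:R) / n.+1%:R) -> k = k'.
Proof.
wlog kk : k k' / (k <= k')%N.
  move=> W kN kN' e; have [h|/ltnW h] := leqP k k'; first exact: W.
  by apply/esym/W.
move=> kN k'N e; have N0 : 0 < n.+1%:R :> R by rewrite ltr0n.
have p0 := pi_gt0 R.
have kE : k'%:R = k%:R + (k' - k)%:R :> R by rewrite -natrD subnKC.
have : cexp (pi * (k' - k)%:R / n.+1%:R) = 1 :> R[i].
  apply: (mulIf (cexp_neq0 ((th + pi * k%:R) / n.+1%:R))); rewrite mul1r -cexpD [RHS]e.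
  by congr cexp; rewrite kE; field; rewrite gt_eqF.
move=> /cexp_eq1 h; have {}h : pi * (k' - k)%:R / n.+1%:R = 0 :> R.
  apply: h; rewrite divr_ge0 ?mulr_ge0 ?(ltW p0) //= ltr_pdivrMr //.
  rewrite (mulrC 2) -mulrA ltr_pM2l // -natrM ltr_nat; apply: leq_ltn_trans k'N.
  exact: leq_subr.
move/eqP: h; rewrite !mulf_eq0 invr_eq0 (gt_eqF p0) (gt_eqF N0) orbF /= pnatr_eq0.
by rewrite subn_eq0 => k'k; apply/eqP; rewrite eqn_leq kk k'k.
Qed.

Lemma cexp_pin_odd th k : cexp (th + pi * k%:R) = (if odd k then -1 else 1) * cexp th.
Proof.
elim: k => [|k IH]; first by rewrite mulr0 addr0 mul1r.
rewrite -[k.+1%:R]natr1 mulrDr mulr1 addrA cexpDpi IH oddS.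
by case: odd => /=; rewrite ?mulN1r ?mul1r ?opprK.
Qed.

Lemma label_unique f n th z k k' : f \is monic -> size f = n.+2 -> nonsing f th ->
  (k < 2 * n.+1)%N -> (k' < 2 * n.+1)%N -> odd k = odd k' ->
  reach f n.+1 z (th + pi * k%:R) -> reach f n.+1 z (th + pi * k'%:R) -> k = k'.
Proof.
move=> fm sf ns kN k'N o r r'.
apply: (label_inj kN k'N (reach_label fm sf (@nonsing_label _ _ _ k ns) _ r r')).
by rewrite !cexp_pin_odd o.
Qed.

(* The partner of a label k is determined, since a root reaches at most one
   label of each parity. *)
Lemma curve_matching_realized f n th (p : nat -> nat) : f \is monic -> size f = n.+2 ->
  pairing (2 * n.+1) p -> realizes f n.+1 th p ->
  forall B : {set 'I_(2 * n.+1)}, B \in curve_matching n.+1 f th <->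
    exists k k' : 'I_(2 * n.+1), [/\ k' = p k :> nat & B = [set k; k']%SET].
Proof.
move=> fm sf pp [ns H] B.
have angE k : asymptote_angle n.+1 th k = (th + pi * k%:R) / n.+1%:R.
  by rewrite /asymptote_angle addrC.
have asym z g k : is_line f th z g -> reach f n.+1 z (th + pi * k%:R) ->
    has_asymptote (connected_component (curve f th) (z : R[i]^o)) (asymptote_angle n.+1 th k).
  move=> lg [h [rh h0 dh]]; rewrite angE.
  apply: (has_asymptote_dir fm sf rh dh) => s s0.
  have [s' ->] := line_ray fm sf ns lg rh h0 s0; exact: component_line.
rewrite inE; split=> [/asboolP[k [k' [kk -> [K [cK ak ak']]]]]|[k [k' [kE ->]]]]; last first.
  apply/asboolP; exists k, k'; split=> //.
    by move=> e; case: (pp k (ltn_ord k)) => _; rewrite -kE e.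
  have [z [r r']] := H k (ltn_ord k); have fz := reach_root r.
  have [g lg] := line_exists fm sf ns fz.
  exists (connected_component (curve f th) (z : R[i]^o)); split.
  - exists z => //; apply/curveP; exists 0; by rewrite fz mul0r.
  - exact: asym lg r.
  - by rewrite kE; apply: asym lg r'.
exists k, k'; split=> //.
have KA : K `<=` curve f th by case: cK => x _ ->; exact: connected_component_sub.
have [z [rz rz']] := H k (ltn_ord k); have [u [ru _]] := H k' (ltn_ord k').
have [g lg] := line_exists fm sf ns (reach_root rz).
have [h lh] := line_exists fm sf ns (reach_root ru).
rewrite angE in ak; rewrite angE in ak'.
have [s Ks] := asymptote_hits fm sf ns KA lg rz ak.
have [s' Ks'] := asymptote_hits fm sf ns KA lh ru ak'.
have [t gt] := component_sub_line fm sf ns lg cK Ks Ks'.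
have zu : z = u := lines_disjoint fm sf ns lg lh gt.
rewrite -{u}zu in ru lh *; have [pN pk _] := pp k (ltn_ord k).
have ok : odd k' <> odd k.
  by move=> o; apply: kk; apply/val_inj/esym; apply: (label_unique fm sf ns _ _ o ru rz).
have opk : odd (p k) <> odd k.
  by move=> o; apply: pk; apply: (label_unique fm sf ns _ _ o rz' rz).
apply: (label_unique fm sf ns _ _ _ ru rz') => //.
by move: ok opk; case: (odd k'); case: (odd k); case: (odd (p k)).
Qed.

End Asymptotes.

(** * Constancy between singular angles and their count *)

Section SingularAngles.
Import Order.TTheory GRing.Theory Num.Theory.
Local Open Scope ring_scope.
Local Open Scope complex_scope.
Context {R : realType}.
Implicit Types (z u v : R[i]) (f G : {poly R[i]}) (g h : R -> R[i]) (w th : R).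

(** The indicator of P is continuous and never takes the value 1 / 2. *)
Lemma locally_constant (P : R -> Prop) (a b : R) : a <= b ->
  (forall t, exists2 d, 0 < d & forall s, `|s - t| < d -> (P s <-> P t)) ->
  P a -> P b.
Proof.
move=> ab H Pa; pose x (t : R) : R := if `[< P t >] then 0 else 1.
have cx : contR x.
  move=> t e e0; have [d d0 hd] := H t; exists d => // s /hd st.
  by rewrite /x (asbool_equiv_eq st) subrr normr0.
have x12 t : x t <> 1 / 2 by rewrite /x; case: asboolP => _ h; lra.
have xa : x a < 1 / 2 by rewrite /x asboolT //; lra.
have := avoid_lt cx ab (fun t _ => @x12 t) xa.
by rewrite /x; case: asboolP => // _; lra.
Qed.

Lemma reach_const f n z k (a b : R) : f \is monic -> size f = n.+2 -> a <= b ->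
  (forall th, a <= th <= b -> nonsing f th) -> f.[z] = 0 ->
  (reach f n.+1 z (a + pi * k%:R) <-> reach f n.+1 z (b + pi * k%:R)).
Proof.
move=> fm sf ab ns fz; pose cl (t : R) := Num.min (Num.max t a) b.
have clP t : a <= cl t <= b.
  by rewrite /cl le_min ge_min le_max lexx !orbT ab lexx orbT.
have ccl s t : `|cl s - cl t| <= `|s - t|.
  by apply: le_trans (lip1_min _ _ _) (lip1_max _ _ _).
have cla : cl a = a by rewrite /cl maxxx (elimT min_idPl).
have clb : cl b = b by rewrite /cl (elimT max_idPl) // minxx.
clearbody cl.
have loc t : exists2 d, 0 < d & forall s, `|s - t| < d ->
    (reach f n.+1 z (cl s + pi * k%:R) <-> reach f n.+1 z (cl t + pi * k%:R)).
  have nst := @nonsing_label _ _ _ k (ns _ (clP t)).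
  have [rt|nrt] := pselect (reach f n.+1 z (cl t + pi * k%:R)).
    have [d d0 hd] := reach_open fm sf nst rt; exists d => // s st; split=> // _.
    apply: hd; apply: le_lt_trans st; apply: le_trans (ccl s t).
    by rewrite le_eqVlt; apply/orP; left; apply/eqP; congr `|_|; ring.
  (* Failure to reach the label is open as well: z then reaches another label of the same parity,
     which persists nearby, and it cannot reach both. *)
  have [l ln rl] := reach_exists fm sf nst fz.
  have cl2 (x : R) : cexp (x + 2 * pi * l%:R) = cexp x by rewrite cexpD2pin.
  have nst2 : nonsing f (cl t + pi * k%:R + 2 * pi * l%:R).
    by apply: nonsing_cexp nst; left.
  have [d d0 hd] := reach_open fm sf nst2 rl; exists d => // s st; split=> // rs.
  have rsl : reach f n.+1 z (cl s + pi * k%:R + 2 * pi * l%:R).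
    apply: hd; apply: le_lt_trans st; apply: le_trans (ccl s t).
    by rewrite le_eqVlt; apply/orP; left; apply/eqP; congr `|_|; ring.
  have nss := @nonsing_label _ _ _ k (ns _ (clP s)).
  have e : cexp ((cl s + pi * k%:R + pi * 0%:R) / n.+1%:R) =
      cexp ((cl s + pi * k%:R + pi * (2 * l)%:R) / n.+1%:R).
    rewrite mulr0 addr0 (reach_label fm sf nss (esym (cl2 _)) rs rsl).
    by congr (cexp (_ / _)); rewrite natrM; ring.
  have l0 : l = 0%N.
    have : 0%N = (2 * l)%N by apply: (label_inj _ _ e); rewrite // ltn_pmul2l.
    by clear; lia.
  by move: rl; rewrite l0 mulr0 addr0.
split=> r.
  have := locally_constant ab loc; rewrite cla clb; exact.
have loc' t : exists2 d, 0 < d & forall s, `|s - t| < d ->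
    (~ reach f n.+1 z (cl s + pi * k%:R) <-> ~ reach f n.+1 z (cl t + pi * k%:R)).
  have [d d0 hd] := loc t; exists d => // s /hd [h1 h2].
  by split=> nr r'; apply: nr; [exact: h2|exact: h1].
have := locally_constant ab loc'; rewrite cla clb => h.
by apply: contrapT => /h; exact.
Qed.

Lemma realizes_const f n p (a b : R) : f \is monic -> size f = n.+2 -> a <= b ->
  (forall th, a <= th <= b -> nonsing f th) ->
  (realizes f n.+1 a p <-> realizes f n.+1 b p).
Proof.
move=> fm sf ab ns; have [na nb] : nonsing f a /\ nonsing f b.
  by split; apply: ns; rewrite lexx ab.
split=> -[_ H]; split=> // k /H[z [r1 r2]]; exists z; have fz := reach_root r1;
  by split; apply/(reach_const _ fm sf ab ns fz).
Qed.

Lemma realizes_unique f n th p q : f \is monic -> size f = n.+2 ->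
  pairing (2 * n.+1) p -> pairing (2 * n.+1) q ->
  realizes f n.+1 th p -> realizes f n.+1 th q ->
  forall k, (k < 2 * n.+1)%N -> p k = q k.
Proof.
move=> fm sf pp pq [ns Hp] [_ Hq] k kN.
have [z [r1 r2]] := Hp k kN; have [z' [r1' r2']] := Hq k kN.
have e := reach_inj fm sf (@nonsing_label _ _ _ k ns) r1 r1'.
rewrite -{z'}e in r1' r2'.
have [pN pk _] := pp k kN; have [qN qk _] := pq k kN.
have o1 : odd (p k) <> odd k by move=> o; apply: pk; apply: (label_unique fm sf ns _ _ o r2 r1).
have o2 : odd (q k) <> odd k by move=> o; apply: qk; apply: (label_unique fm sf ns _ _ o r2' r1).
apply: (label_unique fm sf ns _ _ _ r2 r2') => //.
by move: o1 o2; case: (odd k); case: (odd (p k)); case: (odd (q k)).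
Qed.

(** Without a singular angle in between, the matching at eta s would persist up to the next sample,
    where f determines it; but the flip has changed the partner of w. *)
Lemma gap_singular f n (p : nat -> nat -> nat) eta s : pnecklace n.+1 p ->
  sampled f n p eta -> (s < n)%N -> exists2 sg, eta s < sg < eta s.+1 & ~ nonsing f sg.
Proof.
move=> [pn fl _] [fm sf rf inc] sn; apply: contrapT => H.
have sn1 : (s < n.+1)%N by apply: ltnW.
have [_ r1] := rf s sn1; have [_ r2] := rf s.+1 sn.
have ns th : eta s <= th <= eta s.+1 -> nonsing f th.
  move=> /andP[]; rewrite le_eqVlt => /predU1P[<- _|h1]; first by case: r1.
  rewrite le_eqVlt => /predU1P[->|h2]; first by case: r2.
  by apply: contrapT => h; apply: H; exists th => //; rewrite h1.
have r1' := (proj1 (realizes_const (p s) fm sf (ltW (inc s sn)) ns)) r1.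
have [[pp _] [pq _]] := (pn s sn1, pn s.+1 sn).
have [w [x [y [z [[wN _ _ _] [pw _ qw _] c _ _]]]]] := fl s sn.
have := realizes_unique fm sf pp pq r1' r2 wN; rewrite pw qw => e.
by move: c; rewrite e /cyc; clear; lia.
Qed.

Lemma singular_angle_unique (F : R[i]) (a b : R) : F != 0 ->
  0 <= a < pi -> 0 <= b < pi -> complex.Im (cexp (- a) * F) = 0 ->
  complex.Im (cexp (- b) * F) = 0 -> a = b.
Proof.
move=> F0; wlog ab : a b / a <= b.
  by move=> W ha hb ia ib; have [h|/ltW h] := leP a b; [apply: W|apply/esym/W].
move=> /andP[a0 ap] /andP[b0 bp] ia ib.
apply/eqP; rewrite eq_le ab leNgt; apply/negP => ltab.
pose r := complex.Re (cexp (- a) * F).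
have rE : r%:C = cexp (- a) * F by apply: complex_ext => //=; rewrite ia.
have FE : F = r%:C * cexp a by rewrite rE mulrAC cexpNM mul1r.
have r0 : r != 0 by apply: contraNneq F0; rewrite FE => ->; rewrite mul0r.
move: ib; rewrite FE mulrCA ImZ -cexpD cexp_Im => /eqP; rewrite mulf_eq0 (negPf r0) /=.
rewrite -oppr_eq0 -sinN opprD opprK gt_eqF //; apply: sin_gt0_pi.
by move: ltab a0 bp; move: pi => c *; apply/andP; split; lra.
Qed.

Lemma singular_angles_sampled f n (p : nat -> nat -> nat) eta : pnecklace n.+1 p ->
  sampled f n p eta -> exists sg : nat -> R,
    (forall s, (s < n)%N -> eta s < sg s < eta s.+1) /\
    (forall th, 0 <= th < pi -> ~ nonsing f th <-> exists2 s, (s < n)%N & th = sg s).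
Proof.
move=> pn sf'; have [fm sf rf inc] := sf'.
have crit th : ~ nonsing f th -> exists c, root f^`() c /\ complex.Im (cexp (- th) * f.[c]) = 0.
  move=> h; apply: contrapT => H; apply: h => c rc im; apply: H; by exists c.
have [S HS] : {S : nat -> R * R[i] & forall s, (s < n)%N ->
    [/\ eta s < (S s).1 < eta s.+1, root f^`() (S s).2 &
      complex.Im (cexp (- (S s).1) * f.[(S s).2]) = 0]}.
  apply: (@boolp.choice _ _ (fun s x => (s < n)%N ->
    [/\ eta s < x.1 < eta s.+1, root f^`() x.2 & complex.Im (cexp (- x.1) * f.[x.2]) = 0])) => s.
  have [sn|ns] := boolP (s < n)%N; last by exists (0, 0).
  have [sg h1 h2] := gap_singular pn sf' sn; have [c [rc ic]] := crit sg h2.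
  by exists (sg, c).
pose sg s := (S s).1; pose c s := (S s).2.
have fc0 z : root f^`() z -> f.[z] != 0.
  move=> rz; apply/eqP => fz; have [_ [ns _]] := rf 0%N isT.
  by apply: (ns z rz); rewrite fz mulr0.
have eta_le s s' : (s <= s')%N -> (s' < n.+1)%N -> eta s <= eta s'.
  elim: s' => [|s' IH]; first by rewrite leqn0 => /eqP ->.
  rewrite leq_eqVlt => /predU1P[->//|]; rewrite ltnS => ss' sn.
  by apply: le_trans (IH ss' (ltnW sn)) (ltW (inc _ sn)).
have sgP s : (s < n)%N -> 0 <= sg s < pi.
  move=> sn; have [/andP[h1 h2] _ _] := HS s sn.
  have [/andP[e1 _] _] := rf s (ltnW sn); have [/andP[_ e2] _] := rf s.+1 sn.
  by rewrite (ltW (lt_trans e1 h1)) (lt_trans h2 e2).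
have sg_lt s s' : (s < s')%N -> (s' < n)%N -> sg s < sg s'.
  move=> ss' sn'; have [/andP[_ h2] _ _] := HS s (ltn_trans ss' sn').
  have [/andP[h1 _] _ _] := HS s' sn'.
  by apply: lt_trans h2 (le_lt_trans (eta_le _ _ ss' (ltnW sn')) h1).
have c_inj s s' : (s < n)%N -> (s' < n)%N -> c s = c s' -> s = s'.
  move=> sn sn' e; have [_ r1 i1] := HS s sn; have [_ r2 i2] := HS s' sn'.
  rewrite -/(c s') -e in i2.
  have := singular_angle_unique (fc0 _ r1) (sgP s sn) (sgP s' sn') i1 i2.
  have [h|h|//] := ltngtP s s'.
    by have := sg_lt _ _ h sn' => /lt_eqF /eqP.
  by have := sg_lt _ _ h sn => /gt_eqF /eqP.
have f'0 := deriv_neq0 sf.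
have [rs pE] := closed_field_poly_normal f^`().
have rsP r : root f^`() r = (r \in rs).
  by rewrite {1}pE rootZ ?root_prod_XsubC // lead_coef_eq0.
have srs : (size rs <= n)%N.
  have : (size f^`() < size f)%N by rewrite lt_size_deriv // -size_poly_gt0 sf.
  by rewrite {1}pE size_scale ?lead_coef_eq0 // size_prod_XsubC sf.
have uc : uniq (map c (iota 0 n)).
  rewrite map_inj_in_uniq ?iota_uniq // => s s'; rewrite !mem_iota /= !add0n.
  exact: c_inj.
have sub : {subset map c (iota 0 n) <= rs}.
  move=> r /mapP[s]; rewrite mem_iota /= add0n => sn ->; rewrite -rsP.
  by case: (HS s sn).
(* The n critical points found in the gaps are distinct and f' has at most n roots, so they are all
   of them. *)
have [|_ eqm] := uniq_min_size uc sub; first by rewrite size_map size_iota.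
exists sg; split; first by move=> s sn; case: (HS s sn).
move=> th thP; split=> [/crit[z [rz iz]]|[s sn ->] ns].
  move: (rz); rewrite rsP -eqm => /mapP[s]; rewrite mem_iota /= add0n => sn e.
  exists s => //; have [_ _ i1] := HS s sn; rewrite -/(c s) -e in i1.
  exact: singular_angle_unique (fc0 _ rz) thP (sgP s sn) iz i1.
by have [_ rc ic] := HS s sn; exact: ns rc ic.
Qed.

End SingularAngles.

(** * From set partitions to partner functions *)

Section Partner.
Local Open Scope nat_scope.
Context {N : nat}.
Implicit Types (M : {set {set 'I_N}}) (x y : 'I_N).

(** For a matching and a label below N, neither of the defaults [x] and 0 is taken. *)
Definition partner M (i : nat) : nat :=
  if insub i is Some x
  then nat_of_ord (odflt x [pick y : 'I_N | (y != x) && ([set x; y]%SET \in M)])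
  else 0.

Lemma matching_unique M x y y' : is_matching M -> [set x; y]%SET \in M ->
  [set x; y']%SET \in M -> y' != x -> y' = y.
Proof.
move=> [/and3P[_ tr _] _] h h' yx.
have x1 : x \in [set x; y]%SET by rewrite !finset.inE eqxx.
have x2 : x \in [set x; y']%SET by rewrite !finset.inE eqxx.
have e : [set x; y']%SET = [set x; y]%SET.
  by rewrite -(def_pblock tr h x1) (def_pblock tr h' x2).
have : y' \in [set x; y]%SET by rewrite -e !finset.inE eqxx orbT.
by rewrite !finset.inE (negPf yx) /= => /eqP.
Qed.

Lemma partner_spec M x : is_matching M ->
  exists y, [/\ y != x, [set x; y]%SET \in M & partner M x = y].
Proof.
move=> hM; have [/and3P[/eqP cov tr n0] c2] := hM.
have xc : x \in finset.cover M by rewrite cov finset.in_setT.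
have BM := pblock_mem xc; have := c2 _ BM => /eqP/cards2P[a [b [ab BE]]].
have [y [yx yM]] : exists y, y != x /\ [set x; y]%SET \in M.
  have : x \in finset.pblock M x by rewrite mem_pblock.
  rewrite BE !finset.inE => /orP[]/eqP e; subst x.
    by exists b; rewrite -BE eq_sym.
  by exists a; rewrite finset.setUC -BE.
rewrite /partner valK; case: pickP => [y' /andP[y'x y'M]|/(_ y)]; last by rewrite yx yM.
by exists y'.
Qed.

Lemma partner_eq M x y : is_matching M -> y != x -> [set x; y]%SET \in M ->
  partner M x = y.
Proof.
move=> hM yx yM; have [y' [y'x y'M ->]] := partner_spec x hM.
by rewrite (matching_unique hM yM y'M y'x).
Qed.

Lemma block_neq M x y : is_matching M -> [set x; y]%SET \in M -> y != x.
Proof.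
by move=> [_ c2] /c2; rewrite cards2 eq_sym; case: eqP.
Qed.

Lemma block_partner M B : is_matching M -> B \in M ->
  exists x y, B = [set x; y]%SET /\ partner M x = y.
Proof.
move=> hM BM; have [_ c2] := hM.
have := c2 _ BM => /eqP/cards2P[a [b [ab BE]]]; exists a, b; split=> //.
by apply: partner_eq; rewrite // -?BE // eq_sym.
Qed.

Lemma pairing_partner M : is_matching M -> pairing N (partner M).
Proof.
move=> hM i iN; have [y [yx yM e]] := partner_spec (Ordinal iN) hM.
rewrite /= in e; rewrite e; split=> //.
  by move=> ye; move/eqP: yx; apply; apply: val_inj.
rewrite (@partner_eq _ y (Ordinal iN)) // 1?eq_sym //.
by rewrite finset.setUC.
Qed.

Lemma planar_partner M : is_matching M -> noncrossing M -> planar N (partner M).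
Proof.
move=> hM nc i j iN jN ij jpi.
have [x [xi xM ex]] := partner_spec (Ordinal iN) hM.
have [y [yj yM ey]] := partner_spec (Ordinal jN) hM.
rewrite /= in ex ey; rewrite ex in jpi *; rewrite ey.
have [pi pj] := (pairing_partner hM iN, pairing_partner hM jN).
rewrite ex in pi; rewrite ey in pj; have [_ _ px] := pi; have [_ _ py] := pj.
have ne : [set Ordinal iN; x]%SET <> [set Ordinal jN; y]%SET.
  move=> e; have : Ordinal jN \in [set Ordinal iN; x]%SET.
    by rewrite e !finset.inE eqxx.
  by rewrite !finset.inE => /orP[]/eqP/(congr1 val) /= h; move: ij jpi; rewrite h ltnn.
have ni : y <> i :> nat by move=> e; move: py; rewrite e ex => h; move: jpi; rewrite h ltnn.
have nx : y <> x :> nat by move=> e; move: py; rewrite e px => h; move: ij; rewrite h ltnn.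
have in1 (u v : 'I_N) : u \in [set u; v]%SET by rewrite !finset.inE eqxx.
have in2 (u v : 'I_N) : v \in [set u; v]%SET by rewrite !finset.inE eqxx orbT.
split.
  rewrite ltnNge; apply/negP => yi.
  apply: (nc _ _ yM xM); first by move/esym.
  exists y, (Ordinal iN), (Ordinal jN), x; split; last by split; rewrite ?in1 ?in2.
  by split=> //=; rewrite ltn_neqAle yi andbT; apply/eqP.
rewrite ltnNge; apply/negP => yi; apply: (nc _ _ xM yM) => //.
exists (Ordinal iN), (Ordinal jN), x, y; split; last by split; rewrite ?in1 ?in2.
by split=> //=; rewrite ltn_neqAle yi andbT; apply/eqP => /esym.
Qed.

Lemma flipped_partner M M' : is_matching M -> noncrossing M -> is_matching M' ->
  noncrossing M' -> is_flip M M' -> flipped N (partner M) (partner M').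
Proof.
move=> hM nc hM' nc' [i [j [k [l [ijM klM ne ME]]]]].
have ilM : [set i; l]%SET \in M' by rewrite ME !finset.inE eqxx orbT.
have jkM : [set j; k]%SET \in M' by rewrite ME !finset.inE eqxx !orbT.
have [ji lk] := (block_neq hM ijM, block_neq hM klM).
have [li kj] := (block_neq hM' ilM, block_neq hM' jkM).
have ik : i != k.
  apply/negP => /eqP e; apply: ne; rewrite -e in klM *.
  by rewrite (matching_unique hM ijM klM) // e.
have [pi pk] := (partner_eq hM ji ijM, partner_eq hM lk klM).
have [qi qj] := (partner_eq hM' li ilM, partner_eq hM' kj jkM).
have inj (u v : 'I_N) : u != v -> (u <> v :> nat) by move=> /eqP h e; apply: h; exact: val_inj.
apply: (@flipped_intro N (partner M) (partner M') i j k l) => //;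
  [exact: pairing_partner|exact: planar_partner|exact: pairing_partner
  |exact: planar_partner|exact: inj|by apply: inj; rewrite eq_sym|].
move=> x xN xi xj xk xl; have [y [yx yM e]] := partner_spec (Ordinal xN) hM.
rewrite /= in e; rewrite e; apply: (@partner_eq M' (Ordinal xN)) => //.
have nin (u v : 'I_N) : x <> u -> x <> v -> [set Ordinal xN; y]%SET != [set u; v]%SET.
  move=> xu xv; apply/eqP => e'; have : Ordinal xN \in [set u; v]%SET.
    by rewrite -e' !finset.inE eqxx.
  by rewrite !finset.inE => /orP[]/eqP/(congr1 val).
by rewrite ME 2!finset.inE yM andbT !finset.inE negb_or !nin.
Qed.

End Partner.

Lemma add_modN1 N (x : 'I_N) : add_mod (-1) x = dn N x :> nat.
Proof.
have xN := ltn_ord x; rewrite /add_mod /= /dn; case: eqP => [->|x0].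
  have -> : ((0%:Z + -1) = (-1) * N%:Z + (N.-1)%:Z)%R by lia.
  by rewrite modzMDl modz_small //; lia.
have -> : (x%:Z + -1 = x.-1%:Z)%R by lia.
by rewrite modz_small //; lia.
Qed.

Lemma pnecklace_partner n (M : n.-tuple {set {set 'I_(2 * n)}}) : 0 < n -> necklace M ->
  pnecklace n (fun s => partner (nth finset.set0 M s)).
Proof.
move=> n0 [hM fl rot]; split.
- move=> s /hM[h1 h2]; split; [exact: pairing_partner|exact: planar_partner].
- move=> s sn; have [h1 h2] := hM s (ltnW sn); have [h3 h4] := hM _ sn.
  by apply: flipped_partner => //; apply: fl.
- move=> i iN; have [m0 _] := hM 0 n0.
  have nn : n.-1 < n by rewrite prednK.
  have [m1 _] := hM _ nn; have uN := up_lt iN.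
  have [y [yx yM e]] := partner_spec (Ordinal uN) m0; rewrite /= in e; rewrite e.
  have ui : add_mod (-1) (Ordinal uN) = Ordinal iN.
    by apply: val_inj; rewrite /= -[LHS]/(nat_of_ord (add_mod (-1) (Ordinal uN))) add_modN1 upK.
  rewrite -(add_modN1 y); apply: (@partner_eq _ _ (Ordinal iN)) => //.
    rewrite -ui; apply: contraNneq yx => h; apply/eqP/val_inj.
    have h' : dn (2 * n) y = dn (2 * n) (Ordinal uN) by rewrite -!add_modN1 h.
    by rewrite /= -[LHS](dnK (ltn_ord y)) h' dnK.
  rewrite rot; apply/finset.imsetP; exists [set Ordinal uN; y]%SET => //.
  by rewrite finset.imsetU !finset.imset_set1 ui.
Qed.

(** * From samples to the necklace of the polynomial *)

Section GenericPolynomial.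
Import Order.TTheory GRing.Theory Num.Theory.
Local Open Scope ring_scope.
Local Open Scope complex_scope.
Local Open Scope classical_set_scope.
Context {R : realType}.
Implicit Types (z : R[i]) (f : {poly R[i]}) (th : R).

Lemma curve_matching_partner f n th (M : {set {set 'I_(2 * n.+1)}}) :
  f \is monic -> size f = n.+2 -> is_matching M ->
  realizes f n.+1 th (partner M) -> curve_matching n.+1 f th = M.
Proof.
move=> fm sf hM r; apply/finset.setP => B.
have P := curve_matching_realized fm sf (pairing_partner hM) r B.
apply/idP/idP => [/P[k [k' [e ->]]]|BM].
  have [y [_ yM ey]] := partner_spec k hM; rewrite ey in e.
  by rewrite (val_inj e).
by apply/P; have [x [y [-> e]]] := block_partner hM BM; exists x, y.
Qed.

Lemma singularP f th : singular_curve f th <-> ~ nonsing f th.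
Proof.
split=> [[z cz rz] ns|h]; first exact: ns rz cz.
by apply: contrapT => H; apply: h => c rc im; apply: H; exists c.
Qed.

(** A multiple root is a critical point with value 0, and such a point lies on the curve at every
    angle. *)
Lemma nonsing_simple_roots f th z : nonsing f th -> f != 0 -> (mup z f <= 1)%N.
Proof.
move=> ns f0; rewrite leqNgt; apply/negP; rewrite mup_geq // => /dvdpP[q fE].
have fz : f.[z] = 0 by rewrite fE hornerM horner_exp hornerXsubC subrr expr0n mulr0.
apply: (ns z); last by rewrite fz mulr0.
by rewrite rootE fE expr2 !derivM derivXsubC; rewrite !mulr1 !mul1r !(hornerD, hornerM, hornerN, hornerX, hornerC) subrr; apply/eqP; ring.
Qed.

Lemma sampled_generic f n (p : nat -> nat -> nat) eta
    (M : n.+1.-tuple {set {set 'I_(2 * n.+1)}}) :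
  pnecklace n.+1 p -> sampled f n p eta ->
  (forall s, (s < n.+1)%N -> is_matching (nth finset.set0 M s)) ->
  (forall s, p s = partner (nth finset.set0 M s)) ->
  completely_generic n.+1 f /\ M = necklace_of n.+1 f.
Proof.
move=> pn sf' hM pE; have [fm sf rf inc] := sf'.
have [sg [sgE sgP]] := singular_angles_sampled pn sf'.
have sg0 s : (s < n)%N -> 0 < sg s < pi.
  move=> sn; have /andP[h1 h2] := sgE s sn.
  have [/andP[e1 _] _] := rf s (ltnW sn); have [/andP[_ e2] _] := rf s.+1 sn.
  by rewrite (lt_trans e1 h1) (lt_trans h2 e2).
have sg_inc s : (s.+1 < n)%N -> sg s < sg s.+1.
  move=> sn; have /andP[_ h] := sgE s (ltnW sn); have /andP[h' _] := sgE _ sn.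
  exact: lt_trans h h'.
pose S := mkseq sg n.
have S_sorted : sorted <%R S.
  apply/(sortedP 0) => i; rewrite size_mkseq => iN.
  by rewrite !nth_mkseq ?(ltnW iN) //; apply: sg_inc.
have S_uniq : uniq S by exact: lt_sorted_uniq.
have memS th : (th \in S) <-> singular_angles f th.
  split=> [/mapP[s]|[thP /singularP ns]].
    rewrite mem_iota /= add0n => sn ->; have /andP[h1 h2] := sg0 s sn.
    have h : 0 <= sg s < pi by rewrite (ltW h1).
    by split=> //; apply/singularP/(sgP _ h); exists s.
  by have [s sn ->] := (proj1 (sgP th thP)) ns; apply/mapP; exists s; rewrite // mem_iota.
pose X : {fset R} := [fset x in S]%fset.
have XE : singular_angles f = [set` X].
  by apply/seteqP; split=> th /=; rewrite !inE => /memS.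
have perm_XS : perm_eq X S.
  by apply: uniq_perm => // th; rewrite !inE.
have ns0 : nonsing f 0.
  apply: contrapT => ns; have h : 0 <= (0 : R) < pi by rewrite lexx pi_gt0.
  have [s sn e] := (proj1 (sgP 0 h)) ns.
  by have /andP[] := sg0 s sn; rewrite -e ltxx.
have f0 : f != 0 by rewrite -size_poly_gt0 sf.
split.
  split=> //.
  - by move=> z; apply: nonsing_simple_roots ns0 f0.
  - rewrite XE; apply/card_eq_fsetP; rewrite /= -[n](size_mkseq sg); exact: perm_size.
  - by move=> /singularP.
have sortE : sort <=%R (fset_set (singular_angles f)) = S.
  rewrite XE set_fsetK; apply: (sorted_eq le_trans le_anti).
  - exact: sort_le_sorted.
  - by move: S_sorted; rewrite lt_sorted_uniq_le => /andP[].
  - by rewrite perm_sort.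
have angE s : angle_seq f s = nth pi (0 :: S) s by rewrite /angle_seq sortE.
have ang0 : angle_seq f 0 = 0 by rewrite angE.
have angS s : (s < n)%N -> angle_seq f s.+1 = sg s by move=> sn; rewrite angE /= nth_mkseq.
(* The list [0 :: S] has n + 1 entries, so the index n + 1 returns the default pi. *)
have angn : angle_seq f n.+1 = pi by rewrite angE /= nth_default // size_mkseq.
have eta_ang s : (s < n.+1)%N -> angle_seq f s < eta s < angle_seq f s.+1.
  move=> sn; have [/andP[e0 e1] _] := rf s sn; apply/andP; split.
    case: s sn e0 {e1} => [|s] sn e0; first by rewrite ang0.
    by rewrite angS //; case/andP: (sgE s sn).
  move: sn; rewrite ltnS leq_eqVlt => /predU1P[->|sn].
    by rewrite angn; case: (rf n (ltnSn _)) => /andP[].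
  by rewrite angS //; case/andP: (sgE s sn).
have sg_le s s' : (s <= s')%N -> (s' < n)%N -> sg s <= sg s'.
  elim: s' => [|s' IH]; first by rewrite leqn0 => /eqP ->.
  rewrite leq_eqVlt => /predU1P[->//|]; rewrite ltnS => ss' sn.
  by apply: le_trans (IH ss' (ltnW sn)) (ltW (sg_inc _ sn)).
have ang_ns s th : (s < n.+1)%N -> angle_seq f s < th < angle_seq f s.+1 -> nonsing f th.
  move=> sn /andP[a1 a2].
  have th0 : 0 < th.
    case: s sn a1 {a2} => [|s] sn; rewrite ?ang0 // angS // => h.
    by apply: lt_trans h; case/andP: (sg0 s sn).
  have thpi : th < pi.
    move: (sn); rewrite ltnS leq_eqVlt => /predU1P[e|sn']; first by rewrite -angn -e.
    by apply: lt_trans a2 _; rewrite angS //; case/andP: (sg0 s sn').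
  apply: contrapT => ns; have h : 0 <= th < pi by rewrite (ltW th0).
  have [r rn e] := (proj1 (sgP th h)) ns.
  have [rs|sr] := ltnP r s.
    case: s sn a1 a2 rs => // s sn; rewrite angS // => a1 _; rewrite ltnS => rs.
    by have := sg_le _ _ rs sn; rewrite -e leNgt a1.
  have sn' : (s < n)%N by exact: leq_ltn_trans sr rn.
  by move: a2; rewrite angS // e ltNge sg_le.
have match_at s th : (s < n.+1)%N -> angle_seq f s < th < angle_seq f s.+1 ->
    curve_matching n.+1 f th = nth finset.set0 M s.
  move=> sn thP; apply: curve_matching_partner => //; first exact: hM.
  have [_ r] := rf s sn; rewrite -pE; have eP := eta_ang s sn.
  have [a1 a2] := andP thP; have [b1 b2] := andP eP.
  (* The gap contains the sample and no singular angle, so the matching is carried from eta s to th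
     in either direction. *)
  have [h|/ltW h] := leP (eta s) th.
    apply: (proj1 (realizes_const _ fm sf h _) r) => x /andP[x1 x2].
    by apply: (ang_ns s) => //; rewrite (lt_le_trans b1 x1) (le_lt_trans x2 a2).
  apply: (proj2 (realizes_const _ fm sf h _) r) => x /andP[x1 x2].
  by apply: (ang_ns s) => //; rewrite (lt_le_trans a1 x1) (le_lt_trans x2 b2).
apply: eq_from_tnth => i; rewrite tnth_mktuple (tnth_nth finset.set0).
have iN := ltn_ord i; apply/esym; apply: xget_subset1.
  by move=> th; apply: match_at.
(* The gap is not empty, as it contains the sample, so at most one constant value qualifies. *)
move=> A B hA hB; have eP := eta_ang i iN.
by rewrite -(hA _ eP) -(hB _ eP).
Qed.

End GenericPolynomial.

Theorem theorem1p5 (R : realType) (n : nat) (hn : (1 <= n)%N)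
  (M : n.-tuple {set {set 'I_(2 * n)}}) (hM : necklace M) :
  exists f : {poly R[i]}, completely_generic n f /\ M = necklace_of n f.
Proof.
case: n hn M hM => // n _ M hM; have pn := pnecklace_partner (ltn0Sn n) hM.
have [f [eta sf]] := @necklace_sampled R _ _ pn; exists f.
by apply: (sampled_generic pn sf) => // s sn; have [/(_ s sn)[]] := hM.
Qed.
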